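(* Let $u(t_n)$ be the solution at time $t_n$ of the variable-exponent subdiffusive Black-Scholes problem (P) described in the context, and let $U^n$ be its numerical approximation produced by the time-discrete scheme (D) described in the context, where $\tau=T/N$. Assume that $|q^{(j)}(t)|\le C_q$ for all $t\in[0,T]$, $j=0,1$, for some constant $C_q$ (with $q$ differentiable on $[0,T]$), and that the transformed solution $\omega$ satisfies the regularity assumption (R) of the context. Then, for $\tau$ sufficiently small, $$\|u(t_N)-U^N\|_A\le C(T)\,\tau^{\frac12+\frac32\alpha_0},\qquad \|u(t_N)-U^N\|_A:=\sqrt{\tau\sum_{l=1}^N\|u(t_l)-U^l\|^2},$$ where $C(T)$ is a positive constant independent of $N$ (equivalently of $\tau$).
   Context: Parameters: $T>0$, $\sigma>0$, $r\ge 0$, a bounded interval $(\bar a,\bar b)$; $\|\cdot\|$ is the norm of $L^2(\bar a,\bar b)$, $H^{m}=H^m(\bar a,\bar b)$, $H^0=L^2$. The variable exponent satisfies $\alpha\in W^{1,\infty}(0,T)$, $0<\alpha(t)\le\alpha^*<1$ on $[0,T]$, and $\alpha'(0)=0$. Put $\alpha_0=\alpha(0)$, $k(t)=\frac{t^{-\alpha(t)}}{\Gamma(1-\alpha(t))}$, $\beta_{\mu}(t)=\frac{t^{\mu-1}}{\Gamma(\mu)}$, and $(g_1*g_2)(t)=\int_0^t g_1(t-s)g_2(s)\,ds$. Define $$q(t)=(\beta_{\alpha_0}*k)(t)=\int_0^1\frac{(t\varsigma)^{\alpha_0-\alpha(t\varsigma)}}{\Gamma(1-\alpha(t\varsigma))}\,\frac{(1-\varsigma)^{\alpha_0-1}\varsigma^{-\alpha_0}}{\Gamma(\alpha_0)}\,d\varsigma,\qquad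 q(0)=1.$$ Problem (P): $$\partial_t^{\alpha(t)}u-\tfrac12\sigma^2\partial_x^2u-\big(r-\tfrac{\sigma^2}{2}\big)\partial_xu+ru=f(x,t)\ \text{ on }(\bar a,\bar b)\times(0,T),$$ $$u(\bar a,t)=u(\bar b,t)=0,\quad u(x,0)=\bar c_t(x),$$ where $\partial_t^{\alpha(t)}u=k*\partial_tu$. (Here $\bar c_t$ is the name of the initial datum, a function of $x$ only.) Transformed problem: let $\bar c_t^*(x)=\exp\left(-(\frac12-\frac{r}{\sigma^2})x\right)\bar c_t(x)$, $\chi(x,t)=\exp\left(-(\frac12-\frac r{\sigma^2})x\right)f(x,t)$, $\lambda=\frac12\left(\frac\sigma2+\frac r\sigma\right)^2$, and $\omega(x,t)=\exp\left(-(\frac12-\frac r{\sigma^2})x\right)u(x,t)-\bar c_t^*(x)$. Then $\omega$ solves $$\omega+q'*\omega-\tfrac12\sigma^2\beta_{\alpha_0}*\partial_x^2\omega+\lambda\beta_{\alpha_0}*\omega=F,\qquad \omega(\bar a,t)=\omega(\bar b,t)=0,\quad \omega(x,0)=0,$$ with $F(x,t)=\beta_{\alpha_0}(t)*\big(\tfrac12\sigma^2\partial_x^2\bar c_t^*(x)-\lambda\bar c_t^*(x)+\chi(x,t)\big)$. The data are assumed sufficiently regular, in particular $F(\cdot,t)\in L^2(\bar a,\bar b)$ at the time grid points. Regularity assumption (R): there is a constant $C$ with $$t\,\|\partial_t^2\omega(t)\|_{H^{2m}}+\|\partial_t\omega(t)\|_{H^{2m}}\le C t^{\alpha_0-1}\quad\text{for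 a.e. }t\in(0,T],\ m=0,1.$$ Scheme (D): for a positive integer $N$ let $\tau=T/N$, $t_n=n\tau$, $F^n=F(\cdot,t_n)$, and for $1\le j\le n\le N$ $$\varpi_{n,j}=\frac1\tau\int_{t_{n-1}}^{t_n}\int_{t_{j-1}}^{\min(t,t_j)}q'(t-s)\,ds\,dt,\qquad \widetilde\varpi_{n,j}=\frac1\tau\int_{t_{n-1}}^{t_n}\int_{t_{j-1}}^{\min(t,t_j)}\beta_{\alpha_0}(t-s)\,ds\,dt.$$ The functions $\mathcal W^n\in H^2(\bar a,\bar b)\cap H_0^1(\bar a,\bar b)$ satisfy $\mathcal W^0=0$ and, for $1\le n\le N$, $$\mathcal W^n+\sum_{j=1}^n\varpi_{n,j}\mathcal W^j+\lambda\sum_{j=1}^n\widetilde\varpi_{n,j}\mathcal W^j-\tfrac12\sigma^2\sum_{j=1}^n\widetilde\varpi_{n,j}\partial_x^2\mathcal W^j=F^n .$$ The numerical approximation of $u(t_n)=u(\cdot,t_n)$ is $U^n=\exp\left((\frac12-\frac r{\sigma^2})x\right)(\mathcal W^n+\bar c_t^* )$. *)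

(* Defs.v *)
From HB Require Import structures.
From mathcomp Require Import all_boot all_order all_algebra.
From mathcomp Require Import all_classical all_reals all_analysis.

Set Implicit Arguments.
Unset Strict Implicit.
Unset Printing Implicit Defensive.

Import Order.TTheory GRing.Theory Num.Theory.
Import numFieldNormedType.Exports.

Local Open Scope classical_set_scope.
Local Open Scope ring_scope.

(* Throughout, a function on an interval is a total function R -> R of which
   only the values on that interval matter, and an element u of a space of
   functions of (x, t) is written u x t. *)

(* One-sided at the end points of an interval D. *)
Definition deriv_on (R : realType) (D : set R) (g : R -> R) (t l : R) : Prop :=
  (fun s => (g s - g t) / (s - t)) @ within D t^' --> l.

Definition Gamma (R : realType) (z : R) : R :=
  \int[lebesgue_measure]_(s in `]0, +oo[) (s `^ (z - 1) * expR (- s)).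

Definition beta_ker (R : realType) (m t : R) : R := t `^ (m - 1) / Gamma m.

Definition convol (R : realType) (g1 g2 : R -> R) (t : R) : R :=
  \int[lebesgue_measure]_(s in `]0, t[) (g1 (t - s) * g2 s).

Definition in_Lp (R : realType) (p : \bar R) (a b : R) (v : R -> R) : Prop :=
  v \_ `]a, b[ \in Lfun (@lebesgue_measure R) p.

Definition normL2 (R : realType) (a b : R) (v : R -> R) : R :=
  fine ('N[@lebesgue_measure R]_(2%:E)[EFin \o (v \_ `]a, b[)])%E.

(* phi is of class C^1 with compact support in ]a, b[.  These are the test
   functions of Brezis, "Functional Analysis, Sobolev Spaces and PDEs", ch. 8;
   smooth ones give the same weak derivatives and the same space H^1_0. *)
Definition test_fun (R : realType) (a b : R) (phi : R -> R) : Prop :=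
  [/\ forall x, derivable phi x 1, continuous (derive1 phi) &
      exists c d : R, [/\ a < c, c < d, d < b &
        forall x, ~~ (c <= x <= d) -> phi x = 0]].

Definition weak_deriv (R : realType) (a b : R) (v g : R -> R) : Prop :=
  forall phi, test_fun a b phi ->
    \int[lebesgue_measure]_(x in `]a, b[) (v x * derive1 phi x) =
    - \int[lebesgue_measure]_(x in `]a, b[) (g x * phi x).

Definition is_wd (R : realType) (a b : R) (v g : R -> R) : Prop :=
  in_Lp 2%:E a b g /\ weak_deriv a b v g.

(* A version of the weak derivative of v in L^2(a, b); it is determined up to
   a null set when it exists, and meaningless otherwise. *)
Definition Dx (R : realType) (a b : R) (v : R -> R) : R -> R :=
  xget (fun=> 0) [set g | is_wd a b v g].

Definition in_H (R : realType) (a b : R) (m : nat) (v : R -> R) : Prop :=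
  in_Lp 2%:E a b v /\
  forall j, (j < m)%N -> is_wd a b (iter j (Dx a b) v) (iter j.+1 (Dx a b) v).

Definition normH (R : realType) (a b : R) (m : nat) (v : R -> R) : R :=
  Num.sqrt (\sum_(j < m.+1) normL2 a b (iter j (Dx a b) v) ^+ 2).

(* H^1_0(a, b), the closure of the test functions in H^1(a, b). *)
Definition in_H10 (R : realType) (a b : R) (v : R -> R) : Prop :=
  in_H a b 1 v /\
  forall e : R, 0 < e ->
    exists2 phi, test_fun a b phi & normH a b 1 (fun x => v x - phi x) < e.

(* alpha is the continuous representative of an element of W^{1,oo}(0, T). *)
Definition in_W1oo (R : realType) (T : R) (alpha : R -> R) : Prop :=
  [/\ {within `[0, T], continuous alpha}, in_Lp +oo%E 0 T alpha &
      exists2 g, in_Lp +oo%E 0 T g & weak_deriv 0 T alpha g].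

(* w is the time derivative of v : J -> L^2(a, b) in the Bochner sense: v is
   locally absolutely continuous on J, with v(t) - v(s) = \int_s^t w in
   L^2(a, b) for all s <= t in J.  Since w is jointly measurable, this Bochner
   integral can be computed for almost every fixed x. *)
Definition is_dt (R : realType) (a b : R) (J : interval R)
    (v w : R -> R -> R) : Prop :=
  [/\ measurable_fun (`]a, b[ `*` [set` J])
        (fun z : measurableTypeR R * measurableTypeR R => w z.1 z.2),
      forall t, t \in J -> in_Lp 2%:E a b (v^~ t) &
      forall s t, s \in J -> t \in J -> s <= t ->
        [/\ {ae @lebesgue_measure R, forall th, s < th < t ->
               in_Lp 2%:E a b (w^~ th)},
            (@lebesgue_measure R).-integrable `]s, t[
               (fun th => (normL2 a b (w^~ th))%:E) &
            {ae @lebesgue_measure R, forall x, a < x < b ->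
               v x t - v x s = \int[lebesgue_measure]_(th in `]s, t[) w x th}]].

Definition vker (R : realType) (alpha : R -> R) (t : R) : R :=
  t `^ (- alpha t) / Gamma (1 - alpha t).

(* q = beta_(alpha 0) * k on ]0, T], extended by q(0) = 1 *)
Definition qker (R : realType) (alpha : R -> R) (t : R) : R :=
  if t == 0 then 1 else convol (beta_ker (alpha 0)) (vker alpha) t.

(* u is a strong solution: the boundary conditions are expressed by
   u(t) \in H^1_0(a, b), the derivatives in x are weak ones, and the equation
   holds in L^2(a, b) for almost every t. *)
Definition is_solution (R : realType) (T sigma r a b : R) (alpha ct : R -> R)
    (f u : R -> R -> R) : Prop :=
  exists2 ut, is_dt a b `[0, T] u ut &
  [/\ forall t, 0 <= t <= T -> in_H a b 2 (u^~ t) /\ in_H10 a b (u^~ t),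
      {ae @lebesgue_measure R, forall x, a < x < b -> u x 0 = ct x} &
      {ae @lebesgue_measure R, forall t, 0 < t < T ->
        {ae @lebesgue_measure R, forall x, a < x < b ->
          convol (vker alpha) (ut x) t
            - 2^-1 * sigma ^+ 2 * Dx a b (Dx a b (u^~ t)) x
            - (r - sigma ^+ 2 / 2) * Dx a b (u^~ t) x + r * u x t = f x t}}].

Definition kappa (R : realType) (sigma r : R) : R := 2^-1 - r / sigma ^+ 2.

Definition lam (R : realType) (sigma r : R) : R :=
  2^-1 * (sigma / 2 + r / sigma) ^+ 2.

Definition transf (R : realType) (sigma r : R) (v : R -> R) (x : R) : R :=
  expR (- kappa sigma r * x) * v x.

Definition omega (R : realType) (sigma r : R) (ct : R -> R) (u : R -> R -> R)
    (x t : R) : R :=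
  transf sigma r (u^~ t) x - transf sigma r ct x.

Definition Fsrc (R : realType) (sigma r a b : R) (alpha ct : R -> R)
    (f : R -> R -> R) (x t : R) : R :=
  convol (beta_ker (alpha 0))
    (fun s => 2^-1 * sigma ^+ 2 * Dx a b (Dx a b (transf sigma r ct)) x
              - lam sigma r * transf sigma r ct x
              + transf sigma r (f^~ s) x) t.

Definition regularity (R : realType) (T a b alpha0 : R) (w : R -> R -> R) : Prop :=
  exists (w1 w2 : R -> R -> R) (C : R),
    [/\ is_dt a b `[0, T] w w1, is_dt a b `]0, T] w1 w2 &
        forall m : nat, (m <= 1)%N ->
        {ae @lebesgue_measure R, forall t, 0 < t <= T ->
          [/\ in_H a b (2 * m) (w1^~ t), in_H a b (2 * m) (w2^~ t) &
              t * normH a b (2 * m) (w2^~ t) + normH a b (2 * m) (w1^~ t)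
                <= C * t `^ (alpha0 - 1)]}].

Definition grid (R : realType) (T : R) (N n : nat) : R := n%:R * (T / N%:R).

Definition weight (R : realType) (T : R) (N : nat) (g : R -> R) (n j : nat) : R :=
  (T / N%:R)^-1 *
  \int[lebesgue_measure]_(t in `[grid T N n.-1, grid T N n])
    \int[lebesgue_measure]_(s in `[grid T N j.-1, Num.min t (grid T N j)])
      g (t - s).

(* dq stands for the derivative of qker alpha. *)
Definition is_scheme (R : realType) (T sigma r a b : R) (alpha dq ct : R -> R)
    (f : R -> R -> R) (N : nat) (W : nat -> R -> R) : Prop :=
  [/\ forall n, (n <= N)%N -> in_H a b 2 (W n) /\ in_H10 a b (W n),
      {ae @lebesgue_measure R, forall x, a < x < b -> W 0%N x = 0} &
      forall n, (1 <= n <= N)%N ->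
      {ae @lebesgue_measure R, forall x, a < x < b ->
        W n x + \sum_(1 <= j < n.+1) weight T N dq n j * W j x
          + lam sigma r *
            \sum_(1 <= j < n.+1) weight T N (beta_ker (alpha 0)) n j * W j x
          - 2^-1 * sigma ^+ 2 *
            \sum_(1 <= j < n.+1) weight T N (beta_ker (alpha 0)) n j
                                 * Dx a b (Dx a b (W j)) x
        = Fsrc sigma r a b alpha ct f x (grid T N n)}].

Definition Unum (R : realType) (sigma r : R) (ct : R -> R) (W : nat -> R -> R)
    (n : nat) (x : R) : R :=
  expR (kappa sigma r * x) * (W n x + transf sigma r ct x).

Definition errA (R : realType) (T a b : R) (N : nat) (u : R -> R -> R)
    (U : nat -> R -> R) : R :=
  Num.sqrt (T / N%:R * \sum_(1 <= l < N.+1)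
    normL2 a b (fun x => u x (grid T N l) - U l x) ^+ 2).

(* Main.v *)
(* The weights of the scheme are those of the product rule which integrates the
   kernel against the piecewise linear interpolant of the unknown, so the scheme
   is the transformed equation with each convolution replaced by its quadrature.

   Consistency.  By assumption (R), a function of the form y(t) = (omega(t), chi)
   grows like t^alpha0 near 0 and has second derivative of size t^(alpha0 - 2), so
   its interpolation error at s is at most of order
   tau^(1/2 + 3/2 alpha0) s^(-(1 + alpha0)/2), and convolution with a kernel of
   size t^(alpha0 - 1) gives tau^(1/2 + 3/2 alpha0) t_n^((alpha0 - 1)/2).  Testing
   against functions chi of class C^2 moves the derivatives in x to chi, and a
   duality argument turns these scalar bounds into an L^2 bound of the residual.
   The same testing shows that omega solves the transformed equation: convolving
   the equation of u with beta_alpha0 produces q * omega', which is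
   omega + q' * omega because q is Lipschitz.

   Stability.  The weights of beta_alpha0 are a convolution sequence w_k for which
   2 w_0, w_1, w_2, ... is convex, nonincreasing and nonnegative, hence of positive
   type (Fejer).  Testing the error equation with the error therefore leaves only
   the q' term, of size tau, which a discrete Gronwall argument absorbs.  The
   conclusion follows since tau sum_n t_n^(alpha0 - 1) is bounded. *)
Require Import Defs.
From HB Require Import structures.
From mathcomp Require Import all_boot all_order all_algebra.
From mathcomp Require Import all_classical all_reals all_analysis.
Import Order.TTheory GRing.Theory Num.Theory.
Import numFieldNormedType.Exports.
Local Open Scope classical_set_scope.
Local Open Scope ring_scope.
From mathcomp Require Import measurable_realfun zify ring lra.
Set Implicit Arguments.
Unset Strict Implicit.
Unset Printing Implicit Defensive.

(** * Integration on the line *)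

(** The rate p = 1/2 + 3/2 alpha0 comes from trading powers of tau for powers of s. Up to a constant
    the interpolation error is tau^p s^(alpha0 - p) for every p between alpha0 and 2. Convolution
    with s^(alpha0 - 1) needs alpha0 - p > -1 and yields tau^p t_n^(2 alpha0 - p), whose squares are
    summable when p < 1/2 + 2 alpha0. Since 0 < alpha0 < 1, the stated p meets both conditions, and
    the squares are t_n^(alpha0 - 1). Consistency is shaped by the fact that derivatives in x are
    versions chosen up to null sets and that the equation holds almost everywhere only. Pairing with
    a fixed chi leaves scalar functions of t, but every bound must then be proportional to the L^2
    norm of chi alone. For the pairing with chi'' this is achieved by returning both derivatives to
    the time derivatives of omega, which is where the H^2 norms of (R) enter. In the stability part,
    shifting the kernel gives convexity of the weights except at the first index, where the doubled
    w_0 meets the singularity at 0. There the sign is that of 7 - 4 * 2^(1 + alpha0) + 3^(1 +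
    alpha0), computed exactly. *)

Definition integ (R : realType) (f : R -> R) : Prop :=
  (@lebesgue_measure R).-integrable setT (EFin \o f).

(** The value is [fine] of the extended integral: linearity therefore asks for [integ], while
    nonnegativity does not. *)
Definition Int (R : realType) (f : R -> R) : R :=
  \int[@lebesgue_measure R]_x f x.

Section LineIntegral.
Context {R : realType}.
Local Notation mu := (@lebesgue_measure R).
Implicit Types (f g h : R -> R) (D : set R).

Lemma ae_mp (P Q : R -> Prop) : {ae mu, forall x, P x} ->
  (forall x, P x -> Q x) -> {ae mu, forall x, Q x}.
Proof.
by move=> aP PQ; apply: (@filterS _ _ (ae_filter_ringOfSetsType mu) _ _ _ aP).
Qed.

Lemma ae_and (P Q : R -> Prop) : {ae mu, forall x, P x} ->
  {ae mu, forall x, Q x} -> {ae mu, forall x, P x /\ Q x}.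
Proof.
by move=> aP aQ; apply: (@filterI _ _ (ae_filter_ringOfSetsType mu)).
Qed.

Lemma ae_mp2 (P Q S : R -> Prop) : {ae mu, forall x, P x} ->
  {ae mu, forall x, Q x} -> (forall x, P x -> Q x -> S x) ->
  {ae mu, forall x, S x}.
Proof.
by move=> aP aQ PQS; apply: (ae_mp (ae_and aP aQ)) => x [p q]; exact: PQS.
Qed.

Lemma integ_measurable f : integ f -> measurable_fun setT f.
Proof. by move=> /measurable_int /measurable_EFinP. Qed.

Lemma Int_EFin f : integ f -> (Int f)%:E = (\int[mu]_x (f x)%:E)%E.
Proof. by move=> fi; rewrite /Int /Rintegral fineK// integrable_fin_num. Qed.

Lemma integ_le f g : measurable_fun setT f -> integ g ->
  (forall x, `|f x| <= g x) -> integ f.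
Proof.
move=> mf ig fg; apply: (le_integrable _ _ _ ig) => //.
  exact/measurable_EFinP.
by move=> x _ /=; rewrite lee_fin (le_trans (fg x))// ler_norm.
Qed.

Lemma integD f g : integ f -> integ g -> integ (fun x => f x + g x).
Proof.
move=> fi gi; have /= := @integrableD _ _ _ mu setT measurableT _ _ fi gi.
exact.
Qed.

Lemma integZ k f : integ f -> integ (fun x => k * f x).
Proof.
by move=> fi; have /= := @integrableZl _ _ _ mu setT measurableT k _ fi; exact.
Qed.

Lemma integN f : integ f -> integ (fun x => - f x).
Proof.
by move=> fi; have /= := @integrableN _ _ _ mu setT _ fi; exact.
Qed.

Lemma integB f g : integ f -> integ g -> integ (fun x => f x - g x).
Proof. by move=> fi gi; apply: integD => //; exact: integN. Qed.

Lemma integ0 : integ (fun=> 0 : R).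
Proof. exact: integrable0. Qed.

Lemma integ_sum (I : Type) (s : seq I) (P : pred I) (F : I -> R -> R) :
  (forall i, P i -> integ (F i)) -> integ (fun x => \sum_(i <- s | P i) F i x).
Proof.
move=> Fi; elim: s => [|i s ih].
  have -> : (fun x => \sum_(i <- [::] | P i) F i x) = (fun=> 0).
    by apply/funext => x; rewrite big_nil.
  exact: integ0.
have -> : (fun x => \sum_(j <- i :: s | P j) F j x) =
    (fun x => (if P i then F i x else 0) + \sum_(j <- s | P j) F j x).
  by apply/funext => x; rewrite big_cons; case: ifP => // _; rewrite add0r.
by apply: integD => //; case: (boolP (P i)) => [/Fi//|_]; exact: integ0.
Qed.

Lemma integ_abs f : integ f -> integ (fun x => `|f x|).
Proof. exact: integrable_norm. Qed.

Lemma integ_abs_le f g : measurable_fun setT f -> integ g ->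
  (forall x, `|f x| <= `|g x|) -> integ f.
Proof. by move=> mf /integ_abs gi fg; exact: integ_le gi fg. Qed.

Lemma integ_mulb f g K : integ f -> measurable_fun setT g ->
  (forall x, `|g x| <= K) -> integ (fun x => g x * f x).
Proof.
move=> fi mg gK; apply: (@integ_le _ (fun x => K * `|f x|)).
- by apply: measurable_funM => //; exact: integ_measurable.
- exact/integZ/integ_abs.
- by move=> x; rewrite normrM ler_wpM2r.
Qed.

Lemma eq_Int f g : f =1 g -> Int f = Int g.
Proof. by move=> fg; apply: eq_Rintegral => x _; exact: fg. Qed.

Lemma IntD f g : integ f -> integ g -> Int (fun x => f x + g x) = Int f + Int g.
Proof. by move=> fi gi; exact: RintegralD. Qed.

Lemma IntZ k f : integ f -> Int (fun x => k * f x) = k * Int f.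
Proof. by move=> fi; exact: RintegralZl. Qed.

Lemma IntB f g : integ f -> integ g -> Int (fun x => f x - g x) = Int f - Int g.
Proof. by move=> fi gi; exact: RintegralB. Qed.

Lemma Int0 : Int (fun=> 0 : R) = 0.
Proof. by rewrite /Int /Rintegral integral0. Qed.

Lemma Int_sum (I : Type) (s : seq I) (P : pred I) (F : I -> R -> R) :
  (forall i, P i -> integ (F i)) ->
  Int (fun x => \sum_(i <- s | P i) F i x) = \sum_(i <- s | P i) Int (F i).
Proof.
move=> Fi; elim: s => [|i s ih].
  by rewrite big_nil (@eq_Int _ (fun=> 0)) ?Int0// => x; rewrite big_nil.
rewrite (@eq_Int _ (fun x => (if P i then F i x else 0) +
    \sum_(j <- s | P j) F j x)); last first.
  by move=> x; rewrite big_cons; case: ifP => // _; rewrite add0r.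
rewrite IntD ?ih ?big_cons; [|by case: (boolP (P i)) => [/Fi//|_]; exact: integ0|exact: integ_sum].
by case: (P i); rewrite ?Int0 ?add0r.
Qed.

Lemma Int_le f g : integ f -> integ g -> (forall x, f x <= g x) ->
  Int f <= Int g.
Proof. by move=> fi gi fg; exact: le_Rintegral. Qed.

Lemma Int_ge0 f : (forall x, 0 <= f x) -> 0 <= Int f.
Proof. by move=> f0; exact: Rintegral_ge0. Qed.

Lemma Int_abs f : integ f -> `|Int f| <= Int (fun x => `|f x|).
Proof. by move=> fi; exact: le_normr_Rintegral. Qed.

Lemma Int_abs_le f g : measurable_fun setT f -> integ g ->
  (forall x, `|f x| <= g x) -> `|Int f| <= Int g.
Proof.
move=> mf gi fg; have fi := integ_le mf gi fg.
by apply: (le_trans (Int_abs fi)); apply: Int_le => //; exact: integ_abs.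
Qed.

Lemma integ_ae f g : integ f -> measurable_fun setT g ->
  {ae mu, forall x, f x = g x} -> integ g.
Proof.
move=> fi mg fg; have mf := integ_measurable fi.
apply/integrableP; split; first exact/measurable_EFinP.
move/integrableP : fi => [_]; apply: le_lt_trans.
apply: ae_ge0_le_integral => //.
- by apply: measurableT_comp => //; exact/measurable_EFinP.
- by apply: measurableT_comp => //; exact/measurable_EFinP.
- by apply: (ae_mp fg) => x /= -> _.
Qed.

Lemma Int_ae f g : measurable_fun setT f -> measurable_fun setT g ->
  {ae mu, forall x, f x = g x} -> Int f = Int g.
Proof.
move=> mf mg fg; congr fine; apply: ae_eq_integral => //.
- exact/measurable_EFinP.
- exact/measurable_EFinP.
- by apply: (ae_mp fg) => x /= ->.
Qed.

Lemma integ_le_ae f g : measurable_fun setT f -> integ g ->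
  {ae mu, forall x, `|f x| <= g x} -> integ f.
Proof.
move=> mf gi fg; have mg := integ_measurable gi.
apply/integrableP; split; first exact/measurable_EFinP.
move/integrableP : (integ_abs gi) => [_]; apply: le_lt_trans.
apply: ae_ge0_le_integral => //.
- by apply: measurableT_comp => //; exact/measurable_EFinP.
- apply: measurableT_comp => //; apply/measurable_EFinP.
  exact: measurableT_comp.
- by apply: (ae_mp fg) => x /= h _;
    rewrite lee_fin normr_id (le_trans h)// ler_norm.
Qed.

Lemma Int_le_ae f g : integ f -> integ g -> {ae mu, forall x, f x <= g x} ->
  Int f <= Int g.
Proof.
move=> fi gi fg; rewrite -subr_ge0 -IntB//.
have mf := integ_measurable fi; have mg := integ_measurable gi.
rewrite (@Int_ae _ (fun x => Num.max 0 (g x - f x))).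
- by apply: Int_ge0 => x; rewrite le_max lexx.
- exact: measurable_funB.
- by apply: measurable_maxr => //; exact: measurable_funB.
- by apply: (ae_mp fg) => x h; rewrite max_r// subr_ge0.
Qed.

Lemma Int_abs_le_ae f g : measurable_fun setT f -> integ g ->
  {ae mu, forall x, `|f x| <= g x} -> `|Int f| <= Int g.
Proof.
move=> mf gi fg; have fi := integ_le_ae mf gi fg.
by apply: (le_trans (Int_abs fi)); apply: Int_le_ae => //; exact: integ_abs.
Qed.

Lemma Int_ge0_eq0 f : integ f -> (forall x, 0 <= f x) -> Int f = 0 ->
  {ae mu, forall x, f x = 0}.
Proof.
move=> fi f0 If0; have mf := integ_measurable fi.
have : (\int[mu]_(x in setT) `|(EFin \o f) x| = 0)%E.
  under eq_integral do rewrite gee0_abs//= ?lee_fin//.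
  by rewrite -Int_EFin// If0.
have mEf : measurable_fun setT (EFin \o f) by exact/measurable_EFinP.
move=> /(ae_eq_integral_abs mu measurableT mEf).
by move=> /ae_mp; apply => x /= /(_ I) [].
Qed.

(** Integrals over sets are rewritten as whole-line integrals of zero extensions, so that one set of
    lemmas suffices and translations and reflections need no bookkeeping of domains. *)
Lemma RintE D f : \int[mu]_(x in D) f x = Int (f \_ D).
Proof. exact: Rintegral_mkcond. Qed.

Lemma integ_restrict D f : measurable D ->
  mu.-integrable D (EFin \o f) <-> integ (f \_ D).
Proof.
by move=> mD; rewrite /integ -restrict_EFin; exact: integrable_mkcond.
Qed.

Lemma patch_itv (i : interval R) f x :
  (f \_ [set` i]) x = if x \in i then f x else 0.
Proof.
rewrite patchE; case: ifPn => [|]; first by rewrite inE/= => ->.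
by rewrite notin_setE/=; case: ifP.
Qed.

Lemma integ_dct (f_ : nat -> R -> R) f g :
  (forall n, measurable_fun setT (f_ n)) -> measurable_fun setT f -> integ g ->
  {ae mu, forall x n, `|f_ n x| <= g x} ->
  {ae mu, forall x, f_ ^~ x @ \oo --> f x} ->
  integ f /\ (fun n => Int (f_ n)) @ \oo --> Int f.
Proof.
move=> mf_ mf gi fg ff.
have h1 n : measurable_fun setT (EFin \o f_ n) by exact/measurable_EFinP.
have h2 : measurable_fun setT (EFin \o f) by exact/measurable_EFinP.
have h3 : {ae mu, forall x, setT x ->
    (fun n => (EFin \o f_ n) x) @ \oo --> (EFin \o f) x}.
  by apply: (ae_mp ff) => x h _; apply: cvg_EFin; [exact: nearW|exact: h].
have h4 : {ae mu, forall x n, setT x -> (`|(EFin \o f_ n) x| <= (EFin \o g) x)%E}.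
  by apply: (ae_mp fg) => x h n _ /=; rewrite lee_fin.
have [fi _ cv] := @dominated_convergence _ _ _ mu setT measurableT _ _ _ h1 h2 h3 gi h4.
split => //.
have -> : (fun n => Int (f_ n)) =
   fine \o (fun n => (\int[mu]_x (f_ n x)%:E)%E) by [].
apply: fine_cvg; rewrite fineK ?integrable_fin_num//.
Qed.

End LineIntegral.

(** * Fubini for real-valued integrals, translations and reflections *)

Section Fubini.
Context {R : realType}.
Local Notation mu := (@lebesgue_measure R).

Definition mplane (F : R -> R -> R) : Prop :=
  measurable_fun setT (fun z : measurableTypeR R * measurableTypeR R => F z.1 z.2).

Lemma mplaneC F : mplane F -> mplane (fun x y => F y x).
Proof. by move=> mF; exact: (measurableT_comp mF (@measurable_swap _ _ _ _)). Qed.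

Lemma mplane1 F x : mplane F -> measurable_fun setT (F x).
Proof. by move=> mF; exact: (measurable_fun_pair2 x mF). Qed.

Lemma mplane2 F y : mplane F -> measurable_fun setT (F^~ y).
Proof. by move=> mF; exact: (measurable_fun_pair1 y mF). Qed.

Lemma mplaneM F G : mplane F -> mplane G -> mplane (fun x y => F x y * G x y).
Proof. by move=> mF mG; exact: measurable_funM. Qed.

Lemma mplaneD F G : mplane F -> mplane G -> mplane (fun x y => F x y + G x y).
Proof. by move=> mF mG; exact: measurable_funD. Qed.

Lemma mplane_fst (f : R -> R) : measurable_fun setT f -> mplane (fun x _ => f x).
Proof. by move=> mf; exact: (measurableT_comp mf (@measurable_fst _ _ _ _)). Qed.

Lemma mplane_snd (f : R -> R) : measurable_fun setT f -> mplane (fun _ y => f y).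
Proof. by move=> mf; exact: (measurableT_comp mf (@measurable_snd _ _ _ _)). Qed.

Lemma mplane_sub (f : R -> R) : measurable_fun setT f -> mplane (fun x y => f (x - y)).
Proof.
move=> mf; apply: (measurableT_comp mf (g := fun z : measurableTypeR R * measurableTypeR R => z.1 - z.2)).
by apply: measurable_funB; [exact: measurable_fst|exact: measurable_snd].
Qed.

Lemma mplane_abs F : mplane F -> mplane (fun x y => `|F x y|).
Proof. by move=> mF; exact: measurableT_comp. Qed.

Lemma mplane_itv (i j : interval R) (F : R -> R -> R) :
  measurable_fun ([set` i] `*` [set` j])
    (fun z : measurableTypeR R * measurableTypeR R => F z.1 z.2) ->
  mplane (fun x y => if (x \in i) && (y \in j) then F x y else 0).
Proof.
move=> mF.
have mij : measurable ([set` i] `*` [set` j] : set (measurableTypeR R * measurableTypeR R)).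
  by apply: measurableX => //; exact: measurable_itv.
have {}mF := (measurable_restrictT _ mij).1 mF.
apply: eq_measurable_fun mF => //= z _.
rewrite patchE; case: ifPn => [|]; first by rewrite inE => -[/= -> ->].
rewrite notin_setE => /not_andP h; case: ifP => // /andP[h1 h2].
by exfalso; case: h => /=; rewrite ?h1 ?h2.
Qed.

(** No integrability is assumed: Tonelli makes the integrals of the positive and negative parts
    measurable, and [fine] is measurable even where their difference is infinite. *)
Lemma mplane_Int (F : R -> R -> R) : mplane F -> measurable_fun setT (fun x => Int (F x)).
Proof.
move=> mF; apply: (@measurableT_comp _ _ _ _ _ _ (@fine R)) => //.
set f := fun z : measurableTypeR R * measurableTypeR R => (F z.1 z.2)%:E.
have mf : measurable_fun setT f by exact/measurable_EFinP.
have -> : (fun x => \int[mu]_y (F x y)%:E)%E =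
  (fun x => \int[mu]_y f^\+ (x, y) - \int[mu]_y f^\- (x, y))%E.
  apply/funext => x; rewrite [LHS]integralE.
  congr (_ - _)%E; apply: eq_integral => y _.
    by rewrite !funeposE.
  by rewrite !funenegE.
apply: emeasurable_funB.
  apply: (@measurable_fun_fubini_tonelli_F _ _ _ _ R mu (f^\+)%E) => //.
  exact: measurable_funepos.
apply: (@measurable_fun_fubini_tonelli_F _ _ _ _ R mu (f^\-)%E) => //.
exact: measurable_funeneg.
Qed.

(** The bound by [G] makes one iterated integral of [|F|] finite, so Tonelli gives joint
    integrability. It is asked for almost every [y] only, because the slices come from Bochner
    derivatives and from an equation valid almost everywhere. *)
Lemma Int_fubini (F : R -> R -> R) (G : R -> R) :
  mplane F -> integ G ->
  {ae mu, forall y, integ (F^~ y) /\ Int (fun x => `|F x y|) <= G y} ->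
  [/\ Int (fun x => Int (F x)) = Int (fun y => Int (F^~ y)),
      {ae mu, forall x, integ (F x)},
      integ (fun x => Int (F x)) & integ (fun y => Int (F^~ y))].
Proof.
move=> mF iG FG.
set f := fun z : measurableTypeR R * measurableTypeR R => (F z.1 z.2)%:E.
have mf : measurable_fun setT f by exact/measurable_EFinP.
have if_ : (mu \x mu)%E.-integrable setT f.
  apply/integrable21ltyP => //.
  apply: (@le_lt_trans _ _ (\int[mu]_y `|(G y)%:E|)%E); last first.
    by move/integrableP : iG => [].
  apply: ae_ge0_le_integral => //.
  - by move=> y _; exact: integral_ge0.
  - apply: (measurable_fun_fubini_tonelli_G (abse \o f)).
      by apply: (measurableT_comp _ mf).
    by move=> x; rewrite /= lee_fin.
  - by apply: measurableT_comp => //; apply/measurable_EFinP; exact: integ_measurable.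
  - apply: (ae_mp FG) => y [iy le] _.
    rewrite [leLHS](_ : _ = (Int (fun x => `|F x y|))%:E).
      by rewrite lee_fin (le_trans le)// ler_norm.
    by rewrite Int_EFin //; exact: integ_abs.
have a1 : {ae mu, forall x, integ (F x)} by exact: (ae_integrable1 if_).
have a2 : {ae mu, forall y, integ (F^~ y)} by exact: (ae_integrable2 if_).
have m1 := mplane_Int mF.
have m2 := mplane_Int (mplaneC mF).
have i1 : integ (fun x => Int (F x)).
  apply/integrableP; split; first exact/measurable_EFinP.
  have /integrableP[mm] := integrable_fubini_F if_; apply: le_lt_trans.
  apply: ae_ge0_le_integral => //.
  - by apply: measurableT_comp => //; apply/measurable_EFinP.
  - exact: measurableT_comp.
  - apply: (ae_mp a1) => x ix _.
    have -> : fubini_F mu f x = (Int (F x))%:E by rewrite Int_EFin.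
    by [].
have i2 : integ (fun y => Int (F^~ y)).
  apply: (integ_le_ae m2 iG); apply: (ae_mp FG) => y [iy]; apply: le_trans.
  exact: Int_abs.
split; [|exact: a1|exact: i1|exact: i2].
have := Fubini if_ => e; congr fine.
transitivity (\int[mu]_x \int[mu]_y f (x, y))%E.
  apply: ae_eq_integral => //.
  - exact/measurable_EFinP.
  - by have /integrableP[] := integrable_fubini_F if_.
  - by apply: (ae_mp a1) => x ix _; exact: Int_EFin.
rewrite e; apply: ae_eq_integral => //.
- exact: (measurable_fubini_G if_).
- exact/measurable_EFinP.
- by apply: (ae_mp a2) => x ix _; exact/esym/Int_EFin.
Qed.

(** A map under which preimages of half-open intervals keep their length preserves Lebesgue measure,
    by uniqueness of that measure. Translations and reflections are both instances. *)
Lemma Int_pushforward (e : R -> R) : measurable_fun setT e ->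
  (forall a b, mu `]a, b] = mu (e @^-1` `]a, b])) ->
  forall f : R -> R, integ f -> integ (f \o e) /\ Int (f \o e) = Int f.
Proof.
move=> me eX f fi; have mf := integ_measurable fi.
pose e_mixin := isMeasurableFun.Build _ _ (measurableTypeR R) (measurableTypeR R) e me.
pose e' : {mfun measurableTypeR R >-> measurableTypeR R} := HB.pack e e_mixin.
have E A : measurable A -> mu A = pushforward mu e' A.
  by apply: lebesgue_measure_unique => _ [[a b] _ <-]; exact: eX.
have EI g : (\int[mu]_x g x = \int[pushforward mu e']_x g x)%E.
  by apply: eq_measure_integral => A mA _; exact: E.
have ife : integ (f \o e).
  apply/integrableP; split; first by apply/measurable_EFinP; exact: measurableT_comp.
  have /integrableP[_] := fi; apply: le_lt_trans.
  rewrite [leRHS]EI ge0_integral_pushforward//.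
  by apply: (measurableT_comp _ (measurableT_comp _ mf)).
split => //; congr fine; rewrite [RHS]EI integral_pushforward//.
exact/measurable_EFinP.
Qed.

Lemma Int_shift c (f : R -> R) : integ f ->
  integ (fun x => f (x + c)) /\ Int (fun x => f (x + c)) = Int f.
Proof.
move=> fi; apply: Int_pushforward => //; first exact: measurable_funD.
move=> a b.
have -> : (fun x => x + c) @^-1` `]a, b] = `]a - c, b - c]%classic.
  by apply/seteqP; split => x /=; rewrite !in_itv/= ltrBlDr lerBrDr.
rewrite !lebesgue_measure_itv/= !lte_fin ltrD2r -!EFinD.
by case: ifP => // _; congr (_%:E); ring.
Qed.

Lemma Int_refl c (f : R -> R) : integ f ->
  integ (fun x => f (c - x)) /\ Int (fun x => f (c - x)) = Int f.
Proof.
move=> fi; apply: Int_pushforward => //; first exact: measurable_funB.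
move=> a b.
have -> : (fun x => c - x) @^-1` `]a, b] = `[c - b, c - a[%classic.
  by apply/seteqP; split => x /=; rewrite !in_itv/=;
    move=> /andP[h1 h2]; apply/andP; split; lra.
rewrite !lebesgue_measure_itv/= !lte_fin -!EFinD.
have -> : (c - b < c - a) = (a < b) by lra.
by case: ifP => // _; congr (_%:E); ring.
Qed.

End Fubini.

(** * Integrals over bounded intervals, and the integral of a power *)

Section PowerIntegral.
Context {R : realType}.
Local Notation mu := (@lebesgue_measure R).

Lemma measurable_patch_itv (i : interval R) (f : R -> R) :
  measurable_fun setT f -> measurable_fun setT (f \_ [set` i]).
Proof.
move=> mf; apply: (measurable_restrictT f (measurable_itv i)).1.
exact: measurable_funTS.
Qed.

Lemma integ_itv (i : interval R) (f : R -> R) : integ f -> integ (f \_ [set` i]).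
Proof.
move=> fi; apply: (integ_abs_le _ fi).
  by apply: measurable_patch_itv; exact: integ_measurable.
by move=> x; rewrite patch_itv; case: ifP => // _; rewrite normr0.
Qed.

Lemma integ_cst_itv (b0 b1 : bool) (a b k : R) :
  integ ((fun=> k) \_ [set` Interval (BSide b0 a) (BSide b1 b)]).
Proof.
apply/(integ_restrict _ (measurable_itv _)).
apply: measurable_bounded_integrable => //.
- rewrite /= lebesgue_measure_itv; case: ifP => _; rewrite ?ltry//.
- exists `|k|; split; first exact: num_real.
  by move=> M kM x _; exact: ltW.
Qed.

Lemma integ_bounded_itv (b0 b1 : bool) (a b k : R) (f : R -> R) :
  let i := Interval (BSide b0 a) (BSide b1 b) in
  measurable_fun setT (f \_ [set` i]) ->
  (forall x, x \in i -> `|f x| <= k) -> integ (f \_ [set` i]).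
Proof.
move=> i mf fk; apply: (integ_le mf (integ_cst_itv b0 b1 a b k)) => x.
by rewrite !patch_itv; case: ifPn => [|_]; [exact: fk|rewrite normr0].
Qed.

Lemma Int_cst_oc (a b k : R) : a <= b -> Int ((fun=> k) \_ `]a, b]) = k * (b - a).
Proof.
move=> ab; rewrite -RintE Rintegral_cst//= lebesgue_measure_itv/= lte_fin.
by move: ab; rewrite le_eqVlt => /predU1P[->|->//]; rewrite ltxx subrr.
Qed.

Lemma ae_neq (c : R) : {ae mu, forall x, x != c}.
Proof.
exists [set c]; split => //; first exact: lebesgue_measure_set1.
by move=> x /= /negP; rewrite negbK => /eqP.
Qed.

(** The two zero extensions differ at most at [a] and [b]. Measurability is transported explicitly,
    since equality almost everywhere does not preserve Borel measurability. *)
Lemma Int_bnd_eq (b0 b1 b0' b1' : bool) (a b : R) (f : R -> R) :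
  let i := Interval (BSide b0 a) (BSide b1 b) in
  let j := Interval (BSide b0' a) (BSide b1' b) in
  measurable_fun setT (f \_ [set` i]) ->
  measurable_fun setT (f \_ [set` j]) /\ Int (f \_ [set` i]) = Int (f \_ [set` j]).
Proof.
move=> i j mf.
have fE : f \_ [set` j] = fun x => if x == a then (if a \in j then f a else 0) else
    if x == b then (if b \in j then f b else 0) else (f \_ [set` i]) x.
  apply/funext => x; rewrite !patch_itv.
  case: eqP => [->//|/eqP xa]; case: eqP => [->//|/eqP xb].
  congr (if _ then _ else _).
  by rewrite /i /j; case: b0 {i mf} b1 b0' {j} b1' => [] [] [] []; rewrite !in_itv/=;
    rewrite ?(le_eqVlt a x) ?(le_eqVlt x b) ?(eq_sym a x) ?(negbTE xa) ?(negbTE xb).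
have mj : measurable_fun setT (f \_ [set` j]).
  rewrite fE; apply: measurable_fun_ifT => //; first exact: measurable_fun_eqr.
  by apply: measurable_fun_ifT => //; first exact: measurable_fun_eqr.
split => //; apply: Int_ae => //.
apply: (ae_mp2 (ae_neq a) (ae_neq b)) => x xa xb.
by rewrite [RHS](congr1 (fun g => g x) fE) /= (negbTE xa) (negbTE xb).
Qed.

Lemma Int_FTC (f F : R -> R) (a b : R) : a <= b ->
  (forall x, a <= x <= b -> is_derive x 1 F (f x)) ->
  (forall x, a <= x <= b -> {for x, continuous f}) ->
  integ (f \_ `]a, b]) /\ Int (f \_ `]a, b]) = F b - F a.
Proof.
rewrite le_eqVlt => /predU1P[-> _ _|ab dF cf].
  rewrite subrr set_itv_ge ?bnd_simp ?ltxx//.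
  have -> : f \_ set0 = (fun=> 0) by apply/funext => x; rewrite patchE in_set0.
  by rewrite Int0; split => //; exact: integ0.
have cab : {within `[a, b], continuous f}.
  by apply: continuous_in_subspaceT => x /[!inE]/= /[!in_itv]/=; exact: cf.
have ifab : mu.-integrable `[a, b] (EFin \o f).
  apply: continuous_compact_integrable => //; exact: segment_compact.
have ii : integ (f \_ `[a, b]) by apply/(integ_restrict _ (measurable_itv _)).
have [mj eq] := @Int_bnd_eq true false false false a b f (integ_measurable ii).
have FTC : (\int[mu]_(x in `[a, b]) (f x)%:E = (F b)%:E - (F a)%:E)%E.
  have dFx x : a <= x <= b -> derivable F x 1 by move=> /dF [].
  have cF x : a <= x <= b -> {for x, continuous F}.
    by move=> /dFx /derivable1_diffP /differentiable_continuous.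
  apply: continuous_FTC2 => //.
    split.
    - by move=> x /[!in_itv]/= /andP[h1 h2]; apply: dFx; rewrite !ltW.
    - apply: cvg_at_right_filter; apply: cF; rewrite lexx; exact: ltW.
    - by apply: cvg_at_left_filter; apply: cF; rewrite lexx ltW.
  move=> x /[!in_itv]/= /andP[h1 h2]; rewrite derive1E.
  by have [_] := dF x ltac:(by rewrite !ltW).
split.
  apply: (integ_le mj (integ_abs ii)) => x; rewrite !patch_itv !in_itv/=.
  case: ifP => [/andP[/ltW -> ->]//|_]; rewrite normr0; by case: ifP.
by rewrite -eq -RintE /Rintegral FTC.
Qed.

(** For [p < 1] the integrand is unbounded at 0. The fundamental theorem is applied on []u n, c]]
    with [u n] decreasing to 0, and monotone convergence reaches []0, c]]. *)
Lemma Int_powR (p c : R) : 0 < p -> 0 <= c ->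
  integ ((fun s => s `^ (p - 1)) \_ `]0, c]) /\
  Int ((fun s => s `^ (p - 1)) \_ `]0, c]) = c `^ p / p.
Proof.
move=> p0; rewrite le_eqVlt => /predU1P[<-|c0].
  rewrite set_itv_ge ?bnd_simp ?ltxx// powR0 ?gt_eqF// mul0r.
  have -> : (fun s : R => s `^ (p - 1)) \_ set0 = (fun=> 0) :> (R -> R).
    by apply/funext => x; rewrite patchE in_set0.
  by rewrite Int0; split => //; exact: integ0.
pose f (s : R) := s `^ (p - 1).
pose u n : R := c * n.+1%:R^-1.
have u0 n : 0 < u n by rewrite mulr_gt0.
have uc n : u n <= c by rewrite ger_pMr// invf_le1// ler1n.
have fn n : (\int[mu]_(x in `]u n, c]) (f x)%:E = ((c `^ p - u n `^ p) / p)%:E)%E.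
  have [||fi fe] := @Int_FTC f (fun s => p^-1 * s `^ p) _ _ (uc n).
  - move=> x /andP[ux _]; have x0 := lt_le_trans (u0 n) ux.
    have h := is_derive1_powR p x0.
    apply: is_derive_eq; rewrite /GRing.scale/= /f.
    by rewrite mulrA mulVf ?mul1r// gt_eqF.
  - move=> x /andP[ux _]; have x0 := lt_le_trans (u0 n) ux.
    have h := is_derive1_powR (p - 1) x0.
    by apply: differentiable_continuous; apply/derivable1_diffP; case: h.
  have := Int_EFin fi; rewrite fe => E.
  rewrite integral_mkcond restrict_EFin -E; congr (_%:E).
  by rewrite -mulrBr mulrC.
have bc : \bigcup_n `]u n, c]%classic = `]0, c]%classic.
  apply/seteqP; split => x /=.
    by move=> [n _ /=]; rewrite !in_itv/= => /andP[/(lt_trans (u0 n)) -> ->].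
  rewrite in_itv/= => /andP[x0 xc].
  have /ltr_add_invr [n] : 0 < x / c by rewrite divr_gt0.
  rewrite add0r => h; exists n => //=; rewrite in_itv/= xc andbT.
  by rewrite /u mulrC -ltr_pdivlMr.
have ndS : nondecreasing_seq (fun n => `]u n, c]%classic : set R).
  apply/nondecreasing_seqP => n; rewrite subsetEset => x /=; rewrite !in_itv/=.
  move=> /andP[h ->]; rewrite andbT (le_lt_trans _ h)// ler_wpM2l ?(ltW c0)//.
  by rewrite lef_pV2 ?posrE// ler_nat.
have mf (D : set R) : measurable_fun D (EFin \o f).
  by apply/measurable_EFinP; apply: measurable_funTS; exact: measurable_powR.
have cv : (\int[mu]_(x in `]u n, c]) (EFin \o f) x)%E @[n --> \oo] -->
    (\int[mu]_(x in `]0%R, c]) (EFin \o f) x)%E.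
  rewrite -bc; apply: ge0_nondecreasing_set_cvg_integral => //.
    by move=> n; exact: mf.
  by move=> n x _; rewrite /= lee_fin powR_ge0.
have : ((c `^ p - u n `^ p) / p)%:E @[n --> \oo] --> (c `^ p / p)%:E.
  apply: cvg_EFin; first exact: nearW.
  rewrite [X in _ --> X](_ : _ = (c `^ p - 0) / p); last by rewrite subr0.
  apply: cvgMl; apply: cvgB; first exact: cvg_cst.
  have := powR_cvg0 p0; move/cvg_at_rightP; apply; split => //.
  rewrite -(mulr0 c); apply: cvgMr.
  exact: cvg_harmonic.
move=> cv2.
have E : (\int[mu]_(x in `]0%R, c]) (f x)%:E = (c `^ p / p)%:E)%E.
  apply: (@cvg_unique _ (@ereal_hausdorff R) _ _ _ _ cv).
  have -> : (fun n => \int[mu]_(x in `]u n, c]) (EFin \o f) x)%E =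
    (fun n => ((c `^ p - u n `^ p) / p)%:E) by apply/funext => n; exact: fn.
  exact: cv2.
have fi : integ (f \_ `]0, c]).
  apply/(integ_restrict _ (measurable_itv _)).
  apply/integrableP; split; first exact: mf.
  under eq_integral do rewrite /= ger0_norm ?powR_ge0//.
  by rewrite E ltry.
by split => //; rewrite -RintE /Rintegral E.
Qed.

End PowerIntegral.

(** * Square-integrable functions and weak derivatives *)

Definition ip (R : realType) (a b : R) (v w : R -> R) : R :=
  Int ((fun x => v x * w x) \_ `]a, b[).

Section SquareIntegrable.
Context {R : realType} (a b : R).
Local Notation mu := (@lebesgue_measure R).
Local Notation L2 := (in_Lp 2%:E a b).
Local Notation ip := (ip a b).
Implicit Types (u v w g : R -> R).

Lemma patchM v w x : ((fun x => v x * w x) \_ `]a, b[) x =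
  (v \_ `]a, b[) x * (w \_ `]a, b[) x.
Proof. by rewrite !patch_itv; case: ifP => // _; rewrite mulr0. Qed.

Lemma in_Lp2P v : L2 v <-> measurable_fun setT (v \_ `]a, b[) /\
  integ (fun x => (v \_ `]a, b[) x ^+ 2).
Proof.
rewrite /in_Lp; set f := v \_ _; split=> [fL|[mf fi]].
  split; last exact: Lfun2_integrable_sqr.
  by move: fL; rewrite inE => /andP[]; rewrite inE.
rewrite inE; apply/andP; split; rewrite inE//= /finite_norm unlock /=.
apply: poweR_lty.
have /integrableP[_] := fi; apply: le_lt_trans.
rewrite le_eqVlt; apply/orP; left; apply/eqP; apply: eq_integral => x _.
by rewrite /= powR_mulrn// normrX.
Qed.

Lemma L2_measurable v : L2 v -> measurable_fun setT (v \_ `]a, b[).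
Proof. by move=> /in_Lp2P[]. Qed.

Lemma integ_ip v w : L2 v -> L2 w -> integ ((fun x => v x * w x) \_ `]a, b[).
Proof.
move=> /in_Lp2P[mv vi] /in_Lp2P[mw wi].
have -> : (fun x => v x * w x) \_ `]a, b[ =
  (fun x => (v \_ `]a, b[) x * (w \_ `]a, b[) x).
  by apply/funext => x; rewrite patchM.
apply: (integ_le (measurable_funM mv mw) (integD vi wi)) => x.
set p := (v \_ _) x; set q := (w \_ _) x.
rewrite normrM -(real_normK (num_real p)) -(real_normK (num_real q)).
have := normr_ge0 p; have := normr_ge0 q; set p' := `|p|; set q' := `|q| => q0 p0.
by nra.
Qed.

Lemma L2_le v w K : L2 v -> measurable_fun setT (w \_ `]a, b[) ->
  (forall x, a < x < b -> `|w x| <= K * `|v x|) -> L2 w.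
Proof.
move=> /in_Lp2P[mv vi] mw wv; apply/in_Lp2P; split => //.
apply: (integ_le _ (integZ (K ^+ 2) vi)); first exact: measurable_funX.
move=> x; rewrite ger0_norm ?sqr_ge0// !patch_itv in_itv/=.
case: ifPn => [/wv h|_]; last by rewrite expr0n/= mulr0.
rewrite -[leLHS]real_normK ?num_real// -[in leRHS](real_normK (num_real (v x))).
by rewrite -exprMn lerXn2r// nnegrE (le_trans _ h).
Qed.

Lemma L2D v w : L2 v -> L2 w -> L2 (fun x => v x + w x).
Proof.
move=> Lv Lw; have := integ_ip Lv Lw.
move: Lv Lw => /in_Lp2P[mv vi] /in_Lp2P[mw wi] vwi.
have E x : ((fun x => v x + w x) \_ `]a, b[) x =
    (v \_ `]a, b[) x + (w \_ `]a, b[) x.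
  by rewrite !patch_itv; case: ifP => // _; rewrite addr0.
apply/in_Lp2P; split.
  have -> : (fun x => v x + w x) \_ `]a, b[ = (v \_ `]a, b[) \+ (w \_ `]a, b[).
    by apply/funext.
  exact: measurable_funD.
have := integD (integD vi wi) (integZ 2 vwi).
congr integ; apply/funext => x.
by rewrite E patchM; ring.
Qed.

Lemma L2_mulb g v K : measurable_fun setT (g \_ `]a, b[) ->
  (forall x, a < x < b -> `|g x| <= K) -> L2 v -> L2 (fun x => g x * v x).
Proof.
move=> mg gK Lv; apply: (@L2_le v _ K) => //.
  have -> : (fun x => g x * v x) \_ `]a, b[ =
    (fun x => (g \_ `]a, b[) x * (v \_ `]a, b[) x).
    by apply/funext => x; rewrite patchM.
  by apply: measurable_funM => //; exact: L2_measurable.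
by move=> x /gK h; rewrite normrM ler_wpM2r.
Qed.

Lemma measurable_patch_cst (k : R) :
  measurable_fun setT ((fun=> k : R) \_ `]a, b[ : R -> R).
Proof. exact: measurable_patch_itv. Qed.

Lemma L2Z k v : L2 v -> L2 (fun x => k * v x).
Proof. by apply: (@L2_mulb (fun=> k) v `|k|) => //; exact: measurable_patch_cst. Qed.

Lemma L2N v : L2 v -> L2 (fun x => - v x).
Proof.
move=> /(L2Z (-1)); congr (in_Lp _ _ _); by apply/funext => x; rewrite mulN1r.
Qed.

Lemma L2B v w : L2 v -> L2 w -> L2 (fun x => v x - w x).
Proof. by move=> Lv Lw; apply: L2D => //; exact: L2N. Qed.

Lemma L2_bounded v K : measurable_fun setT (v \_ `]a, b[) ->
  (forall x, a < x < b -> `|v x| <= K) -> L2 v.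
Proof.
move=> mv vK; apply/in_Lp2P; split => //.
have E : (fun x => (v \_ `]a, b[) x ^+ 2) = (fun x => v x ^+ 2) \_ `]a, b[.
  by apply/funext => x; rewrite !patch_itv; case: ifP; rewrite ?expr0n.
rewrite E; apply: (@integ_bounded_itv _ _ _ _ _ (K ^+ 2)).
  by rewrite -E; exact: measurable_funX.
move=> x; rewrite in_itv/= => /vK h; rewrite normrX lerXn2r ?nnegrE//.
exact: le_trans h.
Qed.

Lemma L2_cst k : L2 (fun=> k).
Proof. by apply: (@L2_bounded _ `|k|) => //; exact: measurable_patch_cst. Qed.

Lemma L2_sum (I : Type) (s : seq I) (P : pred I) (F : I -> R -> R) :
  (forall i, P i -> L2 (F i)) -> L2 (fun x => \sum_(i <- s | P i) F i x).
Proof.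
move=> LF; elim: s => [|i s ih].
  have := L2_cst 0; congr (in_Lp _ _ _); by apply/funext => x; rewrite big_nil.
have -> : (fun x => \sum_(j <- i :: s | P j) F j x) =
    (fun x => (if P i then F i x else 0) + \sum_(j <- s | P j) F j x).
  by apply/funext => x; rewrite big_cons; case: ifP => // _; rewrite add0r.
by apply: L2D => //; case: (boolP (P i)) => [/LF//|_]; exact: L2_cst.
Qed.

Lemma ipC v w : ip v w = ip w v.
Proof. by apply: eq_Int => x; rewrite !patchM mulrC. Qed.

Lemma ipDl u v w : L2 u -> L2 v -> L2 w ->
  ip (fun x => u x + v x) w = ip u w + ip v w.
Proof.
move=> Lu Lv Lw; rewrite /ip -IntD; [|exact: integ_ip..].
by apply: eq_Int => x; rewrite !patch_itv; case: ifP; rewrite ?addr0// mulrDl.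
Qed.

Lemma ipZl k v w : L2 v -> L2 w -> ip (fun x => k * v x) w = k * ip v w.
Proof.
move=> Lv Lw; rewrite /ip -IntZ; last exact: integ_ip.
by apply: eq_Int => x; rewrite !patch_itv; case: ifP; rewrite ?mulr0// mulrA.
Qed.

Lemma ipZr k v w : L2 v -> L2 w -> ip w (fun x => k * v x) = k * ip w v.
Proof. by move=> *; rewrite ipC ipZl// !(ipC w). Qed.

Lemma ipNl v w : L2 v -> L2 w -> ip (fun x => - v x) w = - ip v w.
Proof.
move=> Lv Lw; rewrite -[RHS]mulN1r -ipZl//; congr ip.
by apply/funext => x; rewrite mulN1r.
Qed.

Lemma ipBl u v w : L2 u -> L2 v -> L2 w ->
  ip (fun x => u x - v x) w = ip u w - ip v w.
Proof. by move=> Lu Lv Lw; rewrite ipDl ?ipNl//; exact: L2N. Qed.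

Lemma ipBr u v w : L2 u -> L2 v -> L2 w ->
  ip w (fun x => u x - v x) = ip w u - ip w v.
Proof. by move=> *; rewrite ipC ipBl// !(ipC w). Qed.

Lemma ip_suml (I : Type) (s : seq I) (P : pred I) (F : I -> R -> R) w :
  (forall i, P i -> L2 (F i)) -> L2 w ->
  ip (fun x => \sum_(i <- s | P i) F i x) w = \sum_(i <- s | P i) ip (F i) w.
Proof.
move=> LF Lw; rewrite /ip -Int_sum; last by move=> i Pi; apply: integ_ip => //; exact: LF.
apply: eq_Int => x; rewrite patch_itv; case: ifPn => h.
  by rewrite mulr_suml; apply: eq_bigr => i _; rewrite patch_itv h.
by rewrite big1// => i _; rewrite patch_itv (negbTE h).
Qed.

Lemma ip_ge0 v : 0 <= ip v v.
Proof. by apply: Int_ge0 => x; rewrite patchM -expr2 sqr_ge0. Qed.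

Lemma ip_ae u v w : L2 u -> L2 v -> L2 w ->
  {ae mu, forall x, a < x < b -> u x = v x} -> ip u w = ip v w.
Proof.
move=> Lu Lv Lw uv; apply: Int_ae.
- exact: integ_measurable (integ_ip Lu Lw).
- exact: integ_measurable (integ_ip Lv Lw).
- apply: (ae_mp uv) => x h; rewrite !patch_itv in_itv/=.
  by case: ifPn => // /h ->.
Qed.

Lemma normL2_ge0 v : 0 <= normL2 a b v.
Proof. by rewrite fine_ge0// Lnorm_ge0. Qed.

Lemma normL2_sqr v : L2 v -> normL2 a b v ^+ 2 = ip v v.
Proof.
move=> Lv; have vi := integ_ip Lv Lv; have v0 := ip_ge0 v.
suff -> : normL2 a b v = Num.sqrt (ip v v) by rewrite sqr_sqrtr.
rewrite /normL2 unlock /=.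
rewrite (_ : (\int[mu]_x _)%E = (ip v v)%:E).
  by rewrite poweR_EFin/= powR12_sqrt.
rewrite Int_EFin//; apply: eq_integral => x _.
by rewrite patchM/= powR_mulrn// real_normK ?num_real// expr2.
Qed.

Lemma normL2_le v K : L2 v -> 0 <= K -> ip v v <= K ^+ 2 -> normL2 a b v <= K.
Proof.
move=> Lv K0; rewrite -normL2_sqr// => h.
by rewrite -(ler_pXn2r (ltn0Sn 1)) ?nnegrE ?normL2_ge0.
Qed.

Lemma cauchy_schwarz v w : L2 v -> L2 w ->
  `|ip v w| <= normL2 a b v * normL2 a b w.
Proof.
move=> Lv Lw.
have H t : 0 <= ip v v - 2 * t * ip v w + t ^+ 2 * ip w w.
  have := ip_ge0 (fun x => v x - t * w x).
  have Ltw := L2Z t Lw.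
  rewrite ipBl// ?ipBr// ?ipZl// ?ipZr//; last exact: L2B.
  by rewrite (ipC w v); set A := ip v v; set B := ip v w; set C := ip w w => h; lra.
rewrite -(ler_pXn2r (ltn0Sn 1)) ?nnegrE ?mulr_ge0 ?normL2_ge0//.
rewrite exprMn !normL2_sqr// real_normK ?num_real//.
move: H (ip_ge0 v) (ip_ge0 w); set A := ip v v; set B := ip v w; set C := ip w w.
move=> H A0; rewrite le_eqVlt => /predU1P[C0|C0].
  have [->|B0] := eqVneq B 0; first by rewrite expr0n -C0 mulr0.
  (* Here the quadratic in [t] is affine, and this value of [t] makes it equal to -1. *)
  have := H ((A + 1) / (2 * B)).
  rewrite -C0 mulr0 addr0.
  have -> : 2 * ((A + 1) / (2 * B)) * B = A + 1.
    by field.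
  by lra.
(* The minimum of the quadratic. *)
have := H (B / C).
have -> : A - 2 * (B / C) * B + (B / C) ^+ 2 * C = (A * C - B ^+ 2) / C.
  by field; rewrite gt_eqF.
by rewrite pmulr_lge0 ?invr_gt0// subr_ge0.
Qed.

Lemma normL2_ae v w : L2 v -> L2 w ->
  {ae mu, forall x, a < x < b -> v x = w x} -> normL2 a b v = normL2 a b w.
Proof.
move=> Lv Lw vw; apply/eqP; rewrite -(@eqrXn2 _ 2) ?normL2_ge0//.
rewrite !normL2_sqr// (ip_ae Lv Lw Lv vw) ipC (ip_ae Lv Lw Lw vw).
by [].
Qed.

Lemma normL2_mulb g v K : 0 <= K -> measurable_fun setT (g \_ `]a, b[) ->
  (forall x, a < x < b -> `|g x| <= K) -> L2 v ->
  normL2 a b (fun x => g x * v x) <= K * normL2 a b v.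
Proof.
move=> K0 mg gK Lv; have Lgv := L2_mulb mg gK Lv.
apply: normL2_le => //; first by rewrite mulr_ge0 ?normL2_ge0.
rewrite exprMn normL2_sqr// -ipZl//.
have LK := L2Z (K ^+ 2) Lv.
apply: Int_le; [exact: integ_ip..|] => x.
rewrite !patch_itv in_itv/=; case: ifPn => // /gK h.
have : g x ^+ 2 <= K ^+ 2.
  by rewrite -(real_normK (num_real (g x))) lerXn2r ?nnegrE// (le_trans _ h).
by have := sqr_ge0 (v x); nra.
Qed.

Lemma L2_integ v : L2 v -> integ (v \_ `]a, b[).
Proof.
move=> Lv; have := integ_ip Lv (L2_cst 1); congr integ.
by apply/funext => x; rewrite !patch_itv; case: ifP => // _; rewrite mulr1.
Qed.

(** Cauchy-Schwarz against the sign of [v]. On a bounded interval it turns L^2 bounds into the L^1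
    bounds that [Int_fubini] asks for. *)
Lemma Int_L2_le v : L2 v ->
  Int (fun x => `|(v \_ `]a, b[) x|) <= normL2 a b (fun=> 1) * normL2 a b v.
Proof.
move=> Lv; have L1 := L2_cst 1.
pose s x := Num.sg ((v \_ `]a, b[) x).
have ms : measurable_fun setT s.
  rewrite (_ : s = fun x => if (v \_ `]a, b[) x == 0 then 0 else
     if (v \_ `]a, b[) x < 0 then -1 else 1); last first.
    by apply/funext => x; rewrite /s; case: sgrP => h; rewrite ?eqxx// ?gt_eqF ?lt_eqF ?h// ltNge ltW.
  have mv := L2_measurable Lv.
  apply: measurable_fun_ifT => //; first exact: measurable_fun_eqr.
  by apply: measurable_fun_ifT => //; exact: measurable_fun_ltr.
have Ls : L2 (fun x => s x).
  apply: (@L2_bounded _ 1); first exact: measurable_patch_itv.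
  by move=> x _; rewrite /s normr_sg; case: (_ == 0).
have -> : Int (fun x => `|(v \_ `]a, b[) x|) = ip s v.
  apply: eq_Int => x; rewrite !patch_itv /s !patch_itv.
  by case: (x \in _); rewrite ?normr0// [LHS]normrEsg.
apply: (le_trans (ler_norm _)); apply: (le_trans (cauchy_schwarz Ls Lv)).
rewrite ler_wpM2r ?normL2_ge0//.
have -> : s = fun x => s x * 1 by apply/funext => x; rewrite mulr1.
rewrite -[leRHS]mul1r; apply: normL2_mulb => //; first exact: measurable_patch_itv.
by move=> x _; rewrite /s normr_sg; case: (_ == 0).
Qed.

End SquareIntegrable.

(** * Primitives and Steklov averages *)

Definition prim (R : realType) (f : R -> R) (y : R) : R := Int (f \_ `]-oo, y]).

(** The Steklov average: the mean of [f] over [[x, x + h]]. It gains one degree of smoothness and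
    enlarges the support on the left only. *)
Definition stek (R : realType) (h : R) (f : R -> R) (x : R) : R :=
  h^-1 * (prim f (x + h) - prim f x).

(** The class stable under averaging: [stek h] sends it to the same class with [c - h] for [c] and
    the same bound [K], which serves as the dominating constant in the limits. *)
Definition bdd_on (R : realType) (c d K : R) (f : R -> R) : Prop :=
  [/\ measurable_fun setT f, forall x, `|f x| <= K &
      forall x, ~~ (c <= x <= d) -> f x = 0].

Section Steklov.
Context {R : realType}.
Local Notation mu := (@lebesgue_measure R).
Implicit Types (f g : R -> R).

Lemma bdd_on_integ c d K f : bdd_on c d K f -> integ f.
Proof.
move=> [mf fK f0].
have -> : f = f \_ `[c, d].
  apply/funext => x; rewrite patch_itv in_itv/=; case: ifPn => // h.
  exact: f0.
apply: integ_bounded_itv => //; exact: measurable_patch_itv.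
Qed.

Lemma prim_sub f x y : integ f -> x <= y ->
  prim f y - prim f x = Int (f \_ `]x, y]).
Proof.
move=> fi xy; rewrite /prim -IntB; [|exact: integ_itv..].
apply: eq_Int => z; rewrite !patch_itv !in_itv/=.
have [zx|xz] := leP z x; first by rewrite (le_trans zx xy) subrr.
by case: ifP => _; rewrite subr0.
Qed.

Lemma prim_lip_le f K x y : integ f -> (forall z, `|f z| <= K) -> x <= y ->
  `|prim f y - prim f x| <= K * (y - x).
Proof.
move=> fi fK xy; rewrite prim_sub// -(Int_cst_oc K xy).
apply: Int_abs_le; last first.
- move=> z; rewrite !patch_itv; case: ifP => // _; by rewrite normr0.
- exact: integ_cst_itv.
- by apply: integ_measurable; exact: integ_itv.
Qed.

Lemma prim_lip f K x y : integ f -> (forall z, `|f z| <= K) ->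
  `|prim f y - prim f x| <= K * `|y - x|.
Proof.
move=> fi fK; have [xy|/ltW yx] := leP x y.
  by rewrite (@ger0_norm _ (y - x)) ?subr_ge0// prim_lip_le.
by rewrite distrC (distrC y) (@ger0_norm _ (x - y)) ?subr_ge0// prim_lip_le.
Qed.

Lemma lip_continuous f K : (forall x y, `|f y - f x| <= K * `|y - x|) -> continuous f.
Proof.
move=> fK x; apply/cvgrPdist_le => e e0.
have K0 : 0 < `|K| + 1 by rewrite ltr_wpDl.
near=> y; rewrite distrC; apply: (le_trans (fK x y)).
apply: (@le_trans _ _ ((`|K| + 1) * `|x - y|)).
  rewrite distrC ler_wpM2r// (le_trans (ler_norm K))// lerDl//.
rewrite mulrC -ler_pdivlMr//.
by near: y; apply: cvgr_dist_le => //; rewrite divr_gt0.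
Unshelve. all: by end_near. Qed.

Lemma stek_continuous h f K : integ f -> (forall z, `|f z| <= K) ->
  continuous (stek h f).
Proof.
move=> fi fK; have cp : continuous (prim f).
  by apply: (@lip_continuous _ K) => x y; exact: prim_lip.
move=> x; apply: cvgMr; apply: cvgB; last exact: cp.
apply: (@continuous_comp _ _ _ (fun x => x + h) (prim f)); last exact: cp.
by apply: cvgD; [exact: cvg_id|exact: cvg_cst].
Qed.

Lemma stek_bdd h c d K f : 0 < h -> bdd_on c d K f ->
  bdd_on (c - h) d K (stek h f).
Proof.
move=> h0 bf; have fi := bdd_on_integ bf; case: (bf) => mf fK f0; split.
- by apply: continuous_measurable_fun; exact: stek_continuous fi fK.
- move=> x; rewrite /stek normrM gtr0_norm ?invr_gt0//.
  rewrite mulrC ler_pdivrMr//.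
  have := @prim_lip f K x (x + h) fi fK.
  by rewrite (addrC x) addrK (gtr0_norm h0).
- move=> x; rewrite negb_and -!ltNge => xcd; rewrite /stek prim_sub//; last first.
    by rewrite lerDl ltW.
  rewrite (_ : Int _ = 0) ?mulr0// -[RHS]Int0; apply: eq_Int => z.
  rewrite patch_itv in_itv/=; case: ifPn => // /andP[xz zxh].
  apply: f0; rewrite negb_and -!ltNge; apply/orP.
  by case/orP : xcd => ?; [left|right]; lra.
Qed.

Lemma derive1_seq (f : R -> R) (x l : R) (u : nat -> R) : is_derive x 1 f l ->
  (forall n, u n != 0) -> u @ \oo --> 0 ->
  (fun n => (u n)^-1 * (f (x + u n) - f x)) @ \oo --> l.
Proof.
move=> [df dl] u0 ucv; move: df; rewrite /derivable.
move=> /cvgP; rewrite -/(derive f x 1) dl => df.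
have := (cvgr_dnbhsP _ _ _).1 df u (conj u0 ucv).
apply: cvg_trans; apply: near_eq_cvg; apply: nearW => n.
by rewrite /GRing.scale/= mulr1 (addrC x).
Qed.

Lemma cvg_divn (e : R) : (fun n => e / n.+1%:R) @ \oo --> (0 : R).
Proof.
rewrite [X in _ --> X](_ : _ = e * 0); last by rewrite mulr0.
by apply: cvgMr; exact: cvg_harmonic.
Qed.

Lemma prim_is_derive f (x : R) : integ f -> {for x, continuous f} ->
  is_derive x 1 (prim f) (f x).
Proof.
move=> fi cf.
have E : prim f = fun y => \int[mu]_(t in [set` `]-oo, y]]) f t.
  by apply/funext => y; rewrite /prim -RintE.
have [|||d e] := @continuous_FTC1 R f -oo%O x (x + 1) _ _ _ cf.
- by rewrite ltrDl.
- by apply: integrableS fi.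
- exact: ltNyr.
by rewrite E; apply: DeriveDef; [exact: d|rewrite -derive1E; exact: e].
Qed.

(** Lebesgue differentiation of [prim f], read along a sequence of step sizes because dominated
    convergence is used for sequences. *)
Lemma stek_ae f (e : R) : 0 < e -> integ f ->
  {ae mu, forall x, (fun n => stek (e / n.+1%:R) f x) @ \oo --> f x}.
Proof.
move=> e0 fi.
have E : prim f = fun y => \int[mu]_(t in [set` `]-oo, y]]) f t.
  by apply/funext => y; rewrite /prim -RintE.
have := @FTC1Ny R f; case.
- by move=> y; apply: integrableS fi.
- by apply: open_integrable_locally => //; exact: openT.
move=> N [mN N0 hN]; exists N; split => // x /= nx; apply: hN => /= -[d' d].
apply: nx; apply: derive1_seq.
- by rewrite E; apply: DeriveDef; [exact: d'|rewrite -derive1E; exact: d].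
- by move=> n; rewrite mulf_neq0 ?invr_eq0 ?gt_eqF.
- exact: cvg_divn.
Qed.

Lemma stek_is_derive (h : R) f (x : R) : integ f -> continuous f ->
  is_derive x 1 (stek h f) (h^-1 * (f (x + h) - f x)).
Proof.
move=> fi cf.
have d1 := prim_is_derive fi (cf x).
have d2 : is_derive x 1 (prim f \o (fun y => y + h)) (f (x + h)).
  have dd := prim_is_derive fi (cf (x + h)).
  by apply: is_derive_eq; rewrite addr0 mulr1.
have := @is_deriveZ _ _ _ _ h^-1 x 1 _ (is_deriveB d2 d1).
exact.
Qed.

End Steklov.

(** * The L^2 norm is determined by pairings with smooth test functions *)

Section Duality.
Context {R : realType}.
Local Notation mu := (@lebesgue_measure R).
Implicit Types (f g phi : R -> R).

Lemma test_is_derive a b phi (x : R) : test_fun a b phi ->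
  is_derive x 1 phi (derive1 phi x).
Proof. by move=> [d _ _]; apply: DeriveDef; [exact: d|rewrite derive1E]. Qed.

Lemma derivable_cts phi : (forall x : R, derivable phi x 1) -> continuous phi.
Proof. by move=> d x; apply: differentiable_continuous; apply/derivable1_diffP. Qed.

Lemma cts_supp_bdd c d phi : c < d -> continuous phi ->
  (forall x, ~~ (c <= x <= d) -> phi x = 0) -> exists K, bdd_on c d K phi.
Proof.
move=> cd cphi phi0.
have cn : {within `[c, d], continuous (fun x => `|phi x|)}.
  apply: continuous_subspaceT => x.
  by apply: continuous_comp; [exact: cphi|exact: norm_continuous].
have [z _ hz] := EVT_max (ltW cd) cn.
exists `|phi z|; split => //; first exact: continuous_measurable_fun.
move=> x; have [xcd|/phi0 ->] := boolP (c <= x <= d); last by rewrite normr0.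
by apply: hz; rewrite in_itv.
Qed.

Lemma derive1_supp c d phi (x : R) : (forall x, ~~ (c <= x <= d) -> phi x = 0) ->
  ~~ (c <= x <= d) -> derive1 phi x = 0.
Proof.
move=> phi0 xcd; rewrite derive1E.
have E : \forall y \near x, phi y = 0.
  move: xcd; rewrite negb_and -!ltNge => /orP[xc|dx]; near=> y; apply: phi0;
    rewrite negb_and -!ltNge; apply/orP.
    by left; near: y; exact: lt_nbhsl.
  by right; near: y; exact: lt_nbhsr.
rewrite (near_eq_derive (g := cst 0))//; exact: derive_cst.
Unshelve. all: by end_near. Qed.

Lemma test_bdd a b phi : test_fun a b phi -> exists c d K,
  [/\ a < c, c < d, d < b, bdd_on c d K phi & bdd_on c d K (derive1 phi)].
Proof.
move=> [dphi cphi [c [d [ac cd db phi0]]]].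
have [K1 [m1 b1 z1]] := cts_supp_bdd cd (derivable_cts dphi) phi0.
have [K2 [m2 b2 z2]] := cts_supp_bdd cd cphi (fun x => @derive1_supp c d phi x phi0).
exists c, d, (Num.max K1 K2); split => //.
  by split => // x; rewrite le_max b1.
by split => // x; rewrite le_max b2 orbT.
Qed.

Lemma stek_derive1 (h : R) f : integ f -> continuous f ->
  derive1 (stek h f) = fun x => h^-1 * (f (x + h) - f x).
Proof.
by move=> fi cf; apply/funext => x; rewrite derive1E;
  have [] := stek_is_derive h x fi cf.
Qed.

Lemma continuous_shift (h : R) f : continuous f -> continuous (fun x => f (x + h)).
Proof.
move=> cf x; apply: (@continuous_comp _ _ _ (fun x => x + h) f); last exact: cf.
by apply: cvgD; [exact: cvg_id|exact: cvg_cst].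
Qed.

Lemma stek_test a b c d K h f : 0 < h -> a < c - h -> c < d -> d < b ->
  continuous f -> bdd_on c d K f -> test_fun a b (stek h f).
Proof.
move=> h0 ac cd db cf bf; have fi := bdd_on_integ bf; split.
- by move=> x; have [] := stek_is_derive h x fi cf.
- rewrite (stek_derive1 h fi cf) => x; apply: cvgMr; apply: cvgB; last exact: cf.
  exact: continuous_shift.
- exists (c - h), d; split => //; first lra.
  by have [] := stek_bdd h0 bf.
Qed.

(** The derivative of the average is a difference quotient of [phi], hence as smooth as [phi]. *)
Lemma stek_test2 a b c d K h phi : 0 < h -> a < c - h -> c < d -> d < b ->
  test_fun a b phi -> bdd_on c d K phi -> test_fun a b (derive1 (stek h phi)).
Proof.
move=> h0 ac cd db tphi bphi.
have [dphi cphi _] := tphi; have [mphi bK phi0] := bphi.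
have fi := bdd_on_integ bphi; have ccphi := derivable_cts dphi.
rewrite (stek_derive1 h fi ccphi).
have D (x : R) : is_derive x 1 (fun x => h^-1 * (phi (x + h) - phi x))
    (h^-1 * (derive1 phi (x + h) - derive1 phi x)).
  have d1 := test_is_derive x tphi.
  have d2 : is_derive x 1 (phi \o (fun y => y + h)) (derive1 phi (x + h)).
    have dd := test_is_derive (x + h) tphi.
    by apply: is_derive_eq; rewrite addr0 mulr1.
  have := @is_deriveZ _ _ _ _ h^-1 x 1 _ (is_deriveB d2 d1).
  exact.
split.
- by move=> x; have [] := D x.
- rewrite (_ : derive1 _ = fun x => h^-1 * (derive1 phi (x + h) - derive1 phi x)).
    move=> x; apply: cvgMr; apply: cvgB; last exact: cphi.
    by apply: (@continuous_shift _ (derive1 phi)).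
  by apply/funext => x; rewrite derive1E; have [] := D x.
- exists (c - h), d; split => //; first lra.
  move=> x; rewrite negb_and -!ltNge => xcd.
  rewrite (phi0 x) ?(phi0 (x + h)) ?subrr ?mulr0// negb_and -!ltNge; apply/orP;
  by case/orP : xcd => ?; [left|right]; lra.
Qed.

Lemma bdd_L2 a b c d K f : bdd_on c d K f -> in_Lp 2%:E a b f.
Proof.
move=> [mf fK _]; apply: (@L2_bounded _ _ _ _ K) => [|x _]; last exact: fK.
exact: measurable_patch_itv.
Qed.

Lemma test_L2 a b phi : test_fun a b phi ->
  in_Lp 2%:E a b phi /\ in_Lp 2%:E a b (derive1 phi).
Proof. by move=> /test_bdd[c [d [K [_ _ _ b1 b2]]]]; split; [exact: bdd_L2 b1|exact: bdd_L2 b2]. Qed.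

Section dual.
Variables (a b : R) (g : R -> R) (M : R).
Hypotheses (Lg : in_Lp 2%:E a b g) (M0 : 0 <= M).

(** The squared form of the duality bound: both sides are built from integrals, so it passes to
    limits by dominated convergence. *)
Let P f := (ip a b g f) ^+ 2 <= M ^+ 2 * ip a b f f.

Lemma ip_cvg v (f_ : nat -> R -> R) f K : in_Lp 2%:E a b v ->
  (forall n, measurable_fun setT (f_ n)) -> measurable_fun setT f ->
  (forall n x, `|f_ n x| <= K) ->
  {ae mu, forall x, (fun n => f_ n x) @ \oo --> f x} ->
  (fun n => ip a b v (f_ n)) @ \oo --> ip a b v f.
Proof.
move=> Lv mf_ mf fK fcv; have vi := L2_integ Lv.
have [_] : integ ((fun x => v x * f x) \_ `]a, b[) /\
    (fun n => Int ((fun x => v x * f_ n x) \_ `]a, b[)) @ \oo -->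
    Int ((fun x => v x * f x) \_ `]a, b[); last exact.
have mvf w : measurable_fun setT w ->
    measurable_fun setT ((fun x => v x * w x) \_ `]a, b[).
  move=> mw; have -> : (fun x => v x * w x) \_ `]a, b[ =
      (fun x => (v \_ `]a, b[) x * w x).
    by apply/funext => x; rewrite !patch_itv; case: ifP; rewrite ?mul0r.
  apply: measurable_funM => //; exact: L2_measurable.
apply: (@integ_dct _ _ _ (fun x => K * `|(v \_ `]a, b[) x|)).
- by move=> n; exact: mvf.
- exact: mvf.
- exact/integZ/integ_abs.
- apply: aeW => x n; rewrite !patch_itv; case: ifP => _; last by rewrite normr0 mulr0.
  by rewrite normrM mulrC ler_wpM2r.
- apply: (ae_mp fcv) => x h; under eq_fun do rewrite patch_itv; rewrite patch_itv.
  case: ifP => _; last exact: cvg_cst.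
  by apply: cvgMr.
Qed.

Lemma dual_lim (f_ : nat -> R -> R) f K :
  (forall n, measurable_fun setT (f_ n)) -> measurable_fun setT f ->
  (forall n x, `|f_ n x| <= K) -> (forall x, `|f x| <= K) ->
  {ae mu, forall x, (fun n => f_ n x) @ \oo --> f x} ->
  (forall n, P (f_ n)) -> P f.
Proof.
move=> mf_ mf f_K fK fcv Pf.
have Lf : in_Lp 2%:E a b f.
  by apply: (@L2_bounded _ _ _ _ K) => [|x _]; [exact: measurable_patch_itv|exact: fK].
have Lf_ n : in_Lp 2%:E a b (f_ n).
  by apply: (@L2_bounded _ _ _ _ K) => [|x _]; [exact: measurable_patch_itv|exact: f_K].
have c1 := ip_cvg Lg mf_ mf f_K fcv.
have c2 : (fun n => ip a b (f_ n) (f_ n)) @ \oo --> ip a b f f.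
  have L1 := L2_cst a b 1.
  have E w : ip a b w w = ip a b (fun=> 1) (fun x => w x ^+ 2).
    by apply: eq_Int => x; rewrite !patch_itv; case: ifP => // _; rewrite mul1r.
  rewrite E; under eq_fun do rewrite E.
  apply: (@ip_cvg _ _ _ (K ^+ 2)) => //.
  - by move=> n; exact: measurable_funX.
  - exact: measurable_funX.
  - move=> n x; rewrite normrX lerXn2r// nnegrE//; exact: le_trans (f_K n x).
  - apply: (ae_mp fcv) => x h.
    have : (fun n => f_ n x * f_ n x) @ \oo --> f x * f x by exact: cvgM.
    by rewrite expr2.
have c3 : (fun n => ip a b g (f_ n) * ip a b g (f_ n)) @ \oo -->
    ip a b g f * ip a b g f by exact: cvgM.
have c4 : (fun n => M ^+ 2 * ip a b (f_ n) (f_ n)) @ \oo --> M ^+ 2 * ip a b f f.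
  by apply: cvgMr.
by rewrite /P expr2; apply: (ler_cvg_to c3 c4); apply: nearW => n; exact: Pf.
Qed.

(** A bound known for all averages of [f] passes to [f]. Step sizes at most [(c - a) / 2] keep the
    enlarged support inside []a, b[]. *)
Lemma dual_step c d K f : a < c -> d < b -> bdd_on c d K f ->
  (forall h, 0 < h -> a < c - h -> P (stek h f)) -> P f.
Proof.
move=> ac db bf H; have fi := bdd_on_integ bf.
have e0 : 0 < (c - a) / 2 by lra.
have u0 n : 0 < (c - a) / 2 / n.+1%:R by rewrite divr_gt0.
have B n := stek_bdd (u0 n) bf.
apply: (@dual_lim (fun n => stek ((c - a) / 2 / n.+1%:R) f) f K).
- by move=> n; case: (B n).
- by case: bf.
- by move=> n; case: (B n).
- by case: bf.
- exact: stek_ae.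
- move=> n; apply: H => //.
  have : (c - a) / 2 / n.+1%:R <= (c - a) / 2.
    by rewrite ler_pdivrMr// ler_peMr ?ler1n// ltW.
  by move: e0; set t := _ / n.+1%:R; lra.
Qed.

(* Steklov averages make test functions twice differentiable. *)
Lemma L2_dual : (forall chi, test_fun a b chi -> test_fun a b (derive1 chi) ->
    `|ip a b g chi| <= M * normL2 a b chi) ->
  normL2 a b g <= M.
Proof.
move=> H.
(* Smoothness is removed one average at a time: twice differentiable tests, test functions,
   continuous functions, and finally bounded measurable functions, all with compact support in []a,
   b[]. *)
have P2 phi : test_fun a b phi -> test_fun a b (derive1 phi) -> P phi.
  move=> t1 t2; have [Lp _] := test_L2 t1.
  rewrite /P -normL2_sqr// -exprMn -(real_normK (num_real (ip a b g phi))).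
  by rewrite lerXn2r ?nnegrE ?mulr_ge0 ?normL2_ge0//; exact: H.
have P1 phi : test_fun a b phi -> P phi.
  move=> t1; have [c [d [K [ac cd db b1 b2]]]] := test_bdd t1.
  apply: (dual_step ac db b1) => h h0 ach; apply: P2.
    have [dphi _ _] := t1; exact: (stek_test h0 ach cd db (derivable_cts dphi) b1).
  exact: (stek_test2 h0 ach cd db t1 b1).
have P0 c d K f : a < c -> c < d -> d < b -> bdd_on c d K f -> continuous f -> P f.
  move=> ac cd db bf cf; apply: (dual_step ac db bf) => h h0 ach.
  by apply: P1; exact: (stek_test h0 ach cd db cf bf).
have PB c d K f : a < c -> c < d -> d < b -> bdd_on c d K f -> P f.
  move=> ac cd db bf; apply: (dual_step ac db bf) => h h0 ach.
  have bs := stek_bdd h0 bf.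
  apply: (P0 (c - h) d K) => //; first lra.
  have [mf fK _] := bf; exact: stek_continuous (bdd_on_integ bf) fK.
have [ba|ab] := leP b a.
  apply: normL2_le => //; rewrite (_ : ip a b g g = 0) ?sqr_ge0//.
  rewrite -[RHS]Int0; apply: eq_Int => x; rewrite patch_itv in_itv/=.
  by case: ifPn => // /andP[ax xb]; lra.
pose G := g \_ `]a, b[.
have mG : measurable_fun setT G by exact: L2_measurable.
pose u n := (b - a) / 3 / n.+1%:R.
have u0 n : 0 < u n by rewrite !divr_gt0 ?subr_gt0.
have u1 n : u n <= (b - a) / 3.
  by rewrite ler_pdivrMr// ler_peMr ?ler1n//; lra.
(* [g] itself, truncated in space and in size, is admissible. Since [ip g (f n) = ip (f n) (f n)],
   the squared bound divides down to [ip (f n) (f n) <= M ^+ 2]. *)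
pose f n x := if (a + u n <= x <= b - u n) && (`|G x| <= n%:R) then G x else 0.
have bf n : bdd_on (a + u n) (b - u n) n%:R (f n).
  split.
  - apply: measurable_fun_ifT => //; apply: measurable_and.
      apply: measurable_and; exact: measurable_fun_ler.
    apply: measurable_fun_ler => //; exact: measurableT_comp.
  - by move=> x; rewrite /f; case: ifP => [/andP[]//|_]; rewrite normr0.
  - by move=> x; rewrite /f => /negbTE ->.
have ipf n : ip a b g (f n) = ip a b (f n) (f n).
  apply: eq_Int => x; rewrite !patch_itv /f; case: ifP => // xab.
  case: ifP => // _; last by rewrite !mulr0.
  by rewrite /G patch_itv xab.
have Pn n : ip a b (f n) (f n) <= M ^+ 2.
  have : P (f n).
    apply: (PB _ _ _ _ _ _ _ (bf n)); have := u0 n; have := u1 n; lra.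
  rewrite /P ipf expr2; have := ip_ge0 a b (f n); set t := ip _ _ _ _ => t0.
  move: t0; rewrite le_eqVlt => /predU1P[<- _|t0]; first by rewrite sqr_ge0.
  by rewrite ler_pM2r.
apply: normL2_le => //.
have [_ cv] : integ ((fun x => g x * g x) \_ `]a, b[) /\
  (fun n => Int (fun x => ((fun x => f n x * f n x) \_ `]a, b[) x)) @ \oo -->
   Int ((fun x => g x * g x) \_ `]a, b[).
  apply: (@integ_dct _ _ _ ((fun x => g x * g x) \_ `]a, b[)).
  - by move=> n; apply: integ_measurable; apply: integ_ip; exact: bdd_L2 (bf n).
  - by apply: integ_measurable; exact: integ_ip.
  - exact: integ_ip.
  - apply: aeW => x n; rewrite !patch_itv; case: ifP => xab; last by rewrite normr0.
    rewrite /f; case: ifP => _; last by rewrite mulr0 normr0 -expr2 sqr_ge0.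
    by rewrite /G patch_itv xab ger0_norm// -expr2 sqr_ge0.
  - apply: aeW => x; apply: cvg_near_cst.
    have [xab|xab] := boolP (x \in `]a, b[); last first.
      by apply: nearW => n; rewrite !patch_itv (negbTE xab).
    near=> n; rewrite !patch_itv xab.
    move: (xab); rewrite in_itv/= => /andP[ax xb].
    suff -> : f n x = g x by [].
    have un : u n <= Num.min (x - a) (b - x).
      near: n; have : 0 < Num.min (x - a) (b - x).
        by move: xab; rewrite in_itv/= lt_min !subr_gt0.
      move=> /(cvgr_lt _ (cvg_divn ((b - a) / 3))).
      by apply: filterS => n /ltW.
    move: un; rewrite le_min => /andP[un1 un2].
    rewrite /f /G patch_itv xab.
    have -> : a + u n <= x <= b - u n by apply/andP; split; lra.
    suff -> : `|g x| <= n%:R by [].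
    by near: n; exact: nbhs_infty_ger.
by apply: (cvgr_to_le cv); exact: nearW.
Unshelve. all: by end_near. Qed.

End dual.

End Duality.

(** The weight of [transf], with a free parameter so that its inverse is [ew (- k)]. *)
Definition ew (R : realType) (k x : R) : R := expR (- k * x).

(** * Weak derivatives, the exponential weight and the boundary condition *)

Section WeakDerivative.
Context {R : realType} (a b : R).
Local Notation mu := (@lebesgue_measure R).
Local Notation L2 := (in_Lp 2%:E a b).
Local Notation ip := (ip a b).
Local Notation test := (test_fun a b).
Local Notation wd := (is_wd a b).
Implicit Types (u v w g phi : R -> R).

Lemma weak_derivE v g : weak_deriv a b v g <->
  forall phi, test phi -> ip v (derive1 phi) = - ip g phi.
Proof. by split=> H phi /H; rewrite !RintE. Qed.

Lemma wd_ip v g phi : wd v g -> test phi -> ip v (derive1 phi) = - ip g phi.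
Proof. by move=> [_ /weak_derivE]; exact. Qed.

Lemma wd_L2 v g : wd v g -> L2 g. Proof. by case. Qed.

Lemma wd_test2 v g h phi : wd v g -> wd g h -> test phi -> test (derive1 phi) ->
  ip h phi = ip v (derive1 (derive1 phi)).
Proof.
move=> vg gh t1 t2.
by rewrite (wd_ip vg t2) (wd_ip gh t1) opprK.
Qed.

Lemma normL2_eq0 v : L2 v -> normL2 a b v <= 0 -> {ae mu, forall x, a < x < b -> v x = 0}.
Proof.
move=> Lv; rewrite le_eqVlt ltNge normL2_ge0 orbF => /eqP v0.
have := Int_ge0_eq0 (integ_ip Lv Lv); case.
- by move=> x; rewrite patchM -expr2 sqr_ge0.
- by rewrite -[LHS](normL2_sqr Lv) v0 expr0n.
move=> N [mN N0 hN]; exists N; split => // x /= nx; apply: hN => /=.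
apply: contra_not nx; rewrite patch_itv in_itv/= => + xab; rewrite xab => /eqP.
by rewrite mulf_eq0 orbb => /eqP.
Qed.

(** [g - g'] pairs to 0 with every test function, so [L2_dual] applies with bound 0. This is the
    access to [Dx], which is a chosen version. *)
Lemma wd_unique v v' g g' : L2 v -> L2 v' ->
  {ae mu, forall x, a < x < b -> v x = v' x} -> wd v g -> wd v' g' ->
  {ae mu, forall x, a < x < b -> g x = g' x}.
Proof.
move=> Lv Lv' vv' wg wg'; have Lg := wd_L2 wg; have Lg' := wd_L2 wg'.
have Ld := L2B Lg Lg'.
have : normL2 a b (fun x => g x - g' x) <= 0.
  apply: L2_dual => // chi t1 t2; have [Lc Lc'] := test_L2 t1.
  rewrite mul0r ipBl// -[ip g _]opprK -(wd_ip wg t1) -[ip g' _]opprK -(wd_ip wg' t1).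
  by rewrite (ip_ae Lv Lv' Lc' vv') subrr normr0.
move/(normL2_eq0 Ld) => h; apply: (ae_mp h) => x hx xab.
by apply/eqP; rewrite -subr_eq0; apply/eqP; exact: hx.
Qed.

Lemma Dx_wd v g : wd v g -> wd v (Dx a b v).
Proof. by move=> vg; apply: (xgetPex (fun=> 0) (ex_intro _ g vg)). Qed.

Lemma wdB v w g h : L2 v -> L2 w -> wd v g -> wd w h ->
  wd (fun x => v x - w x) (fun x => g x - h x).
Proof.
move=> Lv Lw vg wh; have Lg := wd_L2 vg; have Lh := wd_L2 wh.
split; first exact: L2B.
apply/weak_derivE => phi t; have [Lp Lp'] := test_L2 t.
by rewrite !ipBl// (wd_ip vg t) (wd_ip wh t); lra.
Qed.

Lemma wdZ k v g : L2 v -> wd v g -> wd (fun x => k * v x) (fun x => k * g x).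
Proof.
move=> Lv vg; have Lg := wd_L2 vg; split; first exact: L2Z.
apply/weak_derivE => phi t; have [Lp Lp'] := test_L2 t.
by rewrite (ipZl k Lv Lp') (ipZl k Lg Lp) (wd_ip vg t) mulrN.
Qed.

Lemma in_H2P v : in_H a b 2 v ->
  [/\ L2 v, wd v (Dx a b v) & wd (Dx a b v) (Dx a b (Dx a b v))].
Proof. by move=> [Lv H]; split => //; [exact: (H 0%N)|exact: (H 1%N)]. Qed.

(** [in_H] speaks of the chosen versions [Dx]. The first one equals [g] almost everywhere, so [h] is
    a weak derivative of it as well. *)
Lemma in_H2_wd v g h : L2 v -> wd v g -> wd g h -> in_H a b 2 v.
Proof.
move=> Lv vg gh; have v1 := Dx_wd vg.
have e := wd_unique Lv Lv (aeW mu (fun x _ => erefl)) vg v1.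
split; first exact: Lv.
case=> [_|[_|j hj]]; [exact v1| |by exfalso].
change (wd (Dx a b v) (Dx a b (Dx a b v))); apply: (@Dx_wd _ h).
split; first exact: wd_L2 gh.
apply/weak_derivE => phi t; have [Lp Lp'] := test_L2 t.
rewrite -(wd_ip gh t); apply/esym/ip_ae => //; [exact: wd_L2 vg|exact: wd_L2 v1].
Qed.

Lemma ew_is_derive (k x : R) : is_derive x 1 (ew k) (- k * ew k x).
Proof.
have d : is_derive x 1 (fun y : R => - k * y) (- k).
  have := @is_deriveZ _ _ _ _ (- k) x 1 _ (is_derive_id x 1).
  by rewrite /GRing.scale/= mulr1.
have h := is_derive1_comp (is_derive_expR (- k * x)) d.
by apply: (is_derive_eq h); rewrite /GRing.scale/= mulrC.
Qed.

Lemma ew_continuous (k : R) : continuous (ew k).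
Proof.
by apply: derivable_cts => x; have [] := ew_is_derive k x.
Qed.

Lemma ew_measurable (k : R) : measurable_fun setT (ew k).
Proof. by apply: continuous_measurable_fun; exact: ew_continuous. Qed.

Lemma ew_gt0 (k x : R) : 0 < ew k x. Proof. exact: expR_gt0. Qed.

Lemma ewNK (k x : R) : ew (- k) x * ew k x = 1.
Proof. by rewrite -expRD opprK mulNr subrr expR0. Qed.

Lemma ew_bound (k x : R) : a < x < b -> `|ew k x| <= expR (`|k| * (`|a| + `|b|)).
Proof.
move=> /andP[ax xb]; rewrite gtr0_norm ?ew_gt0// ler_expR.
apply: (le_trans (ler_norm _)); rewrite normrM normrN ler_wpM2l//.
have := ler_norm b; have := ler_norm (- a); rewrite normrN => h1 h2.
have := normr_ge0 a; have := normr_ge0 b => h3 h4.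
by rewrite ler_norml; apply/andP; split; lra.
Qed.

Lemma L2_ew k v : L2 v -> L2 (fun x => ew k x * v x).
Proof.
apply: L2_mulb (@ew_bound k); apply: measurable_patch_itv; exact: ew_measurable.
Qed.

Lemma normL2_ew k v : L2 v ->
  normL2 a b (fun x => ew k x * v x) <= expR (`|k| * (`|a| + `|b|)) * normL2 a b v.
Proof.
apply: normL2_mulb (@ew_bound k); first exact: expR_ge0.
apply: measurable_patch_itv; exact: ew_measurable.
Qed.

Lemma ip_ew k v w : ip (fun x => ew k x * v x) w = ip v (fun x => ew k x * w x).
Proof. by apply: eq_Int => x; rewrite !patch_itv; case: ifP => // _; ring. Qed.

Lemma ew_mul_derive k phi (x : R) : (forall x, derivable phi x 1) ->
  is_derive x 1 (fun x => ew k x * phi x) (ew k x * (derive1 phi x - k * phi x)).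
Proof.
move=> dphi.
have d1 : is_derive x 1 phi (derive1 phi x) by apply: DeriveDef; rewrite ?derive1E.
have d2 := ew_is_derive k x.
have := is_deriveM d2 d1; rewrite /GRing.scale/=.
rewrite (_ : _ + _ = ew k x * (derive1 phi x - k * phi x)); last by ring.
exact.
Qed.

Lemma ew_mul_derive1 k phi : (forall x : R, derivable phi x 1) ->
  derive1 (fun x => ew k x * phi x) = fun x => ew k x * (derive1 phi x - k * phi x).
Proof.
by move=> d; apply/funext => x; rewrite derive1E; have [] := ew_mul_derive k x d.
Qed.

Lemma test_ew k phi : test phi -> test (fun x => ew k x * phi x).
Proof.
move=> [d c [p [q [ap pq qb phi0]]]]; split.
- by move=> x; have [] := ew_mul_derive k x d.
- rewrite (ew_mul_derive1 k d) => x; apply: cvgM; first exact: ew_continuous.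
  apply: cvgB; first exact: c.
  by apply: cvgMr; exact (derivable_cts d (x:=x)).
- by exists p, q; split => // x /phi0 ->; rewrite mulr0.
Qed.

(** The product rule: the weight is moved onto the test function, and the product is again a test
    function. *)
Lemma wd_ew k v g : L2 v -> wd v g ->
  wd (fun x => ew k x * v x) (fun x => ew k x * (g x - k * v x)).
Proof.
move=> Lv vg; have Lg := wd_L2 vg; have Lkv := L2Z k Lv.
split; first by apply: L2_ew; exact: L2B.
apply/weak_derivE => phi t; have [Lp Lp'] := test_L2 t.
have te := test_ew k t; have [Le Le'] := test_L2 te.
have dphi : forall x, derivable phi x 1 by case: t.
have eq1 := wd_ip vg te; move: eq1; rewrite ew_mul_derive1//.
have LE := L2_ew k Lp; have LE' := L2_ew k Lp'.
have -> : (fun x => ew k x * (derive1 phi x - k * phi x)) =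
    (fun x => ew k x * derive1 phi x - k * (ew k x * phi x)).
  by apply/funext => x; ring.
rewrite (ipBr LE' (L2Z k LE) Lv) (ipZr k LE Lv) => eq1.
rewrite !ip_ew (ipBl Lg Lkv LE) (ipZl k Lv LE).
by lra.
Qed.

Lemma wd_ew2 k v g h : L2 v -> wd v g -> wd g h ->
  wd (fun x => ew k x * (g x - k * v x))
     (fun x => ew k x * ((h x - k * g x) - k * (g x - k * v x))).
Proof.
move=> Lv vg gh; have Lg := wd_L2 vg; have Lkv := L2Z k Lv.
exact: (wd_ew k (L2B Lg Lkv) (wdB Lg Lkv gh (wdZ k Lv vg))).
Qed.

Lemma test_by_parts phi psi : test phi -> test psi ->
  ip phi (derive1 psi) = - ip (derive1 phi) psi.
Proof.
move=> t1 t2; have [L1 L1'] := test_L2 t1; have [L2' L2''] := test_L2 t2.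
apply/eqP; rewrite -addr_eq0 (ipC a b (derive1 phi)).
have [d1 c1 [p [q [ap pq qb phi0]]]] := t1.
have [d2 c2 _] := t2.
have ab : a <= b by lra.
have [|| _ e] := @Int_FTC R (fun x => phi x * derive1 psi x + psi x * derive1 phi x)
  (fun x => phi x * psi x) a b ab.
- move=> x _; have h1 := test_is_derive x t1; have h2 := test_is_derive x t2.
  have := is_deriveM h1 h2; exact.
- move=> x _; have e1 := derivable_cts d1 (x:=x); have e2 := derivable_cts d2 (x:=x).
  exact (cvgD (cvgM e1 (c2 x)) (cvgM e2 (c1 x))).
have ii := integD (integ_ip L1 L2'') (integ_ip L2' L1').
rewrite /ip -IntD; [|exact: integ_ip..].
have E : (fun x => phi x * derive1 psi x + psi x * derive1 phi x) \_ `]a, b[ =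
  (fun x => ((fun x => phi x * derive1 psi x) \_ `]a, b[) x +
     ((fun x => psi x * derive1 phi x) \_ `]a, b[) x).
  by apply/funext => x; rewrite !patch_itv; case: ifP; rewrite ?addr0.
rewrite -E.
have [_ ->] := @Int_bnd_eq R false true false false a b
  (fun x => phi x * derive1 psi x + psi x * derive1 phi x)
  (eq_ind_r (fun f => measurable_fun setT f) (integ_measurable ii) E).
rewrite e (phi0 a) ?(phi0 b) ?mul0r ?subrr// negb_and -!ltNge; apply/orP; [right|left] => //.
Qed.

Lemma test_wd phi : test phi -> wd phi (derive1 phi).
Proof.
move=> t; have [L1 L1'] := test_L2 t; split => //.
by apply/weak_derivE => psi tp; exact: test_by_parts.
Qed.

(* The form in which the boundary condition v = 0 is used. *)
Definition green v g : Prop := forall p p1, L2 p -> wd p p1 -> ip p1 v = - ip p g.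

(** For a test function in place of [v] this is the definition of the weak derivative [p1]. Density
    extends it to [v]: the two error terms are controlled by the L^2 and the derivative parts of the
    H^1 distance. *)
Lemma green_H10 v g : in_H10 a b v -> wd v g -> green v g.
Proof.
move=> [[Lv _] H] vg p p1 Lp pp1; have Lg := wd_L2 vg; have Lp1 := wd_L2 pp1.
apply/eqP; rewrite -addr_eq0 -normr_le0; apply/ler_addgt0Pl => e e0; rewrite addr0.
set A := normL2 a b p1; set B := normL2 a b p.
have A0 : 0 <= A by exact: normL2_ge0.
have B0 : 0 <= B by exact: normL2_ge0.
have [|phi t h] := H (e / (A + B + 1)); first by rewrite divr_gt0// ltr_wpDl// addr_ge0.
have [Lphi Lphi'] := test_L2 t.
have Lvp := L2B Lv Lphi; have Lgp := L2B Lg Lphi'.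
have w := wdB Lv Lphi vg (test_wd t).
have w' := Dx_wd w.
(* [normH] measures the chosen version [Dx] of the difference, which agrees almost everywhere with
   the explicit derivative. *)
have n1 : normL2 a b (Dx a b (fun x => v x - phi x)) = normL2 a b (fun x => g x - derive1 phi x).
  apply: normL2_ae => //; first exact: wd_L2 w'.
  by apply: wd_unique w' w => //; exact: aeW.
set d := e / (A + B + 1) in h.
have d0 : 0 < d by exact: le_lt_trans (sqrtr_ge0 _) h.
have sq : normL2 a b (fun x => v x - phi x) ^+ 2 +
     normL2 a b (fun x => g x - derive1 phi x) ^+ 2 < d ^+ 2.
  move: h; rewrite /normH big_ord_recr big_ord_recr big_ord0 /= add0r n1 => h.
  rewrite -(@sqr_sqrtr _ (_ + _)) ?addr_ge0 ?sqr_ge0//.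
  by rewrite ltrXn2r// nnegrE ?sqrtr_ge0// ltW.
have b1 : normL2 a b (fun x => v x - phi x) <= d.
  rewrite -(ler_pXn2r (ltn0Sn 1)) ?nnegrE ?normL2_ge0 ?(ltW d0)//.
  by have := sqr_ge0 (normL2 a b (fun x => g x - derive1 phi x)); lra.
have b2 : normL2 a b (fun x => g x - derive1 phi x) <= d.
  rewrite -(ler_pXn2r (ltn0Sn 1)) ?nnegrE ?normL2_ge0 ?(ltW d0)//.
  by have := sqr_ge0 (normL2 a b (fun x => v x - phi x)); lra.
have -> : ip p1 v + ip p g = ip p1 (fun x => v x - phi x) + ip p (fun x => g x - derive1 phi x).
  by rewrite !ipBr// (wd_ip pp1 t); lra.
apply: (le_trans (ler_normD _ _)).
have c1 := cauchy_schwarz Lp1 Lvp; have c2 := cauchy_schwarz Lp Lgp.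
apply: (@le_trans _ _ (A * d + B * d)).
  apply: lerD; [apply: (le_trans c1)|apply: (le_trans c2)]; exact: ler_wpM2l.
rewrite -mulrDl /d mulrA ler_pdivrMr; last by rewrite ltr_wpDl// addr_ge0.
by rewrite mulrC ler_pM2l// lerDl.
Qed.

Lemma greenB v w g h : L2 v -> L2 w -> L2 g -> L2 h -> green v g -> green w h ->
  green (fun x => v x - w x) (fun x => g x - h x).
Proof.
move=> Lv Lw Lg Lh G1 G2 p p1 Lp pp1; have Lp1 := wd_L2 pp1.
by rewrite !ipBr// (G1 p p1)// (G2 p p1)//; lra.
Qed.

Lemma green_ew k v g : L2 v -> L2 g -> green v g ->
  green (fun x => ew k x * v x) (fun x => ew k x * (g x - k * v x)).
Proof.
move=> Lv Lg G p p1 Lp pp1; have Lp1 := wd_L2 pp1.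
have eq1 := G _ _ (L2_ew k Lp) (wd_ew k Lp pp1); move: eq1.
have Lkp := L2Z k Lp; have Lkv := L2Z k Lv.
have LE := L2_ew k Lv; have LE' := L2_ew k Lg.
rewrite !ip_ew (ipBl Lp1 Lkp LE) (ipZl k Lp LE) => eq1.
have -> : (fun x => ew k x * (g x - k * v x)) =
    (fun x => ew k x * g x - k * (ew k x * v x)).
  by apply/funext => x; ring.
rewrite (ipBr LE' (L2Z k LE) Lp) (ipZr k LE Lp).
by lra.
Qed.

End WeakDerivative.

(** * Quadrature error of the scheme *)

Definition hat (R : realType) (x : R) : R := Num.max 0 (1 - `|x|).

Definition ind (R : realType) (c d x : R) : R := if c <= x <= d then 1 else 0.

(** The sum starts at 1: node 0 carries the value 0, as [omega] does at the initial time. *)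
Definition hat_interp (R : realType) (h : R) (n : nat) (y : nat -> R) (s : R) : R :=
  \sum_(1 <= j < n.+1) hat (s / h - j%:R) * y j.

Section Quadrature.
Context {R : realType}.
Local Notation mu := (@lebesgue_measure R).
Implicit Types (f g G : R -> R).

Lemma measurable_hat : measurable_fun setT (@hat R).
Proof.
apply: measurable_maxr => //; apply: measurable_funB => //.
Qed.

Lemma hat_ge0 (x : R) : 0 <= hat x. Proof. by rewrite le_max lexx. Qed.

Lemma hat_le1 (x : R) : hat x <= 1.
Proof. by rewrite ge_max ler01 lerBlDr lerDl normr_ge0. Qed.

Lemma hat_abs_le1 (x : R) : `|hat x| <= 1.
Proof. by rewrite ger0_norm ?hat_ge0 ?hat_le1. Qed.

Lemma hat0 (x : R) : 1 <= `|x| -> hat x = 0.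
Proof. by move=> h; rewrite /hat max_l// subr_le0. Qed.

Lemma hatE (x : R) : `|x| <= 1 -> hat x = 1 - `|x|.
Proof. by move=> h; rewrite /hat max_r// subr_ge0. Qed.

Lemma measurable_hat_affine (k h : R) : measurable_fun setT (fun s : R => hat (k - s / h)).
Proof.
apply: (measurableT_comp measurable_hat); apply: measurable_funB => //.
exact: measurable_funM.
Qed.

Lemma integ_hat G (k h : R) : integ G -> integ (fun s => G s * hat (k - s / h)).
Proof.
move=> Gi; have := integ_mulb (g := fun s : R => hat (k - s / h)) Gi
  (measurable_hat_affine k h) (fun s => hat_abs_le1 _).
by congr integ; apply/funext => s; rewrite mulrC.
Qed.

Lemma Int_neq1 (c : R) f g : measurable_fun setT g -> (forall x, x != c -> f x = g x) ->
  Int f = Int g.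
Proof.
move=> mg fg.
have E : f = fun x => if x == c then f c else g x.
  by apply/funext => x; case: eqP => [->//|/eqP]; exact: fg.
apply: Int_ae => //.
  by rewrite E; apply: measurable_fun_ifT => //; exact: measurable_fun_eqr.
by apply: (ae_mp (ae_neq c)) => x; exact: fg.
Qed.

(** The product is the indicator of the overlap of two intervals of length [h], offset by
    [p - c - x]: two indicators convolve to a hat. *)
Lemma ind_overlap (h p c d x : R) : 0 < h -> d = c + h ->
  Int (fun t => ind p (p + h) t * ind c d (t - x)) = h * hat ((p - c - x) / h).
Proof.
move=> h0 ->.
pose lo := Num.max p (c + x); pose hi := Num.min (p + h) (c + h + x).
have -> : Int (fun t => ind p (p + h) t * ind c (c + h) (t - x)) = Int ((fun=> 1 : R) \_ `[lo, hi]).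
  apply: eq_Int => t; rewrite patch_itv in_itv/= /lo /hi ge_max le_min /ind.
  have -> : (c <= t - x <= c + h) = ((c + x <= t) && (t <= c + h + x)).
    by apply/idP/idP => /andP[h1 h2]; apply/andP; split; lra.
  by case: (p <= t); case: (t <= p + h); case: (c + x <= t); case: (t <= _);
    rewrite /= ?mulr0 ?mul0r ?mulr1.
have E : `|(p - c - x) / h| = `|p - c - x| / h by rewrite normrM (gtr0_norm (x := h^-1)) ?invr_gt0.
have lohi : hi - lo = h - `|p - c - x|.
  rewrite /hi /lo; have [h1|h1] := leP p (c + x).
    by rewrite min_l; [rewrite ler0_norm; lra|lra].
  by rewrite min_r; [rewrite gtr0_norm; lra|lra].
have [lh|lh] := leP lo hi; last first.
  rewrite hat0 ?mulr0.
    rewrite -[RHS]Int0; apply: eq_Int => t; rewrite patch_itv in_itv/=.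
    by case: ifPn => // /andP[t1 t2]; lra.
  by rewrite E ler_pdivlMr// mul1r; lra.
have [_ ->] := @Int_bnd_eq R true false false false lo hi (fun=> 1 : R)
  (integ_measurable (integ_cst_itv _ _ _ _ _)).
rewrite Int_cst_oc// mul1r hatE; last by rewrite E ler_pdivrMr// mul1r; lra.
by rewrite E lohi mulrBr mulr1 mulrCA mulfV ?mulr1// gt_eqF.
Qed.

(* By Fubini, the double integral is a moment of [g] against a hat function:
   the scheme integrates the piecewise linear interpolant exactly. *)
Lemma weight_hat (T : R) (N n j : nat) g : 0 < T -> (1 <= j)%N -> (j <= n)%N ->
  (n <= N)%N -> integ (g \_ `]0, T]) ->
  weight T N g n j =
  Int (fun s => (g \_ `]0, T]) s * hat (n%:R - j%:R - s / (T / N%:R))).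
Proof.
move=> T0 j1 jn nN Gi; rewrite /weight /grid.
have N0 : (0 < N)%N by exact: leq_trans (leq_trans j1 jn) nN.
set h := T / N%:R; set G := g \_ _.
have h0 : 0 < h by rewrite divr_gt0 ?ltr0n.
have mG := integ_measurable Gi.
have nT : n%:R * h <= T.
  by rewrite /h mulrCA ler_piMr ?(ltW T0)// ler_pdivrMr ?ltr0n// mul1r ler_nat.
have pn : n.-1%:R * h + h = n%:R * h.
  by rewrite -[X in _ + X]mul1r -mulrDl natr1 (ltn_predK (leq_trans j1 jn)).
have pj : j.-1%:R * h + h = j%:R * h.
  by rewrite -[X in _ + X]mul1r -mulrDl natr1 (ltn_predK j1).
clearbody h.
pose F (t s : R) := ind (n.-1%:R * h) (n%:R * h) t *
   (ind (j.-1%:R * h) (j%:R * h) (t - s) * G s).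
have mind c d : measurable_fun setT (@ind R c d).
  apply: measurable_fun_ifT => //.
  by apply: measurable_and; exact: measurable_fun_ler.
have mF : mplane F.
  apply: mplaneM; first exact: mplane_fst.
  by apply: mplaneM; [exact: mplane_sub|exact: mplane_snd].
have FI s : Int (F^~ s) = h * hat (n%:R - j%:R - s / h) * G s.
  have e : (fun t => ind (n.-1%:R * h) (n%:R * h) t *
      (ind (j.-1%:R * h) (j%:R * h) (t - s) * G s)) =
      fun t => G s * (ind (n.-1%:R * h) (n.-1%:R * h + h) t *
        ind (j.-1%:R * h) (j%:R * h) (t - s)).
    by apply/funext => t; rewrite pn; ring.
  rewrite /F e IntZ.
    rewrite ind_overlap// mulrC; congr (_ * hat _ * _).
    have -> : n.-1%:R * h = n%:R * h - h by rewrite -pn addrK.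
    have -> : j.-1%:R * h = j%:R * h - h by rewrite -pj addrK.
    by field; rewrite gt_eqF.
  apply: (integ_le _ (integ_cst_itv true false (n.-1%:R * h) (n.-1%:R * h + h) 1)).
    apply: measurable_funM => //; apply: (measurableT_comp (mind _ _)).
    exact: measurable_funB.
  move=> t; rewrite patch_itv in_itv/= /ind.
  by case: ifP => _; case: ifP => _; rewrite ?mulr0 ?mul0r ?mulr1 ?normr0 ?normr1.
have Fi s : integ (F^~ s).
  apply: (integ_le _ (integ_cst_itv true false (n.-1%:R * h) (n%:R * h) `|G s|)).
    exact: mplane2 s mF.
  move=> t; rewrite patch_itv in_itv/= /F /ind.
  by case: ifP => _; case: ifP => _; rewrite ?mulr0 ?mul0r ?mulr1 ?mul1r ?normr0.
have FG s : Int (fun t => `|F t s|) <= h * `|G s|.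
  rewrite (_ : (fun t => `|F t s|) = fun t => Num.sg (G s) * F t s).
    rewrite IntZ// FI; apply: (le_trans (ler_norm _)).
    rewrite !normrM (gtr0_norm h0) mulrCA -mulrA ler_wpM2l ?(ltW h0)//.
    rewrite mulrA ler_piMl// mulr_ile1 ?normr_ge0 ?hat_abs_le1//.
    by rewrite normr_sg; case: (_ == 0).
  apply/funext => t; rewrite /F /ind; case: ifP => _; case: ifP => _;
    rewrite ?mulr0 ?mul0r ?mulr0 ?mul1r ?normr0// normrEsg//.
have [fub _ _ _] := Int_fubini mF (integZ h (integ_abs Gi))
  (aeW mu (fun s => conj (Fi s) (FG s))).
have -> : \int[mu]_(t in `[n.-1%:R * h, n%:R * h])
    \int[mu]_(s in `[j.-1%:R * h, Num.min t (j%:R * h)]) g (t - s) =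
    Int (fun t => Int (F t)).
  rewrite RintE; apply: eq_Int => t; rewrite patch_itv in_itv/=.
  case: ifPn => [/andP[t1 t2]|ht]; last first.
    rewrite -[LHS]Int0; apply: eq_Int => s; rewrite /F /ind (negbTE ht) mul0r//.
  have Hi : integ (fun s => ind (j.-1%:R * h) (j%:R * h) (t - s) * G s).
    apply: (integ_mulb (K := 1) Gi); last first.
      by move=> s; rewrite /ind; case: ifP; rewrite ?normr1 ?normr0.
    by apply: (measurableT_comp (mind _ _)); exact: measurable_funB.
  (* The substitution of [t - s] for [s] leaves the kernel a function of the integration variable
     alone, so that the integral in [t] sees only the two indicators. *)
  have [Hi' Hr] := Int_refl t Hi.
  rewrite RintE /F [in RHS](_ : Int _ =
    Int (fun s => ind (j.-1%:R * h) (j%:R * h) (t - s) * G s)); last first.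
    by apply: eq_Int => s; rewrite {1}/ind t1 t2 mul1r.
  (* At [s = t] the kernel has argument 0, which []0, T]] excludes, whereas [weight] evaluates [g]
     there. *)
  rewrite -Hr; apply: (@Int_neq1 t); first exact: integ_measurable.
  have tts s : t - (t - s) = s by exact: subKr.
  move=> s st; rewrite patch_itv in_itv/= le_min tts /ind /G patch_itv in_itv/=.
  have s0 : j.-1%:R * h <= s -> 0 <= s.
    by apply: le_trans; rewrite mulr_ge0 ?ler0n ?(ltW h0).
  have [h1|h1] := leP s t.
    have lst : s < t by rewrite lt_neqAle st.
    rewrite andTb; case: ifP => [/andP[j1' j2']|_]; last by rewrite mul0r.
    rewrite mul1r subr_gt0 lst andTb ifT; first by [].
    by have := s0 j1'; lra.
  by rewrite andbF subr_gt0 ltNge (ltW h1) mulr0.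
rewrite fub -IntZ; last first.
  rewrite (_ : (fun _ => _) = fun s => h * (G s * hat (n%:R - j%:R - s / h))).
    exact/integZ/integ_hat.
  by apply/funext => s; rewrite FI; ring.
by apply: eq_Int => s; rewrite FI -!mulrA mulKf ?gt_eqF// mulrC.
Qed.

Lemma quad_interp (T : R) (N n : nat) g (y : nat -> R) : 0 < T -> (n <= N)%N ->
  integ (g \_ `]0, T]) ->
  integ (fun s => (g \_ `]0, T]) (grid T N n - s) * hat_interp (T / N%:R) n y s) /\
  \sum_(1 <= j < n.+1) weight T N g n j * y j =
  Int (fun s => (g \_ `]0, T]) (grid T N n - s) * hat_interp (T / N%:R) n y s).
Proof.
move=> T0 nN Gi; set h := T / N%:R; set G := g \_ _.
case: n nN => [|n] nN.
  rewrite big_geq// (_ : (fun s => _) = fun=> 0).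
    by rewrite Int0; split => //; exact: integ0.
  by apply/funext => s; rewrite /hat_interp big_geq// mulr0.
have N0 : (0 < N)%N by exact: leq_trans nN.
have h0 : 0 < h by rewrite divr_gt0 ?ltr0n.
have A j : (1 <= j < n.+2)%N ->
    integ (fun s => G (grid T N n.+1 - s) * hat (s / h - j%:R)) /\
    weight T N g n.+1 j = Int (fun s => G (grid T N n.+1 - s) * hat (s / h - j%:R)).
  move=> /andP[j1 jn].
  have [i1 e1] := Int_refl (grid T N n.+1) (integ_hat (n.+1%:R - j%:R) h Gi).
  have E : (fun x => G (grid T N n.+1 - x) *
       hat (n.+1%:R - j%:R - (grid T N n.+1 - x) / h)) =
       fun s => G (grid T N n.+1 - s) * hat (s / h - j%:R).
    apply/funext => s; congr (_ * hat _); rewrite /grid -/h.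
    by field; rewrite gt_eqF.
  by move: i1 e1; rewrite E => i1 e1; rewrite weight_hat//.
(* The guard makes every summand integrable whatever its index, since [integ_sum] does not know the
   range of the sum. *)
have E : (fun s => G (grid T N n.+1 - s) * hat_interp h n.+1 y s) =
    fun s => \sum_(1 <= j < n.+2) (if (1 <= j < n.+2)%N then
       y j * (G (grid T N n.+1 - s) * hat (s / h - j%:R)) else 0).
  apply/funext => s; rewrite /hat_interp mulr_sumr; apply: eq_big_nat => j ->.
  by ring.
have B j : integ (fun s => if (1 <= j < n.+2)%N then
       y j * (G (grid T N n.+1 - s) * hat (s / h - j%:R)) else 0).
  by case: (boolP (1 <= j < n.+2)%N) => [/A[i _]|_]; [exact: integZ|exact: integ0].
rewrite E; split; first by apply: integ_sum => j _; exact: B.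
rewrite Int_sum; last by move=> j _; exact: B.
apply: eq_big_nat => j jn; rewrite jn; have [i ->] := A j jn.
by rewrite IntZ// mulrC.
Qed.

Lemma convolE (T t : R) g1 g2 : t <= T ->
  convol g1 g2 t = Int (fun s => (g1 \_ `]0, T]) (t - s) * (g2 \_ `]0, T]) s).
Proof.
move=> tT; rewrite /convol RintE; apply: eq_Int => s.
rewrite !patch_itv !in_itv/=.
case: ifPn => [/andP[s0 st]|]; first by rewrite !ifT//; apply/andP; split; lra.
rewrite negb_and -!leNgt => /orP[s0|ts].
  by rewrite [X in _ * X]ifF ?mulr0//; apply/negbTE; rewrite negb_and -!ltNge -leNgt s0.
by rewrite ifF ?mul0r//; apply/negbTE; rewrite negb_and -leNgt; apply/orP; left; lra.
Qed.

Lemma hat_interpE (h s : R) (n m : nat) (y : nat -> R) : 0 < h -> y 0%N = 0 -> (m < n)%N ->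
  m%:R * h <= s <= m.+1%:R * h ->
  hat_interp h n y s = y m + (s / h - m%:R) * (y m.+1 - y m).
Proof.
move=> h0 y0 mn /andP[s1 s2].
have u1 : m%:R <= s / h by rewrite ler_pdivlMr.
have u2 : s / h <= m%:R + 1 by rewrite ler_pdivrMr// natr1.
set u := s / h in u1 u2 *.
have -> : hat_interp h n y s = \sum_(0 <= j < n.+1) hat (u - j%:R) * y j.
  by rewrite [RHS]big_nat_recl//= y0 mulr0 add0r /hat_interp big_add1.
rewrite (big_cat_nat (n := m))//=; last exact: ltnW (leqW mn).
rewrite big_nat big1 => [|j /andP[_ jm]]; last first.
  rewrite hat0 ?mul0r// ger0_norm; have : (j.+1%:R : R) <= m%:R by rewrite ler_nat.
    by rewrite -natr1; lra.
  by rewrite -natr1; lra.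
rewrite add0r big_ltn ?(leqW mn)// big_ltn// big_nat big1 => [|j /andP[jm _]]; last first.
  have jm' : (m.+2%:R : R) <= j%:R by rewrite ler_nat.
  rewrite hat0 ?mul0r// ler0_norm; move: jm'; rewrite -!natr1; lra.
rewrite addr0 hatE; last by rewrite ger0_norm; lra.
rewrite hatE; last by rewrite -natr1 ler0_norm; lra.
by rewrite -natr1 ger0_norm ?ler0_norm; lra.
Qed.

End Quadrature.

(** * Interpolation near a weak singularity, and the resulting truncation error *)

Section Truncation.
Context {R : realType}.
Local Notation mu := (@lebesgue_measure R).

Lemma Int_cst_oo (a b k : R) : a <= b -> Int ((fun=> k) \_ `]a, b[) = k * (b - a).
Proof.
move=> ab; rewrite -RintE Rintegral_cst//= lebesgue_measure_itv/= lte_fin.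
by move: ab; rewrite le_eqVlt => /predU1P[->|->//]; rewrite ltxx subrr.
Qed.

Lemma powR_anti (p x y : R) : p <= 0 -> 0 < x -> x <= y -> y `^ p <= x `^ p.
Proof.
move=> p0 x0 xy; have y0 := lt_le_trans x0 xy.
rewrite -(opprK p) !(powRN _ (- p)) lef_pV2 ?posrE ?powR_gt0//.
by apply: ge0_ler_powR; rewrite ?nnegrE ?oppr_ge0// ltW.
Qed.

Lemma powRDp (x p q : R) : 0 < x -> x `^ (p + q) = x `^ p * x `^ q.
Proof. by move=> x0; rewrite powRD// (gt_eqF x0) implybT. Qed.

Lemma measurable_conv_pow (p q t : R) :
  measurable_fun setT ((fun s => (t - s) `^ (p - 1) * s `^ (q - 1)) \_ `]0, t[).
Proof.
apply: measurable_patch_itv; apply: measurable_funM; last exact: measurable_powR.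
apply: (measurableT_comp (measurable_powR _)); exact: measurable_funB.
Qed.

Let half_pow (r t s : R) : R := ((fun s : R => s `^ (r - 1)) \_ `]0, t / 2]) s.

Let half_pow_ge0 r t s : 0 <= half_pow r t s.
Proof. by rewrite /half_pow patch_itv; case: ifP => // _; exact: powR_ge0. Qed.

Let conv_pow_le (p q t s : R) : p <= 1 -> q <= 1 -> 0 < t ->
  `|((fun s => (t - s) `^ (p - 1) * s `^ (q - 1)) \_ `]0, t[) s| <=
    (t / 2) `^ (p - 1) * half_pow q t s + (t / 2) `^ (q - 1) * half_pow p t (t - s).
Proof.
move=> p1 q1 t0.
have A0 : 0 <= (t / 2) `^ (p - 1) * half_pow q t s.
  by apply: mulr_ge0; [exact: powR_ge0|exact: half_pow_ge0].
have B0 : 0 <= (t / 2) `^ (q - 1) * half_pow p t (t - s).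
  by apply: mulr_ge0; [exact: powR_ge0|exact: half_pow_ge0].
rewrite patch_itv in_itv/=; case: ifPn => [/andP[s0 st]|_]; last first.
  by rewrite normr0; exact: addr_ge0.
rewrite ger0_norm; last by apply: mulr_ge0; exact: powR_ge0.
have [h|h] := leP s (t / 2).
  apply: (@le_trans _ _ ((t / 2) `^ (p - 1) * half_pow q t s)); last by rewrite lerDl.
  rewrite /half_pow patch_itv in_itv/= s0 h /=; apply: ler_wpM2r; first exact: powR_ge0.
  by apply: powR_anti; lra.
apply: (@le_trans _ _ ((t / 2) `^ (q - 1) * half_pow p t (t - s))); last by rewrite lerDr.
have -> : half_pow p t (t - s) = (t - s) `^ (p - 1).
  by rewrite /half_pow patch_itv in_itv/= ifT//; apply/andP; split; lra.
rewrite mulrC; apply: ler_wpM2r; first exact: powR_ge0.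
by apply: powR_anti; lra.
Qed.

(** A bound of the Beta integral by splitting at [t / 2]: on each half one factor is at most its
    value at [t / 2], and the other is integrated exactly. *)
Lemma conv_pow (p q t : R) : 0 < p <= 1 -> 0 < q <= 1 -> 0 < t ->
  integ ((fun s => (t - s) `^ (p - 1) * s `^ (q - 1)) \_ `]0, t[) /\
  Int ((fun s => (t - s) `^ (p - 1) * s `^ (q - 1)) \_ `]0, t[) <=
    (t / 2) `^ (p + q - 1) * (p^-1 + q^-1).
Proof.
move=> /andP[p0 p1] /andP[q0 q1] t0; have t20 : 0 < t / 2 by lra.
have le s := conv_pow_le s p1 q1 t0.
have [ip_ ep] := Int_powR p0 (ltW t20); have [iq eq] := Int_powR q0 (ltW t20).
have [ip' ep'] := Int_refl t ip_.
have i1 : integ (fun s => (t / 2) `^ (p - 1) * half_pow q t s) by exact: integZ iq.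
have i2 : integ (fun s => (t / 2) `^ (q - 1) * half_pow p t (t - s)) by exact: integZ ip'.
have gi := integD i1 i2.
have fi := integ_le (measurable_conv_pow p q t) gi le.
split; first exact: fi.
apply: (le_trans (ler_norm _)).
apply: (le_trans (Int_abs_le (measurable_conv_pow p q t) gi le)).
have e1 : Int (fun s => (t / 2) `^ (p - 1) * half_pow q t s) =
    (t / 2) `^ (p - 1) * ((t / 2) `^ q / q) by rewrite -eq; exact: IntZ.
have e2 : Int (fun s => (t / 2) `^ (q - 1) * half_pow p t (t - s)) =
    (t / 2) `^ (q - 1) * ((t / 2) `^ p / p) by rewrite -ep -ep'; exact: IntZ.
rewrite (IntD i1 i2) e1 e2 !mulrA -!(powRDp _ _ t20).
have -> : p + q - 1 = (p - 1) + q by ring.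
have -> : q - 1 + p = p - 1 + q by ring.
by rewrite mulrDr addrC.
Qed.

Lemma grid_cell (h s : R) (n : nat) : 0 <= s <= n.+1%:R * h ->
  exists2 m, (m < n.+1)%N & m%:R * h <= s <= m.+1%:R * h.
Proof.
elim: n => [|n ih] /andP[s0 sn]; first by exists 0%N => //; rewrite mul0r s0.
have [h1|h1] := leP s (n.+1%:R * h).
  have [|m mn hm] := ih; first by rewrite s0.
  by exists m => //; exact: leqW.
by exists n.+1 => //; rewrite (ltW h1).
Qed.

(** A form of (R) without derivatives: the second clause is the linear interpolation error on
    [[c, d]] of a function whose second derivative is of size t^(al - 2). *)
Definition singular_at0 (al T K : R) (y : R -> R) : Prop :=
  (forall t, 0 <= t <= T -> `|y t| <= K * t `^ al) /\
  (forall c s d, 0 < c -> c <= s -> s <= d -> c < d -> d <= T ->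
     `|y s - (y c + (s - c) / (d - c) * (y d - y c))| <=
       K * (d - c) ^+ 2 * c `^ (al - 2)).

(** In the first cell both [y] and its interpolant are at most K h^al, and h^(al - p) <= s^(al - p)
    for the rate p = 1/2 + 3/2 al because s <= h. In a later cell starting at [c], the surplus power
    h^(2 - p) is exchanged for c^(2 - p), since h <= c. *)
Lemma interp_error (al T K h s : R) (n : nat) (y : R -> R) :
  0 < al < 1 -> 0 <= K -> singular_at0 al T K y -> 0 < h -> n%:R * h <= T ->
  0 < s <= n%:R * h ->
  `|hat_interp h n (fun j => y (j%:R * h)) s - y s| <=
    2 * K * h `^ (2^-1 + 3 / 2 * al) * s `^ ((1 - al) / 2 - 1).
Proof.
move=> /andP[a0 a1] K0 [yA yB] h0; case: n => [|n] nT /andP[s0 sn].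
  by move: sn; rewrite mul0r leNgt s0.
have h0' := ltW h0; have s0' := ltW s0.
have y0 : y 0 = 0.
  apply/eqP; rewrite -normr_le0; have := yA 0; rewrite powR0 ?gt_eqF// mulr0; apply.
  by rewrite lexx (le_trans _ nT)// mulr_ge0.
have [m mn sm] := grid_cell (ltac:(by rewrite (ltW s0) sn) : 0 <= s <= n.+1%:R * h).
have msT : m.+1%:R * h <= T by apply: le_trans nT; rewrite ler_pM2r// ler_nat.
rewrite (hat_interpE h0 _ mn sm) ?mul0r//.
set th := (1 - al) / 2 - 1.
have th0 : th <= 0 by rewrite /th; lra.
case: m mn sm msT => [|m] mn /andP[sm1 sm2] msT.
  rewrite mul1r in sm2 msT *.
  rewrite subr0 mul0r y0 subr0 add0r.
  have b1 : `|y s| <= K * h `^ al.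
    apply: (le_trans (yA s _)); first by rewrite ltW//= (le_trans sm2).
    by rewrite ler_wpM2l// ge0_ler_powR ?nnegrE// ltW.
  have b2 : `|s / h * y h| <= K * h `^ al.
    rewrite normrM ger0_norm ?divr_ge0 ?(ltW s0) ?(ltW h0)//.
    apply: (@le_trans _ _ (1 * `|y h|)).
      by rewrite ler_wpM2r// ler_pdivrMr// mul1r.
    by rewrite mul1r yA// ltW.
  apply: (le_trans (ler_normB _ _)); apply: (le_trans (lerD b2 b1)).
  rewrite [leLHS](_ : _ = 2 * (K * h `^ al)); last by ring.
  rewrite [leRHS](_ : _ = 2 * (K * (h `^ (2^-1 + 3 / 2 * al) * s `^ th))); last by ring.
  rewrite ler_pM2l//; apply: ler_wpM2l => //.
  have -> : h `^ al = h `^ (2^-1 + 3 / 2 * al) * h `^ th.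
    by rewrite -powRDp//; congr (_ `^ _); rewrite /th; lra.
  by apply: ler_wpM2l; [exact: powR_ge0|exact: powR_anti].
set c := m.+1%:R * h.
have hc : h <= c by rewrite /c ler_peMl ?(ltW h0)// ler1n.
have c0 : 0 < c by exact: lt_le_trans hc.
have dc : m.+2%:R * h - c = h by rewrite /c -mulrBl -natrB// subSnn mul1r.
have divc : s / h - m.+1%:R = (s - c) / h by rewrite /c mulrBl mulfK// gt_eqF.
rewrite -/c in sm1 *; rewrite divc; clearbody c.
have e := yB c s (m.+2%:R * h) c0 sm1 sm2 (ltac:(by rewrite -subr_gt0 dc)) msT.
rewrite dc in e.
rewrite distrC.
apply: (le_trans e).
rewrite -mulrA [leRHS](_ : _ = K * (2 * (h `^ (2^-1 + 3 / 2 * al) * s `^ th))); last by ring.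
apply: ler_wpM2l => //.
(* [ga] is 2 - p for the rate p = 1/2 + 3/2 al, and [th] is al - p. *)
set ga := 2 - al - (1 + al) / 2.
have ga0 : 0 <= ga by rewrite /ga; lra.
have -> : h ^+ 2 = h `^ (2^-1 + 3 / 2 * al) * h `^ ga.
  rewrite -powRDp// -powR_mulrn ?ltW//; congr (_ `^ _); rewrite /ga; lra.
have -> : al - 2 = - ga + th by rewrite /ga /th; lra.
rewrite (powRDp (- ga) th c0) [leRHS]mulrCA -[leLHS]mulrA.
apply: ler_wpM2l; first exact: powR_ge0.
apply: (@le_trans _ _ (1 * c `^ th)).
  rewrite mulrA; apply: ler_wpM2r; first exact: powR_ge0.
  rewrite powRN ler_pdivrMr ?powR_gt0// mul1r.
  by rewrite ge0_ler_powR ?nnegrE// ltW.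
rewrite mul1r.
(* The cell has length h <= c, so s <= 2 c. As -1 <= [th] <= 0, replacing [c] by [s] costs at most
   the factor 2 of the statement. *)
have s2c : s / 2 <= c.
  rewrite ler_pdivrMr//; apply: (le_trans sm2); move: dc; lra.
apply: (le_trans (powR_anti th0 _ s2c)); first lra.
rewrite powRM ?invr_ge0// mulrC ler_wpM2r ?powR_ge0//.
rewrite -powR_inv1// -powRrM mulN1r -[leRHS]powRr1//.
by apply: ler_powR; rewrite ?ler1n// /th; lra.
Qed.

(** The sum is the constant of [conv_pow] for the exponents [al] and [(1 - al) / 2]. The 4 is the 2
    of [interp_error] times a bound 2 for 2^((1 - al) / 2), which comes from the halved time in
    [conv_pow]. *)
Definition quad_const (al : R) : R := 4 * (al^-1 + ((1 - al) / 2)^-1).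

Lemma quad_const_ge0 al : 0 < al < 1 -> 0 <= quad_const al.
Proof.
by move=> /andP[a0 a1]; rewrite /quad_const mulr_ge0// addr_ge0// invr_ge0 ?ltW//; lra.
Qed.

(** By [quad_interp] the quadrature is exact on the interpolant, so what remains is the convolution
    of [g] with the interpolation error, a product of two powers covered by [conv_pow]. *)
Lemma truncation_error (al T A K : R) (N n : nat) (g y : R -> R) :
  0 < al < 1 -> 0 < T -> 0 <= A -> 0 <= K -> (0 < n <= N)%N ->
  integ (g \_ `]0, T]) -> (forall s, 0 < s <= T -> `|g s| <= A * s `^ (al - 1)) ->
  measurable_fun setT (y \_ `]0, T]) -> singular_at0 al T K y ->
  `|\sum_(1 <= j < n.+1) weight T N g n j * y (grid T N j) - convol g y (grid T N n)|
  <= A * K * quad_const al *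
     ((T / N%:R) `^ (2^-1 + 3 / 2 * al) * grid T N n `^ ((al - 1) / 2)).
Proof.
move=> al01 T0 A0 K0 /andP[n0 nN] Gi gA my yS; have /andP[a0 a1] := al01.
pose G := g \_ `]0, T]; pose Y := y \_ `]0, T].
have N0 : (0 < N)%N by exact: leq_trans nN.
set h := T / N%:R; have h0 : 0 < h by rewrite divr_gt0 ?ltr0n.
set t := grid T N n.
have t0 : 0 < t by rewrite /t /grid mulr_gt0// ltr0n.
have tT : t <= T.
  by rewrite /t /grid mulrCA ler_piMr ?(ltW T0)// ler_pdivrMr ?ltr0n// mul1r ler_nat.
have [i1 ->] := quad_interp (fun j => y (grid T N j)) T0 nN Gi.
rewrite (convolE g y tT) -/t -/G -/Y -/h.
have [Gi' _] := Int_refl t Gi.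
have Yb x : `|Y x| <= K * T `^ al.
  rewrite /Y patch_itv in_itv/=; case: ifPn => [/andP[x0 xT]|_].
    apply: (le_trans (yS.1 x _)); first by rewrite ltW.
    by rewrite ler_wpM2l// ge0_ler_powR ?nnegrE// ltW.
  by rewrite normr0 mulr_ge0 ?powR_ge0.
have i2 : integ (fun s => G (t - s) * Y s).
  have := integ_mulb Gi' my Yb; congr integ; by apply/funext => s; rewrite mulrC.
rewrite -IntB//.
set q := (1 - al) / 2.
have q01 : 0 < q <= 1 by rewrite /q; apply/andP; split; lra.
have a01 : 0 < al <= 1 by rewrite a0 ltW.
have [ci ce] := conv_pow a01 q01 t0.
have mm : measurable_fun setT (fun s : R => G (t - s) * hat_interp h n (fun j => y (grid T N j)) s -
   G (t - s) * Y s).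
  by apply: measurable_funB; exact: integ_measurable.
set B := 2 * K * h `^ (2^-1 + 3 / 2 * al).
have B0 : 0 <= B by rewrite /B !mulr_ge0 ?powR_ge0.
apply: (le_trans (Int_abs_le mm (integZ (A * B) ci) _)).
  move=> s; rewrite patch_itv in_itv/=.
  case: ifPn => [/andP[s0 st]|hs].
    rewrite -mulrBr normrM.
    have -> : Y s = y s by rewrite /Y patch_itv in_itv/= s0 (le_trans (ltW st) tT).
    have sin_ : 0 < s <= n%:R * h by rewrite s0 (ltW st).
    have e := interp_error al01 K0 yS h0 tT sin_.
    have Gs : `|G (t - s)| <= A * (t - s) `^ (al - 1).
      rewrite /G patch_itv in_itv/=; case: ifPn => [/gA//|_].
      by rewrite normr0 mulr_ge0 ?powR_ge0.
    have := ler_pM (normr_ge0 _) (normr_ge0 _) Gs e.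
    rewrite -/B -/q; congr (_ <= _); ring.
  rewrite mulr0 -mulrBr; move: hs; rewrite negb_and -!leNgt => /orP[s0|ts].
    have -> : Y s = 0 by rewrite /Y patch_itv in_itv/= ltNge s0.
    rewrite /hat_interp big_nat big1 ?subrr ?mulr0 ?normr0// => j /andP[j1 _].
    rewrite hat0 ?mul0r// ler0_norm.
      rewrite opprB lerBrDr; apply: (@le_trans _ _ 1); last by rewrite ler1n.
      by rewrite gerDl mulr_le0_ge0// invr_ge0 (ltW h0).
    by rewrite subr_le0 (@le_trans _ _ 0)// mulr_le0_ge0// invr_ge0 ltW.
  have -> : G (t - s) = 0 by rewrite /G patch_itv in_itv/= ltNge subr_le0 ts.
  by rewrite mul0r normr0.
rewrite IntZ//; apply: (le_trans (ler_wpM2l _ ce)); first by rewrite mulr_ge0.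
have -> : al + q - 1 = (al - 1) / 2 by rewrite /q; lra.
rewrite powRM ?invr_ge0 ?(ltW t0)//.
have e2 : 2^-1 `^ ((al - 1) / 2) <= 2 :> R.
  have : -1 <= (al - 1) / 2 by lra.
  move: (_ / 2) => e e1; rewrite -powR_inv1// -powRrM mulN1r -[leRHS]powRr1//.
  by apply: ler_powR; rewrite ?ler1n//; lra.
rewrite /quad_const -/q /B.
set X := h `^ _; set Z := t `^ _; set W := al^-1 + q^-1.
have W0 : 0 <= W by apply: addr_ge0; rewrite invr_ge0 /q; lra.
have X0 : 0 <= X by exact: powR_ge0.
have Z0 : 0 <= Z by exact: powR_ge0.
have P0 : 0 <= A * K * X * Z * W by rewrite !mulr_ge0.
rewrite [leLHS](_ : _ = (2 * (A * K * X * Z * W)) * 2^-1 `^ ((al - 1) / 2)); last by ring.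
rewrite [leRHS](_ : _ = (2 * (A * K * X * Z * W)) * 2); last by ring.
by apply: ler_wpM2l => //; apply: mulr_ge0.
Qed.

(** Growth integrates t^(al - 1), which gives the 1/al. The interpolation error is a combination of
    two Taylor remainders at [c], taken at [s] and at [d], in which the terms [y1 c] cancel; these
    give the 2. Derivatives enter in integrated form only. *)
Lemma ac_singular (al T M : R) (y y1 y2 : R -> R) : 0 < al < 1 -> 0 <= M -> y 0 = 0 ->
  (forall s t, 0 <= s -> s <= t -> t <= T ->
     integ (y1 \_ `]s, t[) /\ y t - y s = Int (y1 \_ `]s, t[)) ->
  (forall s t, 0 < s -> s <= t -> t <= T ->
     integ (y2 \_ `]s, t[) /\ y1 t - y1 s = Int (y2 \_ `]s, t[)) ->
  {ae mu, forall t, 0 < t <= T ->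
     `|y1 t| <= M * t `^ (al - 1) /\ `|y2 t| <= M * t `^ (al - 2)} ->
  singular_at0 al T (M * (al^-1 + 2)) y.
Proof.
move=> /andP[a0 a1] M0 y0 H1 H2 H; split.
  move=> t /andP[t0 tT]; have [i1 e1] := H1 0 t (lexx _) t0 tT.
  have [pi_ pe] := Int_powR a0 t0.
  rewrite -[y t]subr0 -y0 e1.
  apply: (le_trans (Int_abs_le_ae (integ_measurable i1) (integZ M pi_) _)).
    apply: (ae_mp H) => s Hs; rewrite !patch_itv !in_itv/=.
    case: ifPn => [/andP[s0 st]|_].
      rewrite s0 (ltW st) /=; apply: (Hs _).1.
      by rewrite s0 (le_trans (ltW st)).
    by rewrite normr0; case: ifP => _; rewrite ?mulr0// mulr_ge0 ?powR_ge0.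
  rewrite IntZ// pe; have X0 := powR_ge0 t al; set X := t `^ al in X0 *.
  rewrite [leRHS](_ : _ = M * (X / al) + 2 * (M * X)); last by ring.
  by rewrite lerDl !mulr_ge0.
move=> c s d c0 cs sd cd dT.
set L := M * c `^ (al - 2).
have L0 : 0 <= L by rewrite mulr_ge0 ?powR_ge0.
have lip x : c <= x -> x <= d -> `|y1 x - y1 c| <= L * (d - c).
  move=> cx xd; have [i2 ->] := H2 c x c0 cx (le_trans xd dT).
  apply: (@le_trans _ _ (L * (x - c))); last by rewrite ler_wpM2l// lerD2r.
  rewrite -(Int_cst_oo L cx).
  apply: (Int_abs_le_ae (integ_measurable i2) (integ_cst_itv _ _ _ _ _)).
  apply: (ae_mp H) => z Hz; rewrite !patch_itv !in_itv/=.
  case: ifPn => [/andP[cz zx]|_]; last by rewrite normr0.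
  have z0 : 0 < z by exact: lt_trans cz.
  apply: (le_trans (Hz _).2); first by rewrite z0 (le_trans (ltW zx))// (le_trans xd).
  by rewrite ler_wpM2l// powR_anti ?(ltW cz)//; lra.
have tay x : c <= x -> x <= d ->
    `|y x - y c - (x - c) * y1 c| <= (x - c) * (L * (d - c)).
  move=> cx xd; have [i1 ->] := H1 c x (ltW c0) cx (le_trans xd dT).
  rewrite mulrC -(Int_cst_oo (y1 c) cx) -IntB//; last exact: integ_cst_itv.
  rewrite mulrC -(Int_cst_oo (L * (d - c)) cx).
  have mm := integ_measurable (integB i1 (integ_cst_itv false true c x (y1 c))).
  apply: (Int_abs_le mm (integ_cst_itv _ _ _ _ _)) => z.
  rewrite !patch_itv !in_itv/=; case: ifPn => [/andP[cz zx]|_]; last by rewrite subrr normr0.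
  by apply: lip; [exact: ltW|rewrite (le_trans (ltW zx))].
have t1 := tay s cs sd; have t2 := tay d (ltW cd) (lexx d).
set th := (s - c) / (d - c).
have th0 : 0 <= th by rewrite divr_ge0 ?subr_ge0// ltW.
have th1 : th <= 1 by rewrite ler_pdivrMr ?subr_gt0// mul1r lerD2r.
have -> : y s - (y c + th * (y d - y c)) =
  (y s - y c - (s - c) * y1 c) - th * (y d - y c - (d - c) * y1 c).
  have -> : s - c = th * (d - c) by rewrite mulfVK// gt_eqF// subr_gt0.
  by ring.
apply: (le_trans (ler_normB _ _)); rewrite normrM (ger0_norm th0).
have u : 0 <= L * (d - c) by rewrite mulr_ge0// subr_ge0 ltW.
have dc0 : 0 <= d - c by rewrite subr_ge0 ltW.
apply: (@le_trans _ _ ((d - c) * (L * (d - c)) + 1 * ((d - c) * (L * (d - c))))).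
  apply: lerD; first by rewrite (le_trans t1)// ler_wpM2r// lerD2r.
  by apply: ler_pM.
rewrite mul1r [leRHS](_ : _ = al^-1 * (L * (d - c) ^+ 2) + ((d - c) * (L * (d - c)) + (d - c) * (L * (d - c)))).
  by rewrite lerDr mulr_ge0 ?invr_ge0 ?(ltW a0)// mulr_ge0// sqr_ge0.
by rewrite /L; ring.
Qed.

(** A Riemann sum at right end points of a nonincreasing function stays below its integral. *)
Lemma grid_power_sum (al T : R) (N : nat) : 0 < al <= 1 -> 0 < T -> (0 < N)%N ->
  T / N%:R * \sum_(1 <= l < N.+1) grid T N l `^ (al - 1) <= T `^ al / al.
Proof.
move=> /andP[a0 a1] T0 N0; set h := T / N%:R.
have h0 : 0 < h by rewrite divr_gt0 ?ltr0n.
have nh : N%:R * h = T by rewrite /h mulrCA mulfV ?mulr1// pnatr_eq0 -lt0n.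
suff H n : h * \sum_(1 <= l < n.+1) grid T N l `^ (al - 1) <= (n%:R * h) `^ al / al.
  by rewrite -{2}nh.
elim: n => [|n ih].
  by rewrite big_geq// mulr0 divr_ge0 ?powR_ge0 ?ltW.
rewrite big_nat_recr//= mulrDr.
have n0 : 0 <= n%:R * h by rewrite mulr_ge0 ?(ltW h0).
have n1 : 0 <= n.+1%:R * h by rewrite mulr_ge0 ?(ltW h0).
have nn : n%:R * h <= n.+1%:R * h by rewrite ler_pM2r// ler_nat.
have [i1 e1] := Int_powR a0 n0; have [i2 e2] := Int_powR a0 n1.
apply: (@le_trans _ _ (Int ((fun s : R => s `^ (al - 1)) \_ `]0, n%:R * h]) +
  h * grid T N n.+1 `^ (al - 1))); first by rewrite e1 lerD2r.
rewrite -e2 addrC -lerBrDr -IntB//.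
rewrite [leLHS](_ : _ = grid T N n.+1 `^ (al - 1) * (n.+1%:R * h - n%:R * h)); last first.
  by rewrite -mulrBl -natrB// subSnn mul1r mulrC.
rewrite -(Int_cst_oc _ nn); apply: Int_le; [exact: integ_cst_itv|exact: integB i2 i1|].
move=> x; rewrite !patch_itv !in_itv/=.
have [xn|nx] := leP x (n%:R * h).
  by rewrite (le_trans xn nn) subrr.
rewrite (le_lt_trans n0 nx) /= subr0; case: ifP => // xn1.
rewrite /grid -/h powR_anti//; first lra.
exact: le_lt_trans nx.
Qed.

End Truncation.

(** * Positivity of the weights and the energy estimate *)

Section Fejer.
Context {R : realType}.
Implicit Types (phi a : nat -> R).

Let ndist (n j : nat) : nat := (maxn n j - minn n j)%N.

Let window (m n i : nat) : R := ((n <= i) && (i < n + m))%N%:R.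

Let window_count (L n r : nat) :
  \sum_(0 <= i < L) ((n <= i) && (i < r))%N%:R = (minn L r - n)%N%:R :> R.
Proof.
elim: L => [|L ih]; first by rewrite big_geq// min0n sub0n.
rewrite big_nat_recr//= ih -natrD; congr (_%:R).
by case: (leqP n L) => h1; case: (ltnP L r) => h2 /=; lia.
Qed.

(** The triangle coefficient counts the integers common to the windows of length [m] starting at [n]
    and [j]. It is thus a Gram matrix, and the form is a sum of squares. *)
Let triangle_psd (N m : nat) phi :
  0 <= \sum_(0 <= n < N) \sum_(0 <= j < N) (m - ndist n j)%N%:R * (phi j * phi n).
Proof.
have E n j : (n < N)%N -> (j < N)%N ->
    (m - ndist n j)%N%:R = \sum_(0 <= i < N + m) window m n i * window m j i :> R.
  move=> nN jN.
  rewrite (eq_bigr (fun i => ((maxn n j <= i) && (i < minn n j + m))%N%:R)).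
    rewrite window_count; congr (_%:R); rewrite /ndist; lia.
  move=> i _; rewrite /window -natrM mulnb; congr (nat_of_bool _)%:R; lia.
rewrite (eq_big_nat _ _ (F2 := fun n => \sum_(0 <= j < N) \sum_(0 <= i < N + m)
    (window m n i * phi n) * (window m j i * phi j))); last first.
  move=> n /andP[_ nN]; apply: eq_big_nat => j /andP[_ jN].
  by rewrite E// mulr_suml; apply: eq_bigr => i _; ring.
rewrite (eq_bigr (fun n => \sum_(0 <= i < N + m)
    (window m n i * phi n) * \sum_(0 <= j < N) (window m j i * phi j))); last first.
  by move=> n _; rewrite exchange_big; apply: eq_bigr => i _; rewrite mulr_sumr.
rewrite exchange_big; apply: sumr_ge0 => i _.
by rewrite -mulr_suml -expr2 sqr_ge0.
Qed.

(** Two summations by parts. For a convex, nonincreasing, nonnegative sequence this is a nonnegative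
    combination of a constant and of triangles. *)
Let convex_decomp a (M k : nat) : (k <= M)%N ->
  a k = a M + (M - k)%N%:R * (a M - a M.+1) +
    \sum_(0 <= m < M) (m.+1 - k)%N%:R * (a m - 2 * a m.+1 + a m.+2).
Proof.
elim: M => [|M ih].
  by rewrite leqn0 => /eqP ->; rewrite subnn big_geq// mul0r !addr0.
rewrite leq_eqVlt => /predU1P[->|].
  rewrite subnn mul0r addr0 big_nat big1 ?addr0// => m /andP[_ mM].
  by rewrite (_ : _ - _ = 0)%N ?mul0r//; lia.
rewrite ltnS => kM; rewrite (ih kM) big_nat_recr//= subSn// -[in RHS]natr1.
by set x := (M - k)%N%:R; set S := \sum_(_ <= _ < _) _; ring.
Qed.

Lemma convex_toeplitz_psd a (N : nat) phi :
  (forall k, 0 <= a k) -> (forall k, a k.+1 <= a k) ->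
  (forall k, 0 <= a k - 2 * a k.+1 + a k.+2) ->
  0 <= \sum_(0 <= n < N) \sum_(0 <= j < N) a (ndist n j) * (phi j * phi n).
Proof.
move=> a0 a1 a2.
rewrite (eq_big_nat _ _ (F2 := fun n => \sum_(0 <= j < N) a N * (phi j * phi n) +
   ((a N - a N.+1) * \sum_(0 <= j < N) (N - ndist n j)%N%:R * (phi j * phi n) +
   \sum_(0 <= m < N) (a m - 2 * a m.+1 + a m.+2) *
     \sum_(0 <= j < N) (m.+1 - ndist n j)%N%:R * (phi j * phi n)))); last first.
  move=> n /andP[_ nN].
  have E3 : \sum_(0 <= m < N) (a m - 2 * a m.+1 + a m.+2) *
      \sum_(0 <= j < N) (m.+1 - ndist n j)%N%:R * (phi j * phi n) =
      \sum_(0 <= j < N) \sum_(0 <= m < N) (a m - 2 * a m.+1 + a m.+2) *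
        ((m.+1 - ndist n j)%N%:R * (phi j * phi n)).
    by rewrite exchange_big; apply: eq_bigr => m _; rewrite mulr_sumr.
  rewrite E3 mulr_sumr -!big_split; apply: eq_big_nat => j /andP[_ jN] /=.
  rewrite (@convex_decomp a N (ndist n j)); last by rewrite /ndist; lia.
  rewrite !mulrDl mulr_suml addrA; congr (_ + _ + _).
    by ring.
  by apply: eq_bigr => m _; ring.
rewrite !big_split /=; apply: addr_ge0; [|apply: addr_ge0].
- rewrite (eq_bigr (fun n => (a N * \sum_(0 <= j < N) phi j) * phi n)).
    by rewrite -mulr_sumr -mulrA -expr2 mulr_ge0// sqr_ge0.
  by move=> n _; rewrite mulr_sumr mulr_suml; apply: eq_bigr => j _; ring.
- by rewrite -mulr_sumr mulr_ge0 ?subr_ge0// triangle_psd.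
- rewrite exchange_big; apply: sumr_ge0 => m _.
  by rewrite -mulr_sumr mulr_ge0// triangle_psd.
Qed.

(** Twice the lower triangular form is the full symmetric form with the diagonal coefficient
    doubled. Hence the sequence [a], and the separate convexity condition at index 0. *)
Lemma lower_toeplitz_psd (w : nat -> R) (N : nat) phi :
  (forall k, 0 <= w k) -> (forall k, w k.+2 <= w k.+1) ->
  0 <= 2 * w 0%N - 2 * w 1%N + w 2%N ->
  (forall k, 0 <= w k.+1 - 2 * w k.+2 + w k.+3) ->
  0 <= \sum_(0 <= n < N) \sum_(0 <= j < n.+1) w (n - j)%N * (phi j * phi n).
Proof.
move=> w0 w1 w2 w3.
pose a k := if k is 0%N then 2 * w 0%N else w k.
have a0 k : 0 <= a k by case: k => [|k] /=; [exact: mulr_ge0|exact: w0].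
have a1 k : a k.+1 <= a k.
  by case: k => [|k] /=; [have := w1 0%N; lra|exact: w1].
have a2 k : 0 <= a k - 2 * a k.+1 + a k.+2 by case: k => [|k]; [exact: w2|exact: w3].
have H := convex_toeplitz_psd N phi a0 a1 a2.
suff E M : \sum_(0 <= n < M) \sum_(0 <= j < M) a (ndist n j) * (phi j * phi n) =
    2 * \sum_(0 <= n < M) \sum_(0 <= j < n.+1) w (n - j)%N * (phi j * phi n).
  by move: H; rewrite E; lra.
elim: M => [|M ih]; first by rewrite !big_geq// mulr0.
rewrite [X in _ = 2 * X]big_nat_recr//= mulrDr -ih [LHS]big_nat_recr//=.
have -> : \sum_(0 <= n < M) \sum_(0 <= j < M.+1) a (ndist n j) * (phi j * phi n) =
    \sum_(0 <= n < M) \sum_(0 <= j < M) a (ndist n j) * (phi j * phi n) +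
    \sum_(0 <= n < M) w (M - n)%N * (phi n * phi M).
  rewrite -big_split; apply: eq_big_nat => n /andP[_ nM] /=.
  rewrite big_nat_recr//=; congr (_ + _).
  have -> : ndist n M = (M - n.+1).+1 by rewrite /ndist; lia.
  have -> : (M - n)%N = (M - n.+1).+1 by lia.
  by rewrite /=; ring.
rewrite -addrA; congr (_ + _).
rewrite [X in _ + X = _]big_nat_recr//= [X in _ = 2 * X]big_nat_recr//= subnn.
have -> : ndist M M = 0%N by rewrite /ndist; lia.
rewrite (eq_big_nat _ _ (F1 := fun j => a (ndist M j) * (phi j * phi M))
   (F2 := fun j => w (M - j)%N * (phi j * phi M))); last first.
  move=> j /andP[_ jM].
  have -> : ndist M j = (M - j.+1).+1 by rewrite /ndist; lia.
  by have -> : (M - j)%N = (M - j.+1).+1 by lia.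
by rewrite /=; set S := \sum_(_ <= _ < _) _; ring.
Qed.

End Fejer.

(** * Convexity of the fractional-integral weights *)

Section BetaWeights.
Context {R : realType} (al h : R).
Hypotheses (al01 : 0 < al < 1) (h0 : 0 < h).
Local Notation mu := (@lebesgue_measure R).

Let a0 : 0 < al. Proof. by case/andP: al01. Qed.
Let a1 : al < 1. Proof. by case/andP: al01. Qed.

(** The kernel without its cut at [T], so that shifts by [h] act freely; it is not integrable on the
    half-line, but its moments against hats are finite. *)
Definition halfpow (s : R) : R := ((fun s : R => s `^ (al - 1)) \_ `]0, +oo[) s.

Definition wt (k : nat) : R := Int (fun s => halfpow s * hat (k%:R - s / h)).

Let hpE s : halfpow s = if 0 < s then s `^ (al - 1) else 0.
Proof. by rewrite /halfpow patch_itv in_itv/= andbT. Qed.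

Let hp_ge0 s : 0 <= halfpow s.
Proof. by rewrite hpE; case: ifP => // _; exact: powR_ge0. Qed.

Let mhp : measurable_fun setT halfpow.
Proof. by apply: measurable_patch_itv; exact: measurable_powR. Qed.

Lemma halfpow_cut (L : R) s : ((fun s : R => s `^ (al - 1)) \_ `]0, L]) s =
  if s <= L then halfpow s else 0.
Proof. by rewrite patch_itv in_itv/= hpE andbC; case: (s <= L); case: (0 < s). Qed.

Lemma wt_cut (k : nat) (L s : R) : k.+1%:R * h <= L ->
  halfpow s * hat (k%:R - s / h) =
  ((fun s : R => s `^ (al - 1)) \_ `]0, L]) s * hat (k%:R - s / h).
Proof.
move=> kL; rewrite halfpow_cut; case: leP => // Ls.
rewrite mul0r hat0 ?mulr0//.
have : k.+1%:R <= s / h by rewrite ler_pdivlMr// (le_trans kL)// ltW.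
by rewrite -natr1 => ?; rewrite ler0_norm; lra.
Qed.

Let wt_integ (k : nat) : integ (fun s => halfpow s * hat (k%:R - s / h)).
Proof.
have L0 : 0 <= k.+1%:R * h by rewrite mulr_ge0// ltW.
have [pi_ _] := Int_powR a0 L0.
have := integ_hat k%:R h pi_; congr integ; apply/funext => s.
by rewrite (@wt_cut _ (k.+1%:R * h)).
Qed.

Lemma wt_ge0 k : 0 <= wt k.
Proof. by apply: Int_ge0 => s; rewrite mulr_ge0 ?hat_ge0. Qed.

(** A change of index in the hat becomes a shift of the kernel. Consecutive weights are thus
    integrals against one common hat, and are compared through the kernel pointwise. *)
Let wt_shift (k : nat) : integ (fun s => halfpow (s + h) * hat (k%:R - s / h)) /\
  wt k.+1 = Int (fun s => halfpow (s + h) * hat (k%:R - s / h)).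
Proof.
have [i e] := Int_shift h (wt_integ k.+1).
have E : (fun s => halfpow (s + h) * hat (k.+1%:R - (s + h) / h)) =
    (fun s => halfpow (s + h) * hat (k%:R - s / h)).
  apply/funext => s; congr (_ * hat _); rewrite -natr1; field; exact: lt0r_neq0.
by move: i e; rewrite E => i e; rewrite /wt e.
Qed.

Let wt_unshift (k : nat) : integ (fun s => halfpow (s - h) * hat (k.+1%:R - s / h)) /\
  wt k = Int (fun s => halfpow (s - h) * hat (k.+1%:R - s / h)).
Proof.
have [i e] := Int_shift (- h) (wt_integ k).
have E : (fun s => halfpow (s - h) * hat (k%:R - (s - h) / h)) =
    (fun s => halfpow (s - h) * hat (k.+1%:R - s / h)).
  apply/funext => s; congr (_ * hat _); rewrite -natr1; field; exact: lt0r_neq0.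
by move: i e; rewrite E => i e; rewrite /wt e.
Qed.

Let hat_supp (k : nat) s : s <= k%:R * h -> hat (k.+1%:R - s / h) = 0.
Proof.
move=> sk; rewrite hat0//.
have : s / h <= k%:R by rewrite ler_pdivrMr.
by rewrite -natr1 => ?; rewrite ger0_norm; lra.
Qed.

Lemma wt_noninc k : wt k.+2 <= wt k.+1.
Proof.
have [i ->] := wt_shift k.+1.
apply: (Int_le i (wt_integ k.+1)) => s; have [s0|s0] := leP s 0.
  rewrite !(hat_supp (k := k)) ?mulr0//.
  by apply: (le_trans s0); rewrite mulr_ge0// ltW.
rewrite ler_wpM2r ?hat_ge0// !hpE s0 (addr_gt0 s0 h0) powR_anti//; last by rewrite lerDl ltW.
by have := a1; lra.
Qed.

(** The arithmetic-geometric mean inequality, since (s - h)(s + h) <= s^2 and the exponent is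
    negative. *)
Let convex_pow s : h < s -> 2 * s `^ (al - 1) <= (s - h) `^ (al - 1) + (s + h) `^ (al - 1).
Proof.
move=> hs; have s0 : 0 < s by exact: lt_trans hs.
have u0 : 0 < s - h by lra.
have v0 : 0 < s + h by exact: addr_gt0.
set e := (al - 1) / 2.
have e0 : e <= 0 by rewrite /e; have := a1; lra.
have PE x : x `^ (al - 1) = (x `^ e) ^+ 2.
  rewrite -powR_mulrn ?powR_ge0// -powRrM; congr (_ `^ _); rewrite /e; lra.
have : s `^ e ^+ 2 <= (s - h) `^ e * (s + h) `^ e.
  rewrite expr2 -!powRM ?(ltW u0) ?(ltW v0) ?(ltW s0)//; apply: powR_anti => //; first by rewrite mulr_gt0.
  by have := sqr_ge0 h; lra.
rewrite !PE; have := sqr_ge0 ((s - h) `^ e - (s + h) `^ e).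
by set A := (s - h) `^ e; set B := (s + h) `^ e; set C := s `^ e; lra.
Qed.

Lemma wt_convex k : 0 <= wt k.+1 - 2 * wt k.+2 + wt k.+3.
Proof.
have [i1 ->] := wt_shift k.+2; have [i2 ->] := wt_unshift k.+1.
have i0 := wt_integ k.+2; rewrite {1}/wt.
rewrite -(IntZ 2 i0) -(IntB i2 (integZ 2 i0)) -(IntD (integB i2 (integZ 2 i0)) i1).
apply: Int_ge0 => s.
(* Up to [h] the kernel shifted by [- h] is cut to 0 and convexity fails, but the hat vanishes
   there. *)
have [sh|hs] := leP s h.
  rewrite !(hat_supp (k := k.+1)) ?mulr0 ?subrr ?addr0//.
  by apply: (le_trans sh); rewrite ler_peMl ?ler1n// ltW.
have s0 : 0 < s by exact: lt_trans hs.
rewrite mulrA -mulrBl -mulrDl mulr_ge0 ?hat_ge0// !hpE subr_gt0 hs s0 (addr_gt0 s0 h0).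
by have := convex_pow hs; lra.
Qed.

Let ramp (x s : R) : R := halfpow s * Num.max 0 (x - s).

Let Int_ramp x : 0 <= x -> integ (ramp x) /\ Int (ramp x) = x `^ (al + 1) / (al * (al + 1)).
Proof.
move=> x0; have a2 : 0 < al + 1 by have := a0; lra.
have [i1 e1] := Int_powR a0 x0; have [i2 e2] := Int_powR a2 x0.
have E : ramp x = fun s => x * ((fun s : R => s `^ (al - 1)) \_ `]0, x]) s -
    ((fun s : R => s `^ (al + 1 - 1)) \_ `]0, x]) s.
  apply/funext => s; rewrite /ramp hpE !patch_itv in_itv/=.
  case: (ltP 0 s) => s0; last by rewrite mul0r mulr0 subr0.
  have [xs|xs] := leP s x; last by rewrite max_l ?mulr0 ?subr0// subr_le0 ltW.
  have -> : s `^ (al + 1 - 1) = s `^ (al - 1) * s.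
    by rewrite -[X in _ * X]powRr1 ?(ltW s0)// -powRDp//; congr (_ `^ _); ring.
  by rewrite max_r ?subr_ge0//=; ring.
rewrite E; split; first exact: integB (integZ _ i1) i2.
rewrite (IntB (integZ x i1) i2) (IntZ x i1) e1 e2.
move: x0; rewrite le_eqVlt => /predU1P[<-|x0].
  by rewrite !powR0 ?gt_eqF// !mul0r subr0.
rewrite (powRDp _ _ x0) powRr1 ?(ltW x0)//; field.
by rewrite !gt_eqF.
Qed.

(* Nonnegativity of the second difference, at its first index, of the sequence
   [2 w_0, w_1, w_2, ...] of the weights. *)
Let pow23 : 0 <= 7 - 4 * 2 `^ (al + 1) + 3 `^ (al + 1) :> R.
Proof.
set s := 1 - al; have s0 : 0 <= s by rewrite /s; have := a1; lra.
(* This is 3^9 <= 2^16. With s = 1 - al, factoring out 2^(- s) leaves 7 * 2^s - 16 + 9 (2/3)^s, and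
   exp x >= 1 + x bounds it below by s (16 ln 2 - 9 ln 3). *)
have l32 : 9 * ln 3 <= 16 * ln 2 :> R.
  by rewrite !mulr_natl -!lnXn// ler_ln ?posrE ?exprn_gt0// -!natrX ler_nat.
have P (x : R) : 0 < x -> x `^ (al + 1) = x ^+ 2 * expR (- s * ln x).
  move=> x0; rewrite -powR_mulrn ?ltW// (_ : al + 1 = 2%:R + - s); last by rewrite /s; ring.
  by rewrite powRDp//; congr (_ * _); rewrite /powR gt_eqF.
rewrite !P//.
have -> : 7 - 4 * (2 ^+ 2 * expR (- s * ln 2)) + 3 ^+ 2 * expR (- s * ln 3) =
  expR (- s * ln 2) * (7 * expR (s * ln 2) - 16 + 9 * expR (s * ln 2 - s * ln 3)) :> R.
  rewrite expRD; rewrite !mulNr !expRN.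
  have := expR_gt0 (s * ln 2 : R); have := expR_gt0 (s * ln 3 : R) => h2 h3.
  by field; rewrite !gt_eqF.
rewrite mulr_ge0 ?expR_ge0//.
have h1 := expR_ge1Dx (s * ln 2 : R); have h2 := expR_ge1Dx (s * ln 2 - s * ln 3 : R).
have h3 : 0 <= s * (16 * ln 2 - 9 * ln 3) :> R by rewrite mulr_ge0// subr_ge0.
by lra.
Qed.

Lemma wt_convex0 : 0 <= 2 * wt 0 - 2 * wt 1 + wt 2.
Proof.
have [i1 e1] := Int_ramp (ltW h0).
have [i2 e2] := @Int_ramp (2 * h) (ltac:(by rewrite mulr_ge0// ltW)).
have [i3 e3] := @Int_ramp (3 * h) (ltac:(by rewrite mulr_ge0// ltW)).
have i0 := wt_integ 0; have i0' := wt_integ 1; have i0'' := wt_integ 2.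
(* On [u > 0] the combination of hats is piecewise linear with slopes -4, 3, -1, 0; the coefficients
   7, -4, 1 are its changes of slope at 1, 2, 3. *)
have E : 2 * wt 0 - 2 * wt 1 + wt 2 =
    h^-1 * (7 * Int (ramp h) - 4 * Int (ramp (2 * h)) + Int (ramp (3 * h))).
  have j1 := integZ 7 i1; have j2 := integZ 4 i2.
  rewrite -(IntZ 7 i1) -(IntZ 4 i2) -(IntB j1 j2) -(IntD (integB j1 j2) i3).
  rewrite -(IntZ h^-1 (integD (integB j1 j2) i3)).
  have k0 := integZ 2 i0; have k1 := integZ 2 i0'.
  rewrite /wt -(IntZ 2 i0) -(IntZ 2 i0') -(IntB k0 k1) -(IntD (integB k0 k1) i0'').
  apply: eq_Int => s; rewrite /ramp hpE.
  case: ltP => s0; last by rewrite !mul0r !mulr0 !subrr !addr0 !mulr0.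
  have hv : h^-1 * h = 1 by rewrite mulVf// gt_eqF.
  set u := s / h; have su : s = u * h by rewrite /u mulfVK// gt_eqF.
  have u0 : 0 < u by rewrite divr_gt0.
  have M (c : R) : Num.max 0 (c * h - s) = h * Num.max 0 (c - u).
    by rewrite maxr_pMr ?(ltW h0)// mulr0 su; congr Num.max; ring.
  have -> : Num.max 0 (h - s) = h * Num.max 0 (1 - u) by rewrite -M mul1r.
  rewrite !M.
  set p := s `^ _.
  rewrite [RHS](_ : _ = h^-1 * h * (7 * (p * Num.max 0 (1 - u)) -
    4 * (p * Num.max 0 (2 - u)) + p * Num.max 0 (3 - u))); last by ring.
  rewrite hv mul1r.
  rewrite [RHS](_ : _ = p * (7 * Num.max 0 (1 - u) - 4 * Num.max 0 (2 - u) + Num.max 0 (3 - u)));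
    last by ring.
  rewrite [LHS](_ : _ = p * (2 * hat (0 - u) - 2 * hat (1 - u) + hat (2 - u))); last by ring.
  congr (_ * _).
  have Z (x : R) : x <= 0 -> Num.max 0 x = 0 by move=> h'; rewrite max_l.
  have I (x : R) : 0 <= x -> Num.max 0 x = x by move=> h'; rewrite max_r.
  have [u1|u1] := leP u 1.
    rewrite (@hatE _ (0 - u)); last by rewrite sub0r normrN gtr0_norm.
    rewrite (@hatE _ (1 - u)); last by rewrite ger0_norm; lra.
    rewrite (@hat0 _ (2 - u)); last by rewrite ger0_norm; lra.
    rewrite sub0r normrN gtr0_norm// ger0_norm; last lra.
    by rewrite !I; lra.
  rewrite (@hat0 _ (0 - u)); last by rewrite sub0r normrN gtr0_norm// ltW.
  rewrite (Z (1 - u)); last lra.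
  have [u2|u2] := leP u 2.
    rewrite (@hatE _ (1 - u)); last by rewrite ler0_norm; lra.
    rewrite (@hatE _ (2 - u)); last by rewrite ger0_norm; lra.
    rewrite ler0_norm; last lra.
    rewrite ger0_norm; last lra.
    by rewrite !I; lra.
  rewrite (@hat0 _ (1 - u)); last by rewrite ler0_norm; lra.
  rewrite (Z (2 - u)); last lra.
  have [u3|u3] := leP u 3.
    rewrite (@hatE _ (2 - u)); last by rewrite ler0_norm; lra.
    rewrite ler0_norm; last lra.
    by rewrite !I; lra.
  rewrite (@hat0 _ (2 - u)); last by rewrite ler0_norm; lra.
  by rewrite Z; lra.
rewrite E e1 e2 e3 !powRM ?(ltW h0)//.
have -> : h^-1 * (7 * (h `^ (al + 1) / (al * (al + 1))) -
   4 * (2 `^ (al + 1) * h `^ (al + 1) / (al * (al + 1))) +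
   3 `^ (al + 1) * h `^ (al + 1) / (al * (al + 1))) =
  h^-1 * (h `^ (al + 1) / (al * (al + 1))) * (7 - 4 * 2 `^ (al + 1) + 3 `^ (al + 1)).
  by ring.
apply: mulr_ge0 => //.
rewrite mulr_ge0 ?invr_ge0 ?(ltW h0)// mulr_ge0 ?powR_ge0// invr_ge0 mulr_ge0 ?(ltW a0)//.
by have := a0; lra.
Qed.

Lemma wt_psd (N : nat) (phi : nat -> R) :
  0 <= \sum_(0 <= n < N) \sum_(0 <= j < n.+1) wt (n - j)%N * (phi j * phi n).
Proof.
apply: lower_toeplitz_psd;
  [exact: wt_ge0|exact: wt_noninc|exact: wt_convex0|exact: wt_convex].
Qed.

End BetaWeights.

(** * Discrete Gronwall inequalities *)

Section Gronwall.
Context {R : realType}.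

Lemma discrete_gronwall (X : nat -> R) (B L : R) (N : nat) : 0 <= B -> 0 <= L ->
  (forall m, (1 <= m <= N)%N -> X m <= B + L * \sum_(1 <= n < m) X n) ->
  forall m, (1 <= m <= N)%N -> X m <= B * (1 + L) ^+ m.
Proof.
move=> B0 L0 H m /andP[m1 mN].
(* The induction runs on the right-hand side of the hypothesis, which grows by the factor [1 + L] at
   each step. *)
have Y k : (k < N)%N -> B + L * \sum_(1 <= n < k.+1) X n <= B * (1 + L) ^+ k.
  elim: k => [|k ih] kN; first by rewrite big_geq// mulr0 addr0 expr0 mulr1.
  rewrite big_nat_recr//= mulrDr addrA.
  have h1 := ih (ltnW kN); have h2 := H k.+1 (ltnW kN : (1 <= k.+1 <= N)%N).
  set S := B + _ in h1 h2 *; rewrite exprSr mulrA.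
  apply: (@le_trans _ _ (S * (1 + L))).
    by rewrite mulrDr mulr1 lerD2l (mulrC S) ler_wpM2l.
  by rewrite ler_wpM2r// addr_ge0.
case: m m1 mN => // m _ mN.
apply: (le_trans (H m.+1 mN)); apply: (le_trans (Y m mN)).
rewrite exprSr mulrA ler_peMr//; last by rewrite lerDl.
by rewrite mulr_ge0// exprn_ge0// addr_ge0.
Qed.

Lemma sum_sqr_le (x : nat -> R) (n : nat) :
  (\sum_(1 <= j < n.+1) x j) ^+ 2 <= n%:R * \sum_(1 <= j < n.+1) x j ^+ 2.
Proof.
elim: n => [|n ih]; first by rewrite !big_geq// expr0n mul0r.
rewrite !(big_nat_recr n.+1)//= -natr1.
move: ih; set S := \sum_(_ <= _ < _) _; set Q := \sum_(_ <= _ < _) _; set t := x n.+1.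
move=> ih.
have H : 2 * S * t <= Q + n%:R * t ^+ 2.
  case: n @S @Q t ih => [|n] S Q t ih.
    rewrite /S /Q !big_geq//; by rewrite !mul0r mulr0 add0r mul0r.
  have n0 : 0 < n.+1%:R :> R by rewrite ltr0n.
  rewrite -(ler_pM2l n0).
  have := sqr_ge0 (S - n.+1%:R * t); move: ih; set k := n.+1%:R => ih h.
  by nra.
by nra.
Qed.

(** Young's inequality absorbs half of the sum of squares, and Cauchy-Schwarz with n h <= T bounds
    the memory term by K h times earlier partial sums, where K = 2 c^2 T. Gronwall then produces (1
    + 2 K h)^N <= exp (2 K T). *)
Lemma energy_gronwall (x M : nat -> R) (c h T : R) (N : nat) :
  0 < h -> 0 <= c -> N%:R * h <= T -> 2 * c ^+ 2 * T * h <= 2^-1 ->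
  (forall n, 0 <= x n) ->
  (forall m, (m <= N)%N -> \sum_(1 <= n < m.+1) x n ^+ 2 <=
     \sum_(1 <= n < m.+1) x n * (M n + c * h * \sum_(1 <= j < n.+1) x j)) ->
  \sum_(1 <= n < N.+1) x n ^+ 2 <=
    4 * expR (4 * c ^+ 2 * T * T) * \sum_(1 <= n < N.+1) M n ^+ 2.
Proof.
move=> h0 c0 NT Kh x0 H.
pose X m := \sum_(1 <= n < m.+1) x n ^+ 2.
pose A := \sum_(1 <= n < N.+1) M n ^+ 2.
have A0 : 0 <= A by apply: sumr_ge0 => n _; exact: sqr_ge0.
have T0 : 0 <= T by apply: le_trans NT; rewrite mulr_ge0// ltW.
set K := 2 * c ^+ 2 * T in Kh.
have K0 : 0 <= K by rewrite /K !mulr_ge0// sqr_ge0.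
have AM m : (m <= N)%N -> \sum_(1 <= n < m.+1) M n ^+ 2 <= A.
  move=> mN; rewrite /A [leRHS](big_cat_nat (n := m.+1))//= lerDl.
  by apply: sumr_ge0 => n _; exact: sqr_ge0.
have X0 m : 0 <= X m by apply: sumr_ge0 => n _; exact: sqr_ge0.
have H1 m : (m <= N)%N -> X m <= 2 * A + K * h * \sum_(1 <= n < m.+1) X n.
  move=> mN.
  have : X m <= 2^-1 * X m + \sum_(1 <= n < m.+1) M n ^+ 2 +
      2^-1 * (K * h * \sum_(1 <= n < m.+1) X n).
    apply: (le_trans (H m mN)).
    rewrite /X !mulr_sumr -!big_split /= big_nat [leRHS]big_nat.
    apply: ler_sum => n /andP[n1 nm].
    have nh : n%:R * h <= T.
      by apply: le_trans NT; rewrite ler_pM2r// ler_nat; lia.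
    have := sum_sqr_le x n; rewrite -/(X n).
    set S := \sum_(1 <= j < n.+1) x j => hS.
    have e1 : (c * h * S) ^+ 2 <= 2^-1 * (K * h * X n).
      rewrite (_ : (c * h * S) ^+ 2 = c ^+ 2 * h * (h * S ^+ 2)); last by ring.
      rewrite (_ : 2^-1 * _ = c ^+ 2 * h * (T * X n)); last by rewrite /K; field.
      apply: ler_wpM2l; first by rewrite mulr_ge0 ?sqr_ge0// ltW.
      apply: (@le_trans _ _ (h * (n%:R * X n))); first by rewrite ler_wpM2l// ltW.
      by rewrite mulrA (mulrC h) ler_wpM2r.
    have := sqr_ge0 (x n - (M n + c * h * S)); have := sqr_ge0 (M n - c * h * S).
    by move: e1; set Z := c * h * S; set W := 2^-1 * (K * h * X n); nra.
  by have := AM m mN; set S := \sum_(_ <= _ < _) X _; set S' := \sum_(_ <= _ < _) _; lra.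
(* The last summand [X m] goes to the left because K h <= 1/2: this is the smallness condition on
   the step. *)
have H2 m : (1 <= m <= N)%N -> X m <= 4 * A + 2 * (K * h) * \sum_(1 <= n < m) X n.
  move=> /andP[m1 mN]; have := H1 m mN; rewrite big_nat_recr//=.
  have : K * h * X m <= 2^-1 * X m by rewrite ler_wpM2r.
  by rewrite mulrDr; set S := \sum_(_ <= _ < _) _; set Y := X m; lra.
have [->|N0] := posnP N; first by rewrite !big_geq// mulr0.
have KH0 : 0 <= 2 * (K * h) by rewrite !mulr_ge0// ltW.
have := @discrete_gronwall X (4 * A) (2 * (K * h)) N (ltac:(by rewrite mulr_ge0)) KH0 H2 N.
rewrite N0 leqnn => /(_ isT) /le_trans; apply.
rewrite -/A [leRHS](_ : _ = 4 * A * expR (4 * c ^+ 2 * T * T)); last by ring.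
apply: ler_wpM2l; first by rewrite mulr_ge0.
apply: (@le_trans _ _ (expR (2 * (K * h)) ^+ N)).
  by rewrite lerXn2r ?nnegrE ?addr_ge0 ?expR_ge0// expR_ge1Dx.
rewrite -expRM_natl ler_expR.
have -> : 4 * c ^+ 2 * T * T = 2 * K * T by rewrite /K; ring.
have -> : N%:R * (2 * (K * h)) = 2 * K * (N%:R * h) by ring.
by rewrite ler_wpM2l// mulr_ge0.
Qed.

End Gronwall.

(** * Stability of the scheme in L^2 *)

Section EnergyEstimate.
Context {R : realType}.
Local Notation mu := (@lebesgue_measure R).

Lemma Gamma_ge0 (z : R) : 0 <= Gamma z.
Proof. by apply: Rintegral_ge0 => s _; rewrite mulr_ge0 ?powR_ge0 ?expR_ge0. Qed.

Lemma beta_ker_integ (al T : R) : 0 < al -> 0 <= T -> integ (beta_ker al \_ `]0, T]).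
Proof.
move=> a0 T0; have [i _] := Int_powR a0 T0.
have := integZ (Gamma al)^-1 i; congr integ; apply/funext => s.
by rewrite !patch_itv /beta_ker; case: ifP; rewrite ?mulr0// mulrC.
Qed.

Lemma weight_beta (al T : R) (N n j : nat) : 0 < al < 1 -> 0 < T -> (1 <= j)%N ->
  (j <= n)%N -> (n <= N)%N ->
  weight T N (beta_ker al) n j = (Gamma al)^-1 * wt al (T / N%:R) (n - j).
Proof.
move=> al01 T0 j1 jn nN; have /andP[a0 a1] := al01.
have N0 : (0 < N)%N by exact: leq_trans (leq_trans j1 jn) nN.
rewrite weight_hat//; last by apply: beta_ker_integ => //; exact: ltW.
set h := T / N%:R; have h0 : 0 < h by rewrite divr_gt0 ?ltr0n.
have kT : (n - j).+1%:R * h <= T.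
  rewrite /h mulrCA ler_piMr ?(ltW T0)// ler_pdivrMr ?ltr0n// mul1r ler_nat; lia.
have [i _] := Int_powR a0 (ltW T0).
have := integ_hat (n - j)%:R h i => i'.
rewrite /wt -natrB//.
rewrite (@eq_Int _ (fun s => halfpow al s * hat ((n - j)%:R - s / h)) (fun s =>
  ((fun s : R => s `^ (al - 1)) \_ `]0, T]) s * hat ((n - j)%:R - s / h))); last first.
  by move=> s; exact: wt_cut.
rewrite -IntZ//; apply: eq_Int => s.
by rewrite !patch_itv /beta_ker; case: ifP => _; rewrite ?mul0r ?mulr0// mulrAC mulrC mulrA.
Qed.

Lemma weight_beta_psd (al T : R) (N m : nat) (phi : nat -> R) : 0 < al < 1 -> 0 < T ->
  (m <= N)%N ->
  0 <= \sum_(1 <= n < m.+1) \sum_(1 <= j < n.+1)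
    weight T N (beta_ker al) n j * (phi j * phi n).
Proof.
move=> al01 T0; case: m => [|m] mN; first by rewrite big_geq.
have h0 : 0 < T / N%:R by rewrite divr_gt0// ltr0n (leq_trans _ mN).
have := wt_psd al01 h0 m.+1 (fun i => phi i.+1).
have G0 : 0 <= (Gamma al)^-1 by rewrite invr_ge0 Gamma_ge0.
move=> /(mulr_ge0 G0); congr (_ <= _).
rewrite big_add1 /= mulr_sumr; apply: eq_big_nat => n /andP[_ nm].
rewrite big_add1 /= mulr_sumr; apply: eq_big_nat => j /andP[_ jn].
rewrite (weight_beta al01 T0)//; last by rewrite (leq_trans nm).
by rewrite subSS [LHS]mulrA.
Qed.

(** A hat is at most 1 and its support has length twice the step, whence the 2. *)
Lemma weight_bounded (T C : R) (N n j : nat) (g : R -> R) : 0 < T -> 0 <= C -> (1 <= j)%N ->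
  (j <= n)%N -> (n <= N)%N -> integ (g \_ `]0, T]) ->
  (forall s, 0 < s <= T -> `|g s| <= C) ->
  `|weight T N g n j| <= 2 * C * (T / N%:R).
Proof.
move=> T0 C0 j1 jn nN Gi gC; rewrite weight_hat//.
have N0 : (0 < N)%N by exact: leq_trans (leq_trans j1 jn) nN.
set h := T / N%:R; have h0 : 0 < h by rewrite divr_gt0 ?ltr0n.
set k := n%:R - j%:R.
have kk : (k - 1) * h <= (k + 1) * h by rewrite ler_pM2r//; lra.
have -> : 2 * C * h = C * ((k + 1) * h - (k - 1) * h) by ring.
rewrite -(Int_cst_oc C kk).
have mi := integ_measurable (integ_hat k h Gi).
apply: (Int_abs_le mi (integ_cst_itv _ _ _ _ _)) => s.
rewrite !patch_itv !in_itv/= normrM.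
have [s1|s1] := boolP ((k - 1) * h < s <= (k + 1) * h).
  rewrite -[leRHS]mulr1 ler_pM ?hat_abs_le1//.
  by case: ifPn => [/gC//|_]; rewrite normr0.
rewrite (hat0 (x := k - s / h)) ?normr0 ?mulr0//.
move: s1; rewrite negb_and -leNgt -ltNge => /orP[s1|s1].
  have : s / h <= k - 1 by rewrite ler_pdivrMr.
  by move=> ?; rewrite ger0_norm; lra.
have : k + 1 <= s / h by rewrite ler_pdivlMr// ltW.
by move=> ?; rewrite ler0_norm; lra.
Qed.

(** Scalar positivity holds at each [x] for the values [v n x]; this is its integral over []a,
    b[]. *)
Lemma weight_beta_psd_ip (a b al T : R) (N m : nat) (v : nat -> R -> R) :
  0 < al < 1 -> 0 < T -> (m <= N)%N ->
  (forall n, (1 <= n <= N)%N -> in_Lp 2%:E a b (v n)) ->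
  0 <= \sum_(1 <= n < m.+1) \sum_(1 <= j < n.+1)
    weight T N (beta_ker al) n j * ip a b (v j) (v n).
Proof.
move=> al01 T0 mN Lv.
pose F n j x := if [&& 1 <= n, n <= m, 1 <= j & j <= n]%N then
  weight T N (beta_ker al) n j * ((fun x => v j x * v n x) \_ `]a, b[) x else 0.
have Fi n j : integ (F n j).
  rewrite /F; case: (boolP [&& _, _, _ & _]) => [/and4P[n1 nm j1 jn]|_]; last exact: integ0.
  by apply: integZ; apply: integ_ip; apply: Lv; apply/andP; split; rewrite ?(leq_trans _ mN)// (leq_trans jn).
have -> : \sum_(1 <= n < m.+1) \sum_(1 <= j < n.+1)
    weight T N (beta_ker al) n j * ip a b (v j) (v n) =
    Int (fun x => \sum_(1 <= n < m.+1) \sum_(1 <= j < n.+1) F n j x).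
  rewrite Int_sum; last by move=> n _; apply: integ_sum => j _; exact: Fi.
  apply: eq_big_nat => n /andP[n1 nm]; rewrite Int_sum; last by move=> j _; exact: Fi.
  apply: eq_big_nat => j /andP[j1 jn].
  rewrite -IntZ; last by apply: integ_ip; apply: Lv; lia.
  by apply: eq_Int => x; rewrite /F ifT//; apply/and4P; split.
apply: Int_ge0 => x.
have := weight_beta_psd (fun n => (v n \_ `]a, b[) x) al01 T0 mN.
congr (_ <= _); apply: eq_big_nat => n /andP[n1 nm]; apply: eq_big_nat => j /andP[j1 jn].
by rewrite /F ifT ?patchM//; apply/and4P; split.
Qed.

Let in_range (j n N : nat) : (1 <= j -> j < n.+1 -> 1 <= n <= N -> 1 <= j <= N)%N.
Proof. by move=> j1 jn /andP[_ nN]; rewrite j1 (leq_trans _ nN). Qed.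

Let energy_arith (x S1 S2 S3 S4 I M C l s : R) :
  x ^+ 2 + S1 + l * S2 - s * - S3 = I -> I <= M * x -> - S1 <= C * S4 * x ->
  x ^+ 2 + (l * S2 + s * S3) <= x * (M + C * S4).
Proof. by move=> h1 h2 h3; lra. Qed.

Let sum_cond (n N : nat) (F : nat -> R) : (n <= N)%N ->
  \sum_(1 <= j < n.+1) F j = \sum_(1 <= j < n.+1 | (1 <= j <= N)%N) F j.
Proof.
move=> nN; rewrite big_nat_cond [RHS]big_nat_cond.
apply: eq_bigl => j; rewrite andbT; case: (boolP (1 <= j < n.+1)%N) => //= hj.
by symmetry; lia.
Qed.

(** The equation at step [n] is paired with [e n]. The [lam_] and [sg] terms are nonnegative only
    after summation over [n <= m], so the estimate is summed for every [m] before Gronwall. The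
    constants 8 and 16 are those of [energy_gronwall] for c = 2 C, the 2 coming from
    [weight_bounded]. *)
Lemma energy_estimate (a b al T lam_ sg C : R) (N : nat) (g : R -> R)
    (e e1 e2 Rs : nat -> R -> R) (M : nat -> R) :
  0 < al < 1 -> 0 < T -> (0 < N)%N -> 0 <= C -> 0 <= lam_ -> 0 <= sg ->
  integ (g \_ `]0, T]) -> (forall s, 0 < s <= T -> `|g s| <= C) ->
  (forall n, (1 <= n <= N)%N ->
     [/\ in_Lp 2%:E a b (e n), is_wd a b (e n) (e1 n),
         is_wd a b (e1 n) (e2 n) & green a b (e n) (e1 n)]) ->
  (forall n, (1 <= n <= N)%N -> in_Lp 2%:E a b (Rs n) /\ normL2 a b (Rs n) <= M n) ->
  (forall n, (1 <= n <= N)%N -> {ae mu, forall x, a < x < b ->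
     e n x + \sum_(1 <= j < n.+1) weight T N g n j * e j x
       + lam_ * \sum_(1 <= j < n.+1) weight T N (beta_ker al) n j * e j x
       - sg * \sum_(1 <= j < n.+1) weight T N (beta_ker al) n j * e2 j x = Rs n x}) ->
  8 * C ^+ 2 * T * (T / N%:R) <= 2^-1 ->
  \sum_(1 <= n < N.+1) normL2 a b (e n) ^+ 2 <=
    4 * expR (16 * C ^+ 2 * T * T) * \sum_(1 <= n < N.+1) M n ^+ 2.
Proof.
move=> al01 T0 N0 C0 l0 s0 Gi gC He HR Heq small.
set h := T / N%:R in small *; have h0 : 0 < h by rewrite divr_gt0 ?ltr0n.
have Le n : (1 <= n <= N)%N -> in_Lp 2%:E a b (e n) by move=> /He[].
have Le1 n : (1 <= n <= N)%N -> in_Lp 2%:E a b (e1 n) by move=> /He[_ /wd_L2].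
have Le2 n : (1 <= n <= N)%N -> in_Lp 2%:E a b (e2 n) by move=> /He[_ _ /wd_L2].
have -> : 16 * C ^+ 2 * T * T = 4 * (2 * C) ^+ 2 * T * T by ring.
apply: (@energy_gronwall _ _ _ _ h) => //.
- by rewrite mulr_ge0.
- by rewrite /h mulrCA mulfV ?mulr1// pnatr_eq0 -lt0n.
- by move: small; rewrite (_ : 2 * (2 * C) ^+ 2 = 8 * C ^+ 2)//; ring.
- by move=> n; exact: normL2_ge0.
move=> m mN.
have key n : (1 <= n <= N)%N ->
    normL2 a b (e n) ^+ 2 +
    (lam_ * (\sum_(1 <= j < n.+1) weight T N (beta_ker al) n j * ip a b (e j) (e n)) +
     sg * (\sum_(1 <= j < n.+1) weight T N (beta_ker al) n j * ip a b (e1 j) (e1 n))) <=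
    normL2 a b (e n) * (M n + 2 * C * h * \sum_(1 <= j < n.+1) normL2 a b (e j)).
  move=> nN; have Ln := Le n nN; have [LR RM] := HR n nN.
  have Lsum (w : nat -> R) (v : nat -> R -> R) :
      (forall j, (1 <= j <= N)%N -> in_Lp 2%:E a b (v j)) ->
      in_Lp 2%:E a b (fun x => \sum_(1 <= j < n.+1) w j * v j x) /\
      ip a b (fun x => \sum_(1 <= j < n.+1) w j * v j x) (e n) =
        \sum_(1 <= j < n.+1) w j * ip a b (v j) (e n).
    move=> Lv.
    have nN' : (n <= N)%N by case/andP: nN.
    have E : (fun x => \sum_(1 <= j < n.+1) w j * v j x) =
        (fun x => \sum_(1 <= j < n.+1 | (1 <= j <= N)%N) w j * v j x).
      by apply/funext => x; exact: sum_cond.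
    have LZ j : (1 <= j <= N)%N -> in_Lp 2%:E a b (fun x => w j * v j x).
      by move=> jN; apply: L2Z; exact: Lv.
    rewrite E; split; first exact: L2_sum LZ.
    rewrite (ip_suml _ LZ Ln) (sum_cond _ nN').
    by apply: eq_bigr => j jN; exact: (ipZl (w j) (Lv j jN) Ln).
  have [L1 E1] := Lsum (weight T N g n) e Le.
  have [L2_ E2] := Lsum (weight T N (beta_ker al) n) e Le.
  have [L3 E3] := Lsum (weight T N (beta_ker al) n) e2 Le2.
  have LA := L2D (L2D Ln L1) (L2Z lam_ L2_).
  have LB := L2B LA (L2Z sg L3).
  have := ip_ae LB LR Ln (Heq n nN).
  rewrite (ipBl LA (L2Z sg L3) Ln) (ipDl (L2D Ln L1) (L2Z lam_ L2_) Ln) (ipDl Ln L1 Ln).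
  rewrite (ipZl lam_ L2_ Ln) (ipZl sg L3 Ln) E1 E2 E3 -(normL2_sqr Ln).
  (* [green] for [e n] with [e1 j] in the role of [p]: the boundary condition is that of [e n], and
     [e1 j] satisfies none. *)
  have -> : \sum_(1 <= j < n.+1) weight T N (beta_ker al) n j * ip a b (e2 j) (e n) =
     - \sum_(1 <= j < n.+1) weight T N (beta_ker al) n j * ip a b (e1 j) (e1 n).
    rewrite -sumrN; apply: eq_big_nat => j /andP[j1 jn].
    have jN := in_range j1 jn nN.
    have [_ _ _ G] := He n nN; have [_ _ w2 _] := He j jN.
    by rewrite (G _ _ (Le1 j jN) w2) mulrN.
  have b1 : ip a b (Rs n) (e n) <= M n * normL2 a b (e n).
    apply: (le_trans (ler_norm _)); apply: (le_trans (cauchy_schwarz LR Ln)).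
    by rewrite ler_wpM2r// normL2_ge0.
  have b2 : - (\sum_(1 <= j < n.+1) weight T N g n j * ip a b (e j) (e n)) <=
      2 * C * h * (\sum_(1 <= j < n.+1) normL2 a b (e j)) * normL2 a b (e n).
    rewrite -sumrN mulr_sumr mulr_suml big_nat [leRHS]big_nat.
    apply: ler_sum => j /andP[j1 jn].
    have jN := in_range j1 jn nN.
    apply: (le_trans (ler_norm _)); rewrite normrN normrM -[leRHS]mulrA.
    have jn' : (j <= n)%N by [].
    have nN' : (n <= N)%N by case/andP: nN.
    exact: (ler_pM (normr_ge0 _) (normr_ge0 _) (weight_bounded T0 C0 j1 jn' nN' Gi gC)
      (cauchy_schwarz (Le j jN) Ln)).
  by move=> eq; exact: energy_arith eq b1 b2.
have p1 := weight_beta_psd_ip (v := e) al01 T0 mN Le.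
have p2 := weight_beta_psd_ip (v := e1) al01 T0 mN Le1.
apply: (@le_trans _ _ (\sum_(1 <= n < m.+1) (normL2 a b (e n) ^+ 2 +
    (lam_ * (\sum_(1 <= j < n.+1) weight T N (beta_ker al) n j * ip a b (e j) (e n)) +
     sg * (\sum_(1 <= j < n.+1) weight T N (beta_ker al) n j * ip a b (e1 j) (e1 n)))))).
  rewrite big_split /= lerDl big_split /= -!mulr_sumr.
  by apply: addr_ge0; apply: mulr_ge0.
rewrite big_nat [leRHS]big_nat; apply: ler_sum => n /andP[n1 nm].
by apply: key; rewrite n1 (leq_trans _ mN).
Qed.

End EnergyEstimate.

(** * Consistency of the scheme *)

Section TimeDerivative.
Context {R : realType} (a b : R).
Local Notation mu := (@lebesgue_measure R).
Local Notation L2 := (in_Lp 2%:E a b).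
Local Notation ip := (ip a b).

Definition spacetime (s t : R) (w : R -> R -> R) (x th : R) : R :=
  if (x \in `]a, b[) && (th \in `]s, t[) then w x th else 0.

(** Bochner integrability, that is integrability of the L^2 norm in time, dominates the L^1 norms of
    the slices as [Int_fubini] demands. *)
Lemma spacetime_fubini (s t : R) (w : R -> R -> R) :
  mplane (spacetime s t w) ->
  {ae mu, forall th, s < th < t -> L2 (w^~ th)} ->
  (@lebesgue_measure R).-integrable `]s, t[ (fun th => (normL2 a b (w^~ th))%:E) ->
  integ ((fun th => normL2 a b (w^~ th)) \_ `]s, t[) /\
  {ae mu, forall th, integ ((spacetime s t w)^~ th) /\
     Int (fun x => `|spacetime s t w x th|) <=
       normL2 a b (fun=> 1) * ((fun th => normL2 a b (w^~ th)) \_ `]s, t[) th}.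
Proof.
move=> mF Lw ni.
have ni' : integ ((fun th => normL2 a b (w^~ th)) \_ `]s, t[).
  exact/(integ_restrict _ (measurable_itv _)).
split => //; apply: (ae_mp Lw) => th hth.
rewrite patch_itv /spacetime in_itv/=; case: ifPn => [/hth Lth|_].
  have E : (fun x => if (x \in `]a, b[) && true then w x th else 0) = (w^~ th) \_ `]a, b[.
    by apply/funext => x; rewrite patch_itv andbT.
  rewrite E; split; first exact: L2_integ.
  have := Int_L2_le Lth; congr (_ <= _); apply: eq_Int => x.
  by rewrite patch_itv andbT.
have E x : (if (x \in `]a, b[) && false then w x th else 0) = 0 by rewrite andbF.
split; first by rewrite (funext E); exact: integ0.
by rewrite mulr0 (@eq_Int _ _ (fun=> 0)) ?Int0// => x; rewrite E normr0.
Qed.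

Lemma spacetime_pair (s t K : R) (w : R -> R -> R) (chi : R -> R) :
  mplane (spacetime s t w) ->
  {ae mu, forall th, s < th < t -> L2 (w^~ th)} ->
  (@lebesgue_measure R).-integrable `]s, t[ (fun th => (normL2 a b (w^~ th))%:E) ->
  measurable_fun setT chi -> (forall x, `|chi x| <= K) ->
  [/\ integ ((fun th => ip (w^~ th) chi) \_ `]s, t[),
      {ae mu, forall x, integ (spacetime s t w x)} &
      Int ((fun th => ip (w^~ th) chi) \_ `]s, t[) =
      Int (fun x => chi x * Int (spacetime s t w x))].
Proof.
move=> mF Lw ni mchi chiK.
have [ni' H] := spacetime_fubini mF Lw ni.
have [_ ai _ _] := Int_fubini mF (integZ _ ni') H.
pose F x th := chi x * spacetime s t w x th.
have mF' : mplane F by apply: mplaneM => //; exact: mplane_fst.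
have K0 : 0 <= K by exact: le_trans (chiK 0).
have H' : {ae mu, forall th, integ (F^~ th) /\ Int (fun x => `|F x th|) <=
    K * (normL2 a b (fun=> 1) * ((fun th => normL2 a b (w^~ th)) \_ `]s, t[) th)}.
  apply: (ae_mp H) => th [i1 l1].
  have iF : integ (F^~ th) by exact: (integ_mulb i1 mchi chiK).
  split => //; apply: (@le_trans _ _ (K * Int (fun x => `|spacetime s t w x th|))).
    rewrite -IntZ; last exact: integ_abs.
    apply: Int_le; [exact: integ_abs|exact/integZ/integ_abs|].
    by move=> x; rewrite /F normrM ler_wpM2r.
  exact: ler_wpM2l.
have [fub _ i3 i4] := Int_fubini mF' (integZ K (integZ _ ni')) H'.
have E : (fun th => Int (F^~ th)) = (fun th => ip (w^~ th) chi) \_ `]s, t[.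
  apply/funext => th; rewrite patch_itv; case: ifPn => hth.
    apply: eq_Int => x; rewrite /F /spacetime hth andbT patch_itv.
    by case: ifP => _; [exact: mulrC|exact: mulr0].
  rewrite -[RHS]Int0; apply: eq_Int => x.
  by rewrite /F /spacetime (negbTE hth) andbF mulr0.
rewrite -E; split; [exact: i4|exact: ai|rewrite -fub].
apply: Int_ae.
- exact: integ_measurable i3.
- by apply: measurable_funM; [exact: mchi|exact: (mplane_Int mF)].
- by apply: (ae_mp ai) => x ix; rewrite /F IntZ.
Qed.

(** Fubini exchanges the pairing in [x] with the integral in time: [ip (v^~ t) chi] becomes a scalar
    primitive, and vector-valued integrals disappear from here on. *)
Lemma dt_pair (J : interval R) (v w : R -> R -> R) (chi : R -> R) (K s t : R) :
  is_dt a b J v w -> measurable_fun setT chi -> (forall x, `|chi x| <= K) ->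
  s \in J -> t \in J -> s <= t -> (forall th, s < th < t -> th \in J) ->
  integ ((fun th => ip (w^~ th) chi) \_ `]s, t[) /\
  ip (v^~ t) chi - ip (v^~ s) chi = Int ((fun th => ip (w^~ th) chi) \_ `]s, t[).
Proof.
move=> [mw Lv H] mchi chiK sJ tJ st stJ.
have [Lw ni ev] := H s t sJ tJ st.
have mF : mplane (spacetime s t w).
  apply: mplane_itv; apply: measurable_funS mw.
    by apply: measurableX; exact: measurable_itv.
  by move=> [x th] /= [hx hth]; split => //=; apply: stJ; move: hth; rewrite in_itv.
have [i1 ai e1] := spacetime_pair mF Lw ni mchi chiK.
split => //; rewrite e1.
have Lchi : L2 chi by apply: (@L2_bounded _ _ _ _ K) => //; exact: measurable_patch_itv.
have Lvt := Lv t tJ; have Lvs := Lv s sJ.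
rewrite -ipBl//; apply: Int_ae.
- by apply: integ_measurable; apply: integ_ip => //; exact: L2B.
- by apply: measurable_funM => //; exact: mplane_Int.
- apply: (ae_mp ev) => x hx; rewrite patch_itv in_itv/=.
  case: ifPn => [xab|xab].
    rewrite hx// mulrC RintE; congr (_ * _); apply: eq_Int => th.
    by rewrite patch_itv /spacetime [x \in _]in_itv/= xab.
  rewrite (@eq_Int _ _ (fun=> 0)) ?Int0 ?mulr0// => th.
  by rewrite /spacetime [x \in _]in_itv/= (negbTE xab).
Qed.

Lemma prim_measurable (T : R) (P y : R -> R) : integ P ->
  (forall s, 0 < s <= T -> y s = Int (P \_ `]0, s[)) ->
  measurable_fun setT (y \_ `]0, T]).
Proof.
move=> Pi yE; have mP := integ_measurable Pi.
have mF : mplane (fun s th => if th <= 0 then 0 else if s <= th then 0 else P th).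
  have m0 : mplane (fun _ _ => 0 : R) by exact: (@mplane_fst _ (fun=> 0)).
  have m1 : mplane (fun s th => if s <= th then 0 else P th).
    apply: (measurable_fun_ifT (f := fun z : measurableTypeR R * measurableTypeR R =>
      z.1 <= z.2)) => //; last exact: mplane_snd.
    exact: measurable_fun_ler.
  apply: (measurable_fun_ifT (f := fun z : measurableTypeR R * measurableTypeR R =>
      z.2 <= 0)) => //.
  exact: measurable_fun_ler.
have -> : y \_ `]0, T] = (fun s => Int (fun th => if th <= 0 then 0 else
    if s <= th then 0 else P th)) \_ `]0, T].
  apply/funext => s; rewrite !patch_itv in_itv/=; case: ifPn => // /yE ->.
  apply: eq_Int => th; rewrite patch_itv in_itv/=.
  by case: (leP th 0) => //= _; case: leP.
by apply: measurable_patch_itv; exact: mplane_Int mF.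
Qed.

Lemma normH2_le (v : R -> R) : normL2 a b v <= normH a b 2 v /\
  normL2 a b (Dx a b (Dx a b v)) <= normH a b 2 v.
Proof.
have A := sqr_ge0 (normL2 a b v); have B := sqr_ge0 (normL2 a b (Dx a b v)).
have C := sqr_ge0 (normL2 a b (Dx a b (Dx a b v))).
have E : normH a b 2 v = Num.sqrt (normL2 a b v ^+ 2 + normL2 a b (Dx a b v) ^+ 2 +
    normL2 a b (Dx a b (Dx a b v)) ^+ 2).
  by rewrite /normH !big_ord_recr big_ord0 /= add0r.
rewrite E; split.
  rewrite -[leLHS]ger0_norm ?normL2_ge0// -sqrtr_sqr ler_sqrt; last by rewrite !addr_ge0.
  by rewrite -addrA lerDl addr_ge0.
rewrite -[leLHS]ger0_norm ?normL2_ge0// -sqrtr_sqr ler_sqrt; last by rewrite !addr_ge0.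
by rewrite lerDr addr_ge0.
Qed.

(** Both pairings satisfy the hypotheses of [ac_singular]. For the second one the derivatives are
    moved from [chi] back to [w1] and [w2], so that the constant involves the L^2 norm of [chi]
    itself, as the later duality requires. *)
Lemma regularity_singular (T al : R) (w : R -> R -> R) : 0 < T -> 0 < al < 1 ->
  regularity T a b al w -> (forall chi, L2 chi -> ip (w^~ 0) chi = 0) ->
  exists2 C0, 0 <= C0 & forall chi, test_fun a b chi -> test_fun a b (derive1 chi) ->
    singular_at0 al T (C0 * normL2 a b chi) (fun s => ip (w^~ s) chi) /\
    singular_at0 al T (C0 * normL2 a b chi)
      (fun s => ip (w^~ s) (derive1 (derive1 chi))).
Proof.
move=> T0 al01 [w1 [w2 [C [dt1 dt2 Hb]]]] w0.
have /andP[a0 a1] := al01.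
pose C' := `|C|.
have C'0 : 0 <= C' by exact: normr_ge0.
have B : {ae mu, forall t, 0 < t <= T ->
   [/\ in_H a b 2 (w1^~ t), in_H a b 2 (w2^~ t),
     normH a b 2 (w1^~ t) <= C' * t `^ (al - 1) &
     normH a b 2 (w2^~ t) <= C' * t `^ (al - 2)]}.
  have := Hb 1%N isT; rewrite muln1 => Hb1; apply: (ae_mp Hb1) => t Ht tT.
  have [h1 h2 h3] := Ht tT; have /andP[t0 _] := tT.
  have n1 : 0 <= normH a b 2 (w1^~ t) by exact: sqrtr_ge0.
  have n2 : 0 <= normH a b 2 (w2^~ t) by exact: sqrtr_ge0.
  have h4 : t * normH a b 2 (w2^~ t) + normH a b 2 (w1^~ t) <= C' * t `^ (al - 1).
    by apply: (le_trans h3); rewrite ler_wpM2r ?powR_ge0// ler_norm.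
  have tn2 : 0 <= t * normH a b 2 (w2^~ t) by rewrite mulr_ge0// ltW.
  split => //; first by apply: le_trans h4; rewrite lerDr.
  rewrite -(ler_pM2l t0); apply: (@le_trans _ _ (C' * t `^ (al - 1))).
    by apply: le_trans h4; rewrite lerDl.
  rewrite mulrCA ler_wpM2l// (_ : al - 1 = (al - 2) + 1); last by ring.
  by rewrite (powRDp _ _ t0) powRr1 ?(ltW t0)// mulrC.
exists (C' * (al^-1 + 2)) => [|chi t1 t2].
  by rewrite mulr_ge0// addr_ge0// invr_ge0 ltW.
have [Lc Lc'] := test_L2 t1; have [_ Lc''] := test_L2 t2.
set M := C' * normL2 a b chi.
have M0 : 0 <= M by rewrite mulr_ge0// normL2_ge0.
have -> : C' * (al^-1 + 2) * normL2 a b chi = M * (al^-1 + 2) by rewrite /M; ring.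
have S (eta : R -> R) (K : R) : measurable_fun setT eta -> (forall x, `|eta x| <= K) ->
    L2 eta ->
    (forall v, in_H a b 2 v -> `|ip v eta| <= normH a b 2 v * normL2 a b chi) ->
    singular_at0 al T (M * (al^-1 + 2)) (fun s => ip (w^~ s) eta).
  move=> meta etaK Leta Heta.
  apply: (@ac_singular _ al T M _ (fun s => ip (w1^~ s) eta) (fun s => ip (w2^~ s) eta)) => //.
  - exact: w0.
  - move=> s t s0 st tT; apply: (dt_pair dt1 meta etaK) => //.
    + by rewrite in_itv/= s0 (le_trans st).
    + by rewrite in_itv/= tT (le_trans s0).
    + move=> th /andP[h1 h2]; rewrite in_itv/=; apply/andP; split; lra.
  - move=> s t s0 st tT; apply: (dt_pair dt2 meta etaK) => //.
    + by rewrite in_itv/= s0 (le_trans st).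
    + by rewrite in_itv/= tT (lt_le_trans s0).
    + move=> th /andP[h1 h2]; rewrite in_itv/=; apply/andP; split; lra.
  - apply: (ae_mp B) => t Ht tT; have [h1 h2 h3 h4] := Ht tT.
    split; [apply: (le_trans (Heta _ h1))|apply: (le_trans (Heta _ h2))].
      by rewrite /M mulrAC ler_wpM2r// normL2_ge0.
    by rewrite /M mulrAC ler_wpM2r// normL2_ge0.
have [c [d [K [_ _ _ [m1 k1 _] _]]]] := test_bdd t1.
have [c' [d' [K' [_ _ _ _ [m2 k2 _]]]]] := test_bdd t2.
split.
- apply: (S _ K) => // v /in_H2P[Lv _ _]; apply: (le_trans (cauchy_schwarz Lv Lc)).
  by rewrite ler_wpM2r ?normL2_ge0//; case: (normH2_le v).
- apply: (S _ K') => // v /in_H2P[Lv wd1 wd2].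
  rewrite -(wd_test2 wd1 wd2 t1 t2).
  apply: (le_trans (cauchy_schwarz (wd_L2 wd2) Lc)).
  by rewrite ler_wpM2r ?normL2_ge0//; case: (normH2_le v).
Qed.

End TimeDerivative.

(** * The Gamma function and the variable-exponent kernel *)

Section VariableExponentKernel.
Context {R : realType}.
Local Notation mu := (@lebesgue_measure R).

Lemma expR_mul_measurable (I : interval R) :
  mplane (fun z s : R => if s \in I then expR (z * ln s) else 0).
Proof.
have -> : (fun z s : R => if s \in I then expR (z * ln s) else 0) =
    (fun z s : R => if (z \in `]-oo, +oo[) && (s \in I) then expR (z * ln s) else 0).
  by apply/funext => z; apply/funext => s; rewrite in_itv.
apply: mplane_itv; apply: measurable_funTS.
have m1 : mplane (fun z _ : R => z) by apply: (@mplane_fst _ idfun); exact: measurable_id.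
have m2 := mplaneM m1 (mplane_snd (@measurable_ln R)).
exact: (measurableT_comp (@measurable_expR R) m2).
Qed.

Lemma Gamma_measurable : measurable_fun setT (@Gamma R).
Proof.
(* s^(z - 1) is split as exp (z ln s) exp (- ln s), which makes joint measurability in [(z, s)] a
   matter of products and compositions; [Gamma] is then a parametric integral. *)
pose F (z s : R) := (if s \in `]0, +oo[ then expR (z * ln s) else 0) *
   (expR (- ln s) * expR (- s)).
have mF : mplane F.
  apply: mplaneM; first exact: expR_mul_measurable.
  apply: mplane_snd; apply: measurable_funM; apply: measurableT_comp => //.
  by apply: measurableT_comp => //; exact: measurable_ln.
have -> : @Gamma R = fun z => Int (F z); last exact: mplane_Int.
apply/funext => z; rewrite /Gamma RintE; apply: eq_Int => s.
rewrite patch_itv /F; case: ifPn => [|_]; last by rewrite mul0r.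
rewrite in_itv/= andbT => s0; rewrite /powR gt_eqF// mulrA.
by congr (_ * _); rewrite -expRD mulrBl mul1r.
Qed.

(** On []0, 1]] the integrand is at least 1/e. If the integral diverges, [Gamma z] is 0 by
    convention and so is its inverse, which is why no lower bound on [z] appears. *)
Lemma Gamma_inv_le (z : R) : z <= 1 -> 0 <= (Gamma z)^-1 <= expR 1.
Proof.
move=> z1; rewrite invr_ge0 Gamma_ge0 /=.
pose f := (fun s : R => s `^ (z - 1) * expR (- s)) \_ `]0, +oo[.
have Ef : Gamma z = Int f by exact: RintE.
have [fi|nfi] := pselect (integ f); last first.
  rewrite (_ : Gamma z = 0) ?invr0 ?expR_ge0// Ef /Int /Rintegral.
  rewrite (_ : (\int[mu]_x (f x)%:E)%E = +oo%E)//.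
  apply/eqP; rewrite eq_le leey /= leNgt; apply/negP => lt; apply: nfi.
  have mf : measurable_fun setT f.
    apply: measurable_patch_itv; apply: measurable_funM; first exact: measurable_powR.
    exact: measurableT_comp.
  apply/integrableP; split; first exact/measurable_EFinP.
  move: lt; congr (_ < _)%E; apply: eq_integral => x _.
  rewrite /= ger0_norm// /f patch_itv; case: ifP => // _.
  by rewrite mulr_ge0 ?powR_ge0 ?expR_ge0.
rewrite -[leRHS]invrK -expRN lef_pV2 ?posrE ?expR_gt0//; last first.
  rewrite Ef; apply: (@lt_le_trans _ _ (Int ((fun=> expR (-1)) \_ `]0, 1]))).
    by rewrite Int_cst_oc ?ler01// subr0 mulr1 expR_gt0.
  apply: (Int_le (integ_cst_itv _ _ _ _ _) fi).
  move=> s; rewrite /f !patch_itv !in_itv/= andbT.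
  case: (ltP 0 s) => //= s0; case: ifPn => [s1|_]; last first.
    by rewrite mulr_ge0 ?powR_ge0 ?expR_ge0.
  rewrite -[leLHS]mul1r ler_pM ?expR_ge0 ?ler_expR ?lerN2//.
  by rewrite -[leLHS](powRr0 s); apply: ger_powR; [rewrite s0|rewrite subr_le0].
rewrite Ef -[leLHS]mulr1 -[X in _ * X](subr0 1) -(Int_cst_oc _ (@ler01 R)).
apply: (Int_le (integ_cst_itv _ _ _ _ _) fi).
move=> s; rewrite /f !patch_itv !in_itv/= andbT.
case: (ltP 0 s) => //= s0; case: ifPn => [s1|_]; last first.
  by rewrite mulr_ge0 ?powR_ge0 ?expR_ge0.
rewrite -[leLHS]mul1r ler_pM ?expR_ge0 ?ler_expR ?lerN2//.
by rewrite -[leLHS](powRr0 s); apply: ger_powR; [rewrite s0|rewrite subr_le0].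
Qed.

(** For s <= 1 the power s^(- alpha s) is at most s^(- alphastar). For s > 1 it is at most 1, hence
    at most T^alphastar s^(- alphastar). The factor e bounds the inverse of [Gamma]. *)
Lemma vker_bound (T alphastar : R) (alpha : R -> R) : 0 < T ->
  {within `[0, T], continuous alpha} ->
  (forall t, 0 <= t <= T -> 0 < alpha t <= alphastar) -> alphastar < 1 ->
  measurable_fun setT (vker alpha \_ `]0, T]) /\
  exists2 C, 0 <= C & forall s, 0 < s <= T ->
    0 <= vker alpha s <= C * s `^ ((1 - alphastar) - 1).
Proof.
move=> T0 ca ha as1.
have aT := ha T (ltac:(by rewrite lexx (ltW T0))).
have as0 : 0 <= alphastar by case/andP: aT => h1 h2; rewrite ltW// (lt_le_trans h1).
pose A := alpha \_ `[0, T].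
have mA : measurable_fun setT A.
  apply: (measurable_restrictT alpha (measurable_itv `[0, T])).1.
  by apply: subspace_continuous_measurable_fun => //; exact: measurable_itv.
have AE s : 0 < s <= T -> A s = alpha s.
  by move=> /andP[s0 sT]; rewrite /A patch_itv in_itv/= (ltW s0) sT.
split.
  have -> : vker alpha \_ `]0, T] =
      (fun t => expR (- A t * ln t) / Gamma (1 - A t)) \_ `]0, T].
    apply/funext => t; rewrite !patch_itv in_itv/=; case: ifP => tT; last by [].
    by rewrite AE// /vker /powR gt_eqF//; case/andP: tT.
  apply: measurable_patch_itv; apply: measurable_funM.
    apply: measurableT_comp => //; apply: measurable_funM; last exact: measurable_ln.
    exact: measurableT_comp.
  have mG : measurable_fun setT (fun t : R => Gamma (1 - A t)).
    by apply: (measurableT_comp Gamma_measurable); exact: measurable_funB.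
  have -> : (fun t => (Gamma (1 - A t))^-1) = (fun t => Gamma (1 - A t) `^ (-1)).
    by apply/funext => t; rewrite powR_inv1// Gamma_ge0.
  apply: (@measurableT_comp _ _ _ _ _ _ (fun x : R => x `^ (-1)) setT (fun t => Gamma (1 - A t))) => //.
exists ((1 + T `^ alphastar) * expR 1) => [|s sT].
  by rewrite mulr_ge0 ?expR_ge0// addr_ge0// powR_ge0.
have /andP[s0 sT'] := sT.
have /andP[al0 alS] := ha s (ltac:(by rewrite (ltW s0) sT')).
have /andP[g0 g1] := @Gamma_inv_le (1 - alpha s) (ltac:(by lra)).
rewrite /vker mulr_ge0 ?powR_ge0//= mulrAC ler_pM ?powR_ge0//.
have P0 : 0 <= s `^ (1 - alphastar - 1) by exact: powR_ge0.
rewrite mulrDl mul1r; have [s1|s1] := leP s 1.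
  rewrite -[leLHS]addr0 lerD ?mulr_ge0 ?powR_ge0// ger_powR ?s0//; lra.
rewrite -[leLHS]add0r lerD//.
apply: (@le_trans _ _ 1).
  by rewrite -[leRHS](powRr0 s); apply: ler_powR; [exact: ltW|lra].
apply: (@le_trans _ _ (s `^ alphastar * s `^ (1 - alphastar - 1))).
  by rewrite -powRDp// (_ : _ + _ = 0) ?powRr0//; ring.
by rewrite ler_wpM2r// ge0_ler_powR ?nnegrE ?(ltW s0) ?(ltW T0).
Qed.

End VariableExponentKernel.

(** * Associativity of the convolution with the two kernels *)

Section KernelConvolution.
Context {R : realType} (T al as_ Cb Ck Cq : R) (bT kT : R -> R).
Local Notation mu := (@lebesgue_measure R).
Hypotheses (T0 : 0 < T) (al01 : 0 < al < 1) (as01 : 0 <= as_ < 1).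
Hypotheses (mb : measurable_fun setT bT) (mk : measurable_fun setT kT)
  (b_ge0 : forall s, 0 <= bT s) (k_ge0 : forall s, 0 <= kT s)
  (b_le : forall s, 0 < s -> bT s <= Cb * s `^ (al - 1))
  (k_le : forall s, 0 < s -> kT s <= Ck * s `^ ((1 - as_) - 1))
  (b_0 : forall s, s <= 0 -> bT s = 0) (k_0 : forall s, s <= 0 -> kT s = 0)
  (k_i : integ kT).

Definition kconv (t : R) : R := Int (fun s => bT (t - s) * kT s).

Hypothesis Q_le : forall t, 0 < t <= T -> kconv t <= Cq.

Lemma kconv_integ t : integ (fun s => bT (t - s) * kT s).
Proof.
have mf : measurable_fun setT (fun s : R => bT (t - s) * kT s).
  apply: measurable_funM => //; apply: (measurableT_comp mb); exact: measurable_funB.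
have [t0|t0] := leP t 0.
  rewrite (_ : (fun s => bT (t - s) * kT s) = (fun=> 0)); first exact: integ0.
  apply/funext => s; have [s0|s0] := leP s 0; first by rewrite k_0// mulr0.
  by rewrite b_0 ?mul0r//; lra.
have /andP[a0 a1] := al01; have /andP[s0_ s1_] := as01.
have p1 : 0 < al <= 1 by rewrite a0 ltW.
have p2 : 0 < 1 - as_ <= 1 by apply/andP; split; lra.
have [ci _] := conv_pow p1 p2 t0.
apply: (integ_le mf (integZ (Cb * Ck) ci)) => s.
rewrite patch_itv in_itv/= ger0_norm ?mulr_ge0//.
case: ifPn => [/andP[s0 st]|].
  have h1 := b_le (ltac:(by rewrite subr_gt0) : 0 < t - s); have h2 := k_le s0.
  apply: (le_trans (ler_pM (b_ge0 _) (k_ge0 _) h1 h2)).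
  by rewrite mulrACA.
rewrite negb_and -!leNgt => /orP[s0|ts]; first by rewrite k_0// !mulr0.
by rewrite b_0 ?mul0r ?mulr0//; lra.
Qed.

Lemma kconv_ge0 t : 0 <= kconv t.
Proof. by apply: Int_ge0 => s; rewrite mulr_ge0. Qed.

Lemma kconv_0 t : t <= 0 -> kconv t = 0.
Proof.
move=> t0; rewrite -[RHS]Int0; apply: eq_Int => s.
have [s0|s0] := leP s 0; first by rewrite k_0// mulr0.
by rewrite b_0 ?mul0r//; lra.
Qed.

Lemma conv_ae_integ P : integ P -> {ae mu, forall s, integ (fun th => kT (s - th) * P th)}.
Proof.
move=> Pi; have mP := integ_measurable Pi.
have mF : mplane (fun s th => kT (s - th) * P th).
  by apply: mplaneM; [exact: mplane_sub|exact: mplane_snd].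
have [] := Int_fubini mF (integZ (Int kT) (integ_abs Pi)); last by [].
apply: aeW => th.
have [i e] := Int_shift (- th) k_i.
have i' : integ (fun s => kT (s - th) * P th).
  by have := integZ (P th) i; congr integ; apply/funext => s; rewrite mulrC.
split => //; rewrite -e mulrC -(IntZ _ i); apply: Int_le.
- exact: integ_abs.
- exact: integZ.
- by move=> s; rewrite normrM (ger0_norm (k_ge0 _)) mulrC.
Qed.

(** Fubini after a shift by [th]. The inner integral of the absolute value is [kconv (t - th)] times
    [|P th|]; as [P] vanishes for [th <= 0], only arguments up to [T] matter, where [Cq] bounds
    [kconv]. The bound on q thus supplies the dominating function. *)
Lemma conv_assoc t P : t <= T -> integ P -> (forall th, th <= 0 -> P th = 0) ->
  integ (fun s => bT (t - s) * Int (fun th => kT (s - th) * P th)) /\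
  Int (fun s => bT (t - s) * Int (fun th => kT (s - th) * P th)) =
  Int (fun th => kconv (t - th) * P th).
Proof.
move=> tT Pi P0; have mP := integ_measurable Pi.
pose F s th := bT (t - s) * (kT (s - th) * P th).
have mF : mplane F.
  apply: mplaneM.
    apply: mplane_fst; apply: (measurableT_comp mb); exact: measurable_funB.
  by apply: mplaneM; [exact: mplane_sub|exact: mplane_snd].
have FE th : integ (fun s => bT (t - s) * kT (s - th)) /\
    Int (fun s => bT (t - s) * kT (s - th)) = kconv (t - th).
  have [i e] := Int_shift (- th) (kconv_integ (t - th)).
  have E : (fun x => bT (t - th - (x - th)) * kT (x - th)) =
      (fun s => bT (t - s) * kT (s - th)).
    by apply/funext => s; congr (bT _ * _); ring.
  by move: i e; rewrite E.
have Fi th : integ (F^~ th) /\ Int (F^~ th) = kconv (t - th) * P th.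
  have [i e] := FE th.
  have E : F^~ th = fun s => P th * (bT (t - s) * kT (s - th)).
    by apply/funext => s; rewrite /F; ring.
  by rewrite E IntZ// e mulrC; split => //; exact: integZ.
have H : {ae mu, forall th, integ (F^~ th) /\ Int (fun s => `|F s th|) <= Cq * `|P th|}.
  apply: aeW => th; split; first by case: (Fi th).
  have [i e] := FE th.
  rewrite (@eq_Int _ _ (fun s => `|P th| * (bT (t - s) * kT (s - th)))); last first.
    by move=> s; rewrite /F !normrM (ger0_norm (b_ge0 _)) (ger0_norm (k_ge0 _)); ring.
  rewrite IntZ// e mulrC.
  have [th0|th0] := leP th 0; first by rewrite P0// normr0 !mulr0.
  rewrite ler_wpM2r//; have [tth|tth] := leP (t - th) 0.
    by rewrite kconv_0// (le_trans (kconv_ge0 T))// Q_le// T0 lexx.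
  by rewrite Q_le// tth /=; lra.
have [fub ai i1 i2] := Int_fubini mF (integZ Cq (integ_abs Pi)) H.
have kae := conv_ae_integ Pi.
have E : {ae mu, forall s, Int (F s) = bT (t - s) * Int (fun th => kT (s - th) * P th)}.
  by apply: (ae_mp kae) => s ik; rewrite /F IntZ.
have mI : measurable_fun setT (fun s : R => bT (t - s) * Int (fun th => kT (s - th) * P th)).
  apply: measurable_funM.
    by apply: (measurableT_comp mb); exact: measurable_funB.
  apply: mplane_Int; by apply: mplaneM; [exact: mplane_sub|exact: mplane_snd].
split; first exact: integ_ae i1 mI E.
rewrite -(Int_ae (integ_measurable i1) mI E) fub.
by apply: eq_Int => th; case: (Fi th).
Qed.

End KernelConvolution.

(** * The fundamental theorem of calculus for a bounded derivative *)

Section BoundedDerivative.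
Context {R : realType} (T Cq : R) (q dq : R -> R).
Local Notation mu := (@lebesgue_measure R).
Hypotheses (T0 : 0 < T)
  (hdq : forall t, 0 <= t <= T -> deriv_on `[0, T] q t (dq t))
  (hC : forall t, 0 <= t <= T -> `|dq t| <= Cq).

Let deriv_seq (t : R) (u : nat -> R) : 0 <= t <= T -> u @ \oo --> 0 -> (forall n, u n != 0) ->
  (forall n, 0 <= t + u n <= T) ->
  (fun n => (q (t + u n) - q t) / u n) @ \oo --> dq t.
Proof.
move=> tT ucv u0 uT; have := hdq tT; rewrite /deriv_on => H.
have tu_ n : t + u n - t = u n by ring.
have cv : (fun n => t + u n) @ \oo --> within `[0, T] t^'.
  move=> A; rewrite /within /= nbhs_simpl /=.
  move=> hA; have tu : (fun n => t + u n) @ \oo --> t.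
    rewrite -[X in _ --> X]addr0; apply: cvgD; [exact: cvg_cst|exact: ucv].
  have hn : \forall n \near \oo, t + u n != t -> t + u n \in `[0, T] -> A (t + u n).
    exact: (tu _ hA).
  apply: (filterS _ hn) => n h.
  have ne : t + u n != t by rewrite -subr_eq0 tu_ u0.
  by apply: h => //; rewrite in_itv /= uT.
have := cvg_comp _ _ cv H; apply: cvg_trans; apply: near_eq_cvg.
by apply: nearW => n /=; rewrite tu_.
Qed.

Let near_small (u : nat -> R) (e : R) : u @ \oo --> 0 -> 0 < e ->
  exists N, forall n, (N <= n)%N -> `|u n| < e.
Proof.
move=> ucv e0; move/cvgrPdist_lt : ucv => /(_ e e0) [N _ hN]; exists N => n Nn.
by have := hN n Nn; rewrite /= sub0r normrN.
Qed.

(** Constant continuation outside [[0, T]]: difference quotients exist on the whole line and keep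
    the Lipschitz constant. *)
Let qc (t : R) : R := q (Num.max 0 (Num.min t T)).

Let qcE t : 0 <= t <= T -> qc t = q t.
Proof. by move=> /andP[t0 tT]; rewrite /qc min_l// max_r. Qed.

Let interior_deriv (t : R) : 0 < t < T -> is_derive t 1 q (dq t).
Proof.
move=> /andP[t0 tT].
have cv : (fun h => h^-1 *: (q (h + t) - q t)) @ 0^' --> dq t.
  apply/cvgr_dnbhsP => u [u0 ucv].
  pose e := Num.min t (T - t).
  have e0 : 0 < e by rewrite /e lt_min t0 subr_gt0.
  have [N hN] := near_small ucv e0.
  have cvS : (fun n => (q (t + u (n + N)%N) - q t) / u (n + N)%N) @ \oo --> dq t.
    apply: (@deriv_seq t (fun n => u (n + N)%N)) => //.
    - by apply/andP; split; exact: ltW.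
    - by rewrite cvg_shiftn.
    - move=> n; have := hN (n + N)%N (leq_addl _ _).
      rewrite /= /e lt_min !ltr_norml => /andP[/andP[h1 h2] /andP[h3 h4]].
      by apply/andP; split; lra.
  rewrite -(cvg_shiftn N); move: cvS; apply: cvg_trans; apply: near_eq_cvg; apply: nearW => n.
  by rewrite /= /GRing.scale/= mulrC (addrC t).
apply: DeriveDef.
  apply/cvg_ex; exists (dq t); move: cv; apply: cvg_trans; apply: near_eq_cvg.
  by apply: nearW => h /=; rewrite /GRing.scale/= mulr1.
by rewrite -derive1E; apply/cvg_lim.
Qed.

Let q_lim_right : q x @[x --> 0^'+] --> q 0.
Proof.
apply/cvg_at_rightP => u [u0 ucv].
have [N hN] := near_small ucv T0.
have uS : (fun n => u (n + N)%N) @ \oo --> (0:R) by rewrite cvg_shiftn.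
have T00 : (0 : R) <= 0 <= T by apply/andP; split; [exact: lexx|exact: ltW].
have d := @deriv_seq 0 (fun n => u (n + N)%N) T00 uS.
have {}d : (fun n => (q (0 + u (n + N)%N) - q 0) / u (n + N)%N) @ \oo --> dq 0.
  apply: d => [n|n]; first by rewrite gt_eqF.
  have := hN (n + N)%N (leq_addl _ _); rewrite add0r /= ltr_norml => /andP[_ h].
  by apply/andP; split; exact: ltW.
have : (fun n => q 0 + (q (0 + u (n + N)%N) - q 0) / u (n + N)%N * u (n + N)%N) @ \oo -->
    q 0 + dq 0 * 0.
  by apply: cvgD; [exact: cvg_cst|exact: cvgM].
rewrite mulr0 addr0 => h; rewrite -(cvg_shiftn N); move: h; apply: cvg_trans;
apply: near_eq_cvg; apply: nearW => n; rewrite mulfVK ?gt_eqF// add0r.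
by rewrite addrC subrK.
Qed.

Let q_lim_left : q x @[x --> T^'-] --> q T.
Proof.
apply/cvg_at_leftP => u [u0 ucv].
have vcv : (fun n => u n - T) @ \oo --> 0.
  by rewrite -(subrr T); apply: cvgB; [exact: ucv|exact: cvg_cst].
have [N hN] := near_small vcv T0.
have uS : (fun n => u (n + N)%N - T) @ \oo --> 0.
  by rewrite (cvg_shiftn N (fun n => u n - T)).
have TT : (0 : R) <= T <= T by apply/andP; split; [exact: ltW|exact: lexx].
have d := @deriv_seq T (fun n => u (n + N)%N - T) TT uS.
have {}d : (fun n => (q (T + (u (n + N)%N - T)) - q T) / (u (n + N)%N - T)) @ \oo --> dq T.
  apply: d => [n|n]; first by rewrite lt_eqF// subr_lt0.
  have := hN (n + N)%N (leq_addl _ _); rewrite /= ltr_norml => /andP[h1 h2].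
  by have := u0 (n + N)%N => h3; apply/andP; split; lra.
have : (fun n => q T + (q (T + (u (n + N)%N - T)) - q T) / (u (n + N)%N - T) *
     (u (n + N)%N - T)) @ \oo --> q T + dq T * 0.
  by apply: cvgD; [exact: cvg_cst|exact: cvgM].
rewrite mulr0 addr0 => h; rewrite -(cvg_shiftn N); move: h; apply: cvg_trans;
apply: near_eq_cvg; apply: nearW => n; rewrite mulfVK; last by rewrite lt_eqF// subr_lt0.
by rewrite [T + _]addrC subrK addrC subrK.
Qed.

Lemma q_lipschitz s t : 0 <= s -> s <= t -> t <= T -> `|q t - q s| <= Cq * (t - s).
Proof.
move=> s0 st tT.
have cq : {within `[0, T], continuous q}.
  apply/(continuous_within_itvP _ T0); split.
  - move=> x; rewrite in_itv/= => hx; apply: differentiable_continuous.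
    by apply/derivable1_diffP; case: (interior_deriv hx).
  - exact: q_lim_right.
  - exact: q_lim_left.
have [||c] := @MVT_segment R q dq s t st.
- by move=> x; rewrite in_itv/= => /andP[h1 h2]; apply: interior_deriv; apply/andP; split; lra.
- apply: continuous_subspaceW cq => x /=; rewrite !in_itv/= => /andP[h1 h2].
  by apply/andP; split; lra.
rewrite in_itv/= => /andP[sc ct] ->; rewrite normrM (@ger0_norm _ (t - s)) ?subr_ge0//.
by rewrite ler_wpM2r ?subr_ge0// hC// (le_trans s0)//= (le_trans ct).
Qed.

Let Cq0 : 0 <= Cq.
Proof. by apply: (le_trans _ (hC (ltac:(by rewrite lexx (ltW T0)) : 0 <= (0 : R) <= T))). Qed.

Let qc_lip s t : `|qc t - qc s| <= Cq * `|t - s|.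
Proof.
have H u v : u <= v -> `|qc v - qc u| <= Cq * (v - u).
  move=> uv; pose c (x : R) := Num.max 0 (Num.min x T).
  have c0 x : 0 <= c x by rewrite /c le_max lexx.
  have cT x : c x <= T by rewrite /c ge_max ge_min lexx orbT andbT ltW.
  have [cuv clip] : c u <= c v /\ c v - c u <= v - u.
    rewrite /c; case: (leP u T) => h1; case: (leP v T) => h2;
      case: (leP 0 u) => h3; case: (leP 0 v) => h4; case: (leP 0 T) => h5;
      split; lra.
  apply: (le_trans (q_lipschitz (c0 u) cuv (cT v))).
  by rewrite ler_wpM2l.
have [st|/ltW ts] := leP s t; first by rewrite (ger0_norm (x := t - s)) ?subr_ge0// H.
by rewrite distrC (distrC t) (ger0_norm (x := s - t)) ?subr_ge0// H.
Qed.

(** [dq] need not be continuous. It is the limit of difference quotients bounded by [Cq], so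
    dominated convergence applies; their integrals are differences of Steklov averages at [t] and at
    0, which converge because q is continuous. *)
Lemma dq_integral : integ (dq \_ `]0, T]) /\
  forall t, 0 <= t <= T -> Int (dq \_ `]0, t]) = q t - q 0.
Proof.
(* The cut makes [qc] integrable. The margin 1 covers the points [t + u n], since [u n <= 1], and
   leaves [f] continuous at 0 and at [T]. *)
pose f := qc \_ `[- 1, T + 1].
have cqc := lip_continuous qc_lip.
have fi : integ f.
  apply/(integ_restrict _ (measurable_itv _)).
  apply: continuous_compact_integrable; first exact: segment_compact.
  exact: continuous_subspaceT.
have fE x : - 1 <= x <= T + 1 -> f x = qc x by move=> h; rewrite /f patch_itv in_itv/= h.
have cf (x : R) : -1 < x -> x < T + 1 -> {for x, continuous f}.
  move=> h1 h2; change (f @ x --> f x).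
  have -> : f x = qc x by apply: fE; rewrite (ltW h1) (ltW h2).
  have := cqc x; apply: cvg_trans; apply: near_eq_cvg; near=> y.
  rewrite fE//; apply/andP; split; apply: ltW; near: y; [exact: lt_nbhsr|exact: lt_nbhsl].
pose u n : R := 1 / n.+1%:R.
have u0 n : 0 < u n by rewrite divr_gt0.
have u1 n : u n <= 1 by rewrite ler_pdivrMr// mul1r ler1n.
have ucv : u @ \oo --> 0 by exact: cvg_divn.
pose D n t := (u n)^-1 * (qc (t + u n) - qc t).
have mD n : measurable_fun setT (D n).
  apply: measurable_funM => //; apply: measurable_funB; apply: continuous_measurable_fun => //.
  exact: continuous_shift.
have DC n t : `|D n t| <= Cq.
  rewrite /D normrM gtr0_norm ?invr_gt0// mulrC ler_pdivrMr//.
  by apply: (le_trans (qc_lip _ _)); rewrite (addrC t) addrK gtr0_norm.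
have Dcv t : 0 < t -> t < T -> (fun n => D n t) @ \oo --> dq t.
  move=> t0 tT; have tI : 0 < t < T by rewrite t0.
  have d : is_derive t 1 qc (dq t).
    apply: near_eq_is_derive (interior_deriv tI); near=> y.
    rewrite qcE//; apply/andP; split; apply: ltW; near: y; [exact: lt_nbhsr|exact: lt_nbhsl].
  by apply: (derive1_seq d) => // n; rewrite gt_eqF.
have K t : 0 <= t <= T -> integ (dq \_ `]0, t]) /\
    (fun n => Int (D n \_ `]0, t])) @ \oo --> Int (dq \_ `]0, t]).
  move=> /andP[t0 tT].
  have md : measurable_fun setT (dq \_ `]0, t]).
    have mo : measurable_fun setT (dq \_ `]0, t[).
      apply: (measurable_restrictT dq (measurable_itv `]0, t[)).1.
      apply: (@measurable_fun_cvg _ _ _ _ D).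
        by move=> n; apply: measurable_funTS.
      by move=> x /=; rewrite in_itv/= => /andP[x0 xt]; apply: Dcv => //; exact: lt_le_trans tT.
    by have [] := @Int_bnd_eq R false true false false 0 t dq mo.
  apply: (@integ_dct _ _ _ ((fun=> Cq) \_ `]0, t])) => //.
  - by move=> n; exact: measurable_patch_itv.
  - exact: integ_cst_itv.
  - by apply: aeW => x n; rewrite !patch_itv; case: ifP => _; rewrite ?normr0.
  - apply: (ae_mp (ae_neq t)) => x xt; under eq_fun do rewrite patch_itv; rewrite patch_itv.
    rewrite in_itv/=; case: ifPn => [/andP[x0 xt']|_]; last exact: cvg_cst.
    by apply: Dcv => //; apply: lt_le_trans tT; rewrite lt_neqAle xt.
split; first by case: (K T (ltac:(by rewrite lexx ltW))).
move=> t tT; have [_ cv] := K t tT; have /andP[t0 tT'] := tT.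
have E n : Int (D n \_ `]0, t]) = stek (u n) f t - stek (u n) f 0.
  have [si se] := Int_shift (u n) fi.
  have i1 : integ (fun x => f (x + u n) - f x) by exact: integB.
  have -> : Int (D n \_ `]0, t]) = (u n)^-1 * Int ((fun x => f (x + u n) - f x) \_ `]0, t]).
    rewrite -IntZ; last exact: integ_itv.
    apply: eq_Int => x; rewrite !patch_itv in_itv/=; case: ifPn => [/andP[x0 xt]|_]; last by rewrite mulr0.
    have := u1 n; have := u0 n => h1 h2.
    by rewrite /D !fE//; apply/andP; split; lra.
  rewrite /stek -mulrBr; congr (_ * _).
  have p1 := prim_sub fi t0.
  have p2 := @prim_sub R f (0 + u n) (t + u n) fi (ltac:(by rewrite lerD2r)).
  have [_ e3] := Int_shift (u n) (integ_itv `]0 + u n, t + u n] fi).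
  have -> : Int ((fun x => f (x + u n) - f x) \_ `]0, t]) =
      Int (f \_ `]0 + u n, t + u n]) - Int (f \_ `]0, t]).
    rewrite -e3 -IntB; [|by case: (Int_shift (u n) (integ_itv `]0 + u n, t + u n] fi))|exact: integ_itv].
    apply: eq_Int => x; rewrite !patch_itv !in_itv/= ltrD2r lerD2r.
    by case: ifP => _; rewrite ?subrr.
  by rewrite -p1 -p2; ring.
have cv1 : (fun n => stek (u n) f t - stek (u n) f 0) @ \oo --> f t - f 0.
  apply: cvgB; apply: derive1_seq => //; try (by move=> n; rewrite gt_eqF);
    apply: prim_is_derive => //; apply: cf; lra.
have cv2 : (fun n => Int (D n \_ `]0, t])) @ \oo --> f t - f 0.
  by move: cv1; apply: cvg_trans; apply: near_eq_cvg; apply: nearW => n; rewrite E.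
have e1 : f t = q t by rewrite fE ?qcE//; apply/andP; split; lra.
have e2 : f 0 = q 0 by rewrite fE ?qcE//; apply/andP; split; lra.
rewrite -e1 -e2; exact: (cvg_unique (@Rhausdorff R) cv cv2).
Unshelve. all: by end_near. Qed.

End BoundedDerivative.

Section DerivativeConvolution.
Context {R : realType} (T Cq : R) (dq Q P y : R -> R).
Local Notation mu := (@lebesgue_measure R).
Hypotheses (T0 : 0 < T) (di : integ (dq \_ `]0, T]))
  (hC : forall t, 0 <= t <= T -> `|dq t| <= Cq)
  (QE : forall t, 0 < t <= T -> Q t = 1 + Int (dq \_ `]0, t]))
  (Q0 : forall t, t <= 0 -> Q t = 0)
  (Pi : integ P) (P0 : forall th, th <= 0 -> P th = 0)
  (yE : forall s, 0 < s <= T -> y s = Int (P \_ `]0, s[)).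

(* [Q * y' = (1 + 1 * dq) * y' = y + dq * y], with [P] the derivative of [y]. *)
Lemma convol_derivative t : 0 < t <= T ->
  Int (fun th => Q (t - th) * P th) = y t + convol dq y t.
Proof.
move=> /andP[t0 tT]; have mP := integ_measurable Pi.
set d := dq \_ `]0, T]; have md : measurable_fun setT d by exact: integ_measurable di.
have dC s : `|d s| <= Cq.
  rewrite /d patch_itv in_itv/=; case: ifPn => [/andP[s0 sT]|_].
    by apply: hC; rewrite sT ltW.
  by rewrite normr0; apply: (le_trans _ (hC (ltac:(by rewrite lexx (ltW T0)) : 0 <= (0 : R) <= T))).
(* The indicator of [th < s] turns the primitive [y s] into an integral over the whole line, so that
   Fubini can exchange [s] and [th]. *)
pose I (s th : R) : R := if s <= th then 0 else 1.
have mI : mplane I.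
  apply: (measurable_fun_ifT (f := fun z : measurableTypeR R * measurableTypeR R =>
      z.1 <= z.2)) => //.
  exact: measurable_fun_ler.
pose F s th := d (t - s) * (I s th * P th).
have mF : mplane F.
  apply: mplaneM.
    by apply: mplane_fst; apply: (measurableT_comp md); exact: measurable_funB.
  by apply: mplaneM => //; exact: mplane_snd.
have [dri dre] := Int_refl t di.
have Fle s th : `|F s th| <= `|P th| * `|d (t - s)|.
  rewrite /F !normrM mulrC ler_wpM2r// /I; case: ifP => _.
    by rewrite normr0 mul0r.
  by rewrite normr1 mul1r.
have Fi th : integ (F^~ th).
  apply: (integ_le (mplane2 th mF) (integZ `|P th| (integ_abs dri))) => s; exact: Fle.
pose K := Int (fun s => `|d (t - s)|).
have Fb th : Int (fun s => `|F s th|) <= K * `|P th|.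
  rewrite mulrC -(IntZ _ (integ_abs dri)).
  by apply: Int_le (integ_abs (Fi th)) (integZ _ (integ_abs dri)) _ => s; exact: Fle.
have [fub ai i1 i2] := Int_fubini mF (integZ K (integ_abs Pi))
  (aeW mu (fun th => conj (Fi th) (Fb th))).
have d0 s : s <= 0 -> d s = 0 by move=> h; rewrite /d patch_itv in_itv/= ltNge h.
have conv : convol dq y t = Int (fun s => Int (F s)).
  rewrite (convolE dq y tT); apply: eq_Int => s; rewrite -/d.
  rewrite /F IntZ; last first.
    apply: (integ_mulb (K := 1) Pi); first exact: mplane1.
    by move=> th; rewrite /I; case: ifP; rewrite ?normr0 ?normr1.
  rewrite [X in _ * X]patch_itv in_itv/=; case: ifPn => [sT|].
    rewrite (yE sT); congr (_ * _); apply: eq_Int => th; rewrite patch_itv in_itv/= /I.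
    have [th0|th0] := leP th 0; first by rewrite (P0 th0) mulr0.
    by case: leP => _; rewrite ?mul0r ?mul1r.
  rewrite negb_and -leNgt -ltNge => /orP[s0|Ts]; last first.
    have ts : t - s <= 0 by rewrite subr_le0 (le_trans tT (ltW Ts)).
    by rewrite (d0 _ ts) !mul0r.
  rewrite mulr0 (@eq_Int _ _ (fun=> 0)); first by rewrite Int0 mulr0.
  move=> th; rewrite /I.
  have [th0|th0] := leP th 0; first by rewrite (P0 th0) mulr0.
  by rewrite (le_trans s0 (ltW th0)) mul0r.
have FI th : 0 < th -> th < t -> Int (F^~ th) = Int (dq \_ `]0, t - th]) * P th.
  move=> h0 ht; have ci := integ_itv `]0, t - th[ di.
  have [ri re] := Int_refl t ci.
  have tth : t - th <= T by apply: le_trans tT; rewrite gerBl; exact: ltW.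
  have pE : dq \_ `]0, t - th[ = d \_ `]0, t - th[.
    apply/funext => s; rewrite /d !patch_itv !in_itv/=.
    case: ifP => [/andP[s0 st]|_]; last by [].
    by rewrite s0 (le_trans (ltW st) tth).
  have mdt : measurable_fun setT (dq \_ `]0, t - th[).
    by rewrite pE; exact: integ_measurable ci.
  have [_ <-] := @Int_bnd_eq R false true false false 0 (t - th) dq mdt.
  rewrite pE -re mulrC -(IntZ _ ri); apply: eq_Int => s.
  rewrite /F /I patch_itv in_itv/= ltrD2l ltrN2.
  have [sth|sth] := leP s th; first by rewrite andbF !mulr0 mul0r mulr0.
  rewrite andbT mul1r mulrC; congr (_ * _).
  by case: (ltP 0 (t - s)) => h; [|rewrite (d0 _ h)].
have FI0 th : t <= th -> Int (F^~ th) = 0.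
  move=> ht; rewrite -[RHS]Int0; apply: eq_Int => s; rewrite /F /I.
  have [_|sth] := leP s th; first by rewrite mul0r mulr0.
  have h : t - s <= 0 by rewrite subr_le0 (le_trans ht (ltW sth)).
  by rewrite (d0 _ h) mul0r.
have tT_ : 0 < t <= T by rewrite t0.
have Pti := integ_itv `]0, t[ Pi.
rewrite conv fub (yE tT_) -(IntD Pti i2); apply: eq_Int => th.
rewrite patch_itv in_itv/=.
have [th0|th0] := leP th 0.
  rewrite (P0 th0) mulr0 /= add0r -[LHS]Int0; apply: eq_Int => s.
  by rewrite /F (P0 th0) !mulr0.
have [tht|tht] := ltP th t.
  have h : 0 < t - th <= T.
    by rewrite subr_gt0 tht /=; apply: le_trans tT; rewrite gerBl; exact: ltW.
  by rewrite (FI _ th0 tht) (QE h) mulrDl mul1r.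
have h : t - th <= 0 by rewrite subr_le0.
by rewrite (FI0 _ tht) (Q0 h) mul0r addr0.
Qed.

End DerivativeConvolution.

Section NonIntegrable.
Context {R : realType}.
Local Notation mu := (@lebesgue_measure R).

(* The integral of a non-integrable function is [fine] of an infinity, hence 0. *)
Lemma Int_not_integ (f : R -> R) : measurable_fun setT f -> ~ integ f -> Int f = 0.
Proof.
move=> mf nf; rewrite /Int /Rintegral integralE.
set p := (X in fine (X - _)%E); set n := (X in fine (_ - X)%E).
have p0 : (0 <= p)%E by apply: integral_ge0 => x _; exact: funepos_ge0.
have n0 : (0 <= n)%E by apply: integral_ge0 => x _; exact: funeneg_ge0.
have mE : measurable_fun setT (EFin \o f) by exact/measurable_EFinP.
have : (p + n = +oo)%E.
  have -> : (p + n = \int[mu]_x `|(f x)%:E|)%E.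
    rewrite /p /n -ge0_integralD//; last 2 first.
    - exact: measurable_funepos.
    - exact: measurable_funeneg.
    by apply: eq_integral => x _; rewrite -/((abse \o (EFin \o f)) x) fune_abse.
  apply/eqP; rewrite eq_le leey /= leNgt; apply/negP => lt; apply: nf.
  by apply/integrableP; split.
move: p0 n0; move: p n => [p||] [n||] //= _ _ //.
Qed.

(** For [k] nonzero both sides diverge together and are then both 0. This allows factors to be moved
    at every point, exceptional slices included. *)
Lemma IntZ_measurable (k : R) (f : R -> R) : measurable_fun setT f ->
  Int (fun x => k * f x) = k * Int f.
Proof.
move=> mf; have [fi|nf] := pselect (integ f); first exact: IntZ.
have [->|k0] := eqVneq k 0.
  by rewrite mul0r -[RHS]Int0; apply: eq_Int => x; rewrite mul0r.
rewrite (Int_not_integ mf nf) mulr0; apply: Int_not_integ.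
  exact: measurable_funM.
move=> /(integZ k^-1) fi; apply: nf; move: fi; congr integ.
by apply/funext => x; rewrite mulKf.
Qed.

End NonIntegrable.

Section SpaceTimeConvolution.
Context {R : realType} (w : R -> R -> R) (Nw : R -> R).
Local Notation mu := (@lebesgue_measure R).
Hypotheses (mw : mplane w)
  (wN : {ae mu, forall th, integ (w^~ th) /\ Int (fun x => `|w x th|) <= Nw th}).

(** Used twice: with the kernel [kT (s - th)] and the time derivative of [u], to test the equation
    at a fixed time, and with [bT (t - s)] and the transformed source, to test [Fsrc]. *)
Lemma weighted_pair (k psi : R -> R) (K : R) : measurable_fun setT k -> (forall th, 0 <= k th) ->
  integ (fun th => k th * Nw th) ->
  measurable_fun setT psi -> (forall x, `|psi x| <= K) ->
  [/\ integ (fun x => Int (fun th => k th * w x th)),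
      Int (fun x => `|Int (fun th => k th * w x th)|) <= Int (fun th => k th * Nw th) &
      Int (fun x => Int (fun th => k th * w x th) * psi x) =
      Int (fun th => k th * Int (fun x => w x th * psi x))].
Proof.
move=> mk k0 ki mpsi psiK; have K0 : 0 <= K by exact: le_trans (psiK 0).
have mF : mplane (fun x th => k th * w x th) by apply: mplaneM => //; exact: mplane_snd.
have H : {ae mu, forall th, integ (fun x => k th * w x th) /\
    Int (fun x => `|k th * w x th|) <= k th * Nw th}.
  apply: (ae_mp wN) => th [i l]; split; first exact: integZ.
  rewrite (@eq_Int _ _ (fun x => k th * `|w x th|)); last first.
    by move=> x; rewrite normrM (ger0_norm (k0 _)).
  by rewrite IntZ; [exact: ler_wpM2l|exact: integ_abs].
have [_ ai i1 i2] := Int_fubini mF ki H.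
have mF' : mplane (fun x th => `|k th * w x th|) by exact: mplane_abs.
have H' : {ae mu, forall th, integ (fun x => `|k th * w x th|) /\
    Int (fun x => `|(`|k th * w x th|)|) <= k th * Nw th}.
  apply: (ae_mp H) => th [i l]; split; first exact: integ_abs.
  by rewrite (@eq_Int _ _ (fun x => `|k th * w x th|))// => x; rewrite normr_id.
have [fub' _ i3 i4] := Int_fubini mF' ki H'.
have mF2 : mplane (fun x th => (k th * w x th) * psi x).
  by apply: mplaneM => //; exact: mplane_fst.
have H2 : {ae mu, forall th, integ (fun x => (k th * w x th) * psi x) /\
    Int (fun x => `|(k th * w x th) * psi x|) <= K * (k th * Nw th)}.
  apply: (ae_mp H) => th [i l].
  have i' : integ (fun x => (k th * w x th) * psi x).
    by have := integ_mulb i mpsi psiK; congr integ; apply/funext => x; rewrite mulrC.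
  split; first exact: i'.
  apply: (@le_trans _ _ (K * Int (fun x => `|k th * w x th|))); last exact: ler_wpM2l.
  rewrite -IntZ; last exact: integ_abs.
  apply: Int_le (integ_abs i') (integZ _ (integ_abs i)) _ => x.
  by rewrite normrM mulrC ler_wpM2r.
have [fub2 _ i5 i6] := Int_fubini mF2 (integZ K ki) H2.
split; first exact: i1.
- apply: (@le_trans _ _ (Int (fun x => Int (fun th => `|k th * w x th|)))).
    apply: Int_le_ae (integ_abs i1) i3 _.
    by apply: (ae_mp ai) => x ix; exact: Int_abs.
  rewrite fub'; apply: Int_le_ae i4 ki _.
  by apply: (ae_mp H) => th [].
- have -> : Int (fun th => k th * Int (fun x => w x th * psi x)) =
      Int (fun th => Int (fun x => (k th * w x th) * psi x)).
    apply: eq_Int => th; rewrite -IntZ_measurable; last first.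
      by apply: measurable_funM => //; exact: mplane2.
    by apply: eq_Int => x; rewrite mulrA.
  rewrite -fub2; apply: eq_Int => x; rewrite mulrC -IntZ_measurable; last exact: mplane1 mF.
  by apply: eq_Int => th; rewrite mulrC.
Qed.

End SpaceTimeConvolution.

(** * The transformed equation in weak form, and the consistency error *)

Section SourceTerm.
Context {R : realType} (T sigma r a b alphastar Cq : R)
  (alpha dq ct : R -> R) (f u ut : R -> R -> R).
Local Notation mu := (@lebesgue_measure R).
Local Notation L2 := (in_Lp 2%:E a b).
Local Notation ip := (ip a b).
Local Notation wd := (is_wd a b).
Local Notation test := (test_fun a b).
Local Notation al := (alpha 0).
Local Notation kap := (kappa sigma r).
Local Notation lm := (lam sigma r).
Local Notation sg := (2^-1 * sigma ^+ 2).
Local Notation om := (omega sigma r ct u).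
Local Notation kT := (vker alpha \_ `]0, T]).
Local Notation bT := (beta_ker al \_ `]0, T]).
Hypotheses (hT : 0 < T) (hsigma : 0 < sigma)
    (halphaW : in_W1oo T alpha)
    (halpha : forall t, 0 <= t <= T -> 0 < alpha t <= alphastar)
    (halphastar : alphastar < 1)
    (hct : in_H a b 2 ct)
    (hf : measurable_fun (`]a, b[ `*` `]0, T[)
            (fun z : measurableTypeR R * measurableTypeR R => f z.1 z.2))
    (hdt : is_dt a b `[0, T] u ut)
    (hu : forall t, 0 <= t <= T -> in_H a b 2 (u^~ t) /\ in_H10 a b (u^~ t))
    (hu0 : {ae mu, forall x, a < x < b -> u x 0 = ct x})
    (heq : {ae mu, forall t, 0 < t < T -> {ae mu, forall x, a < x < b ->
          convol (vker alpha) (ut x) t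
            - 2^-1 * sigma ^+ 2 * Dx a b (Dx a b (u^~ t)) x
            - (r - sigma ^+ 2 / 2) * Dx a b (u^~ t) x + r * u x t = f x t}})
    (hdq : forall t, 0 <= t <= T -> deriv_on `[0, T] (qker alpha) t (dq t))
    (hCq : forall t, 0 <= t <= T -> `|qker alpha t| <= Cq /\ `|dq t| <= Cq)
    (hreg : regularity T a b al om).

Let zT : (0 : R) <= 0 <= T. Proof. by rewrite lexx (ltW hT). Qed.

Lemma order_bounds : 0 < al < 1 /\ 0 <= alphastar < 1.
Proof.
have /andP[h1 h2] := halpha zT; rewrite h1 halphastar !andbT /=.
by split; [exact: le_lt_trans halphastar|exact: ltW (lt_le_trans h1 h2)].
Qed.

Let al01 : 0 < al < 1. Proof. by case: order_bounds. Qed.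
Let as01 : 0 <= alphastar < 1. Proof. by case: order_bounds. Qed.
Let al0 : 0 < al. Proof. by case/andP: al01. Qed.

Let bTi : integ bT. Proof. by apply: beta_ker_integ => //; exact: ltW. Qed.

Let bT0 s : 0 <= bT s.
Proof.
rewrite patch_itv; case: ifP => // _.
by rewrite /beta_ker mulr_ge0 ?powR_ge0// invr_ge0 Gamma_ge0.
Qed.

Let bTz s : s <= 0 -> bT s = 0.
Proof. by move=> s0; rewrite patch_itv in_itv/= ltNge s0. Qed.

Let bTle s : 0 < s -> bT s <= (Gamma al)^-1 * s `^ (al - 1).
Proof.
move=> s0; rewrite patch_itv; case: ifP => _; first by rewrite /beta_ker mulrC.
by rewrite mulr_ge0 ?powR_ge0// invr_ge0 Gamma_ge0.
Qed.

Let kT_facts : [/\ integ kT, forall s, 0 <= kT s, forall s, s <= 0 -> kT s = 0 &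
  exists2 Ck, 0 <= Ck & forall s, 0 < s -> kT s <= Ck * s `^ ((1 - alphastar) - 1)].
Proof.
have ca : {within `[0, T], continuous alpha} by case: halphaW.
have [mk [C C0 hC]] := vker_bound hT ca halpha halphastar.
have k0 s : 0 <= kT s.
  rewrite patch_itv in_itv/=; case: ifPn => // h; by case/andP: (hC s h).
have p0 : 0 < 1 - alphastar by rewrite subr_gt0.
have [pi _] := Int_powR p0 (ltW hT).
split; [|exact: k0| |].
- apply: (integ_le mk (integZ C pi)) => s; rewrite ger0_norm//.
  rewrite !patch_itv in_itv/=; case: ifPn => [h|]; last by rewrite mulr0.
  by case/andP: (hC s h).
- by move=> s s0; rewrite patch_itv in_itv/= ltNge s0.
- exists C => // s s0; rewrite patch_itv in_itv/=; case: ifPn => [h|_].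
    by case/andP: (hC s h).
  by rewrite mulr_ge0// powR_ge0.
Qed.

Let kTi : integ kT. Proof. by case: kT_facts. Qed.
Let kT0 s : 0 <= kT s. Proof. by case: kT_facts => _ + _ _; exact. Qed.
Let kTz s : s <= 0 -> kT s = 0. Proof. by case: kT_facts => _ _ + _; exact. Qed.
Let mk := integ_measurable kTi.
Let mb := integ_measurable bTi.

Let dCq t : 0 <= t <= T -> `|dq t| <= Cq. Proof. by move=> /hCq[]. Qed.

Lemma dq_integ : integ (dq \_ `]0, T]).
Proof. by have [] := dq_integral hT hdq dCq. Qed.

Let QE t : 0 < t <= T -> kconv bT kT t = qker alpha t.
Proof. by move=> /andP[t0 tT]; rewrite /qker gt_eqF// (convolE _ _ tT). Qed.

Let Q_le t : 0 < t <= T -> kconv bT kT t <= Cq.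
Proof.
move=> h; rewrite QE//; apply: (le_trans (ler_norm _)).
by have [] := hCq (ltac:(by case/andP: h => h1 ->; rewrite (ltW h1)) : 0 <= t <= T).
Qed.

Let QI t : 0 < t <= T -> kconv bT kT t = 1 + Int (dq \_ `]0, t]).
Proof.
move=> h; rewrite QE//; have [_ ->] := dq_integral hT hdq dCq.
  by rewrite {3}/qker eqxx; ring.
by case/andP: h => h1 ->; rewrite (ltW h1).
Qed.

Let assoc t P : t <= T -> integ P -> (forall th, th <= 0 -> P th = 0) ->
  integ (fun s => bT (t - s) * Int (fun th => kT (s - th) * P th)) /\
  Int (fun s => bT (t - s) * Int (fun th => kT (s - th) * P th)) =
  Int (fun th => kconv bT kT (t - th) * P th).
Proof.
have [_ _ _ [Ck Ck0 Ckle]] := kT_facts.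
exact: (conv_assoc hT al01 as01 mb mk bT0 kT0 bTle Ckle bTz kTz kTi Q_le).
Qed.

Let Lct : L2 ct. Proof. by case: hct. Qed.
Let Lu t : 0 <= t <= T -> L2 (u^~ t). Proof. by move=> /hu[[]]. Qed.

Lemma omega_L2 t : 0 <= t <= T -> L2 (om^~ t).
Proof. by move=> /Lu h; exact: (L2B (L2_ew kap h) (L2_ew kap Lct)). Qed.

(* The exponential weight is bounded on ]a, b[ only. *)
Let cut (eta : R -> R) : R -> R := (fun x => ew kap x * eta x) \_ `]a, b[.

Let cut_bounded (eta : R -> R) (K : R) : measurable_fun setT eta -> (forall x, `|eta x| <= K) ->
  measurable_fun setT (cut eta) /\
  forall x, `|cut eta x| <= expR (`|kap| * (`|a| + `|b|)) * K.
Proof.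
move=> me eK; have K0 : 0 <= K by exact: le_trans (eK 0).
split.
  by apply: measurable_patch_itv; apply: measurable_funM => //; exact: ew_measurable.
move=> x; rewrite /cut patch_itv in_itv/=; case: ifPn => [xab|_]; last first.
  by rewrite normr0 mulr_ge0// expR_ge0.
by rewrite normrM; apply: ler_pM => //; exact: ew_bound.
Qed.

Let ip_cut (v eta : R -> R) : ip v (cut eta) = ip (fun x => ew kap x * v x) eta.
Proof.
apply: eq_Int => x; rewrite !patch_itv; case: ifPn => // xab; rewrite /cut patch_itv xab /=; ring.
Qed.

Let P (eta : R -> R) : R -> R := (fun th => ip (ut^~ th) (cut eta)) \_ `]0, T[.

(** The derivative is known for [u], so the weight of [transf] is moved onto [eta] by [cut]. The
    initial condition makes the subtracted [ct] term the value at time 0. *)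
Lemma omega_pair (eta : R -> R) (K : R) : measurable_fun setT eta -> (forall x, `|eta x| <= K) ->
  integ (P eta) /\
  forall s, 0 <= s <= T -> ip (om^~ s) eta = Int (P eta \_ `]0, s[).
Proof.
move=> me eK; have [mc cK] := cut_bounded me eK.
have in0 : (0 : R) \in `[0, T] by rewrite in_itv.
have H t : 0 <= t <= T -> integ ((fun th => ip (ut^~ th) (cut eta)) \_ `]0, t[) /\
    ip (u^~ t) (cut eta) - ip (u^~ 0) (cut eta) =
    Int ((fun th => ip (ut^~ th) (cut eta)) \_ `]0, t[).
  move=> /andP[t0 tT]; apply: (dt_pair hdt mc cK) => //.
    by rewrite in_itv/= t0.
  by move=> th /andP[h1 h2]; rewrite in_itv/=; apply/andP; split; lra.
split; first by case: (H T); rewrite ?lexx ?(ltW hT).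
have Le : L2 eta.
  by apply: (@L2_bounded _ _ _ _ K) => // ; exact: measurable_patch_itv.
have Lc : L2 (cut eta) by apply: L2_bounded (fun x _ => cK x); exact: measurable_patch_itv.
move=> s sT; have [_ e] := H s sT.
have -> : ip (om^~ s) eta = ip (u^~ s) (cut eta) - ip (u^~ 0) (cut eta).
  rewrite (ip_ae (Lu zT) Lct Lc hu0) !ip_cut.
  exact: (ipBl (L2_ew kap (Lu sT)) (L2_ew kap Lct) Le).
rewrite e; apply: eq_Int => th; rewrite /P !patch_itv !in_itv/=.
case: ifPn => // /andP[h1 h2]; rewrite h1/= ifT//.
by case/andP: sT => _; exact: lt_le_trans.
Qed.

Let zc := transf sigma r ct.
Let Z t := transf sigma r (u^~ t).

Let test_bounded chi : test chi -> measurable_fun setT chi /\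
  exists K, forall x, `|chi x| <= K.
Proof. by move=> /test_bdd [c [d [K [_ _ _ [m k _] _]]]]; split => //; exists K. Qed.

Let test_bounded2 chi : test (derive1 chi) ->
  measurable_fun setT (derive1 (derive1 chi)) /\
  exists K, forall x, `|derive1 (derive1 chi) x| <= K.
Proof. by move=> /test_bdd [c [d [K [_ _ _ _ [m k _]]]]]; split => //; exists K. Qed.

Let LZ t : 0 <= t <= T -> L2 (Z t). Proof. by move=> /Lu; exact: L2_ew. Qed.
Let Lzc : L2 zc. Proof. exact: L2_ew. Qed.

Let zc_wd : wd zc (Dx a b zc) /\ wd (Dx a b zc) (Dx a b (Dx a b zc)).
Proof.
have [L0 w1 w2] := in_H2P hct.
by have [_ h1 h2] := in_H2P (in_H2_wd Lzc (wd_ew kap L0 w1) (wd_ew2 kap L0 w1 w2)).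
Qed.

(** The sign is such that the equation reads k * u_t = f + [rest]. *)
Definition rest (t x : R) : R :=
  sg * Dx a b (Dx a b (u^~ t)) x + (r - sigma ^+ 2 / 2) * Dx a b (u^~ t) x - r * u x t.

Lemma rest_L2 t : 0 <= t <= T -> L2 (rest t).
Proof.
move=> /hu[/in_H2P[L0 /wd_L2 L1 /wd_L2 L2'] _].
exact: (L2B (L2D (L2Z sg L2') (L2Z _ L1)) (L2Z r L0)).
Qed.

(* The exponent [kappa] is chosen so that the weight removes the first-order term. *)
Lemma ew_rest t x : ew kap x * rest t x =
  sg * (ew kap x * ((Dx a b (Dx a b (u^~ t)) x - kap * Dx a b (u^~ t) x)
     - kap * (Dx a b (u^~ t) x - kap * u x t))) - lm * Z t x.
Proof.
rewrite /rest /Z /transf -/(ew kap x) /lam.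
set e := ew kap x; set p := Dx a b (Dx a b _) x; set q := Dx a b _ x; set v := u x t.
rewrite /kappa; clearbody e p q v; field; exact: lt0r_neq0.
Qed.

Let Zpair t chi : 0 <= t <= T -> test chi -> test (derive1 chi) ->
  ip (fun x => ew kap x * rest t x) chi =
  sg * ip (Z t) (derive1 (derive1 chi)) - lm * ip (Z t) chi.
Proof.
move=> tT t1 t2; have [Lc _] := test_L2 t1.
have [/in_H2P[L0 w1 w2] _] := hu tT.
have W1 := wd_ew kap L0 w1; have W2 := wd_ew2 kap L0 w1 w2.
have LZ2 := wd_L2 W2.
rewrite -(wd_test2 W1 W2 t1 t2) -(ipZl sg LZ2 Lc) -(ipZl lm (LZ tT) Lc).
rewrite -(ipBl (L2Z sg LZ2) (L2Z lm (LZ tT)) Lc); congr (Int (_ \_ _)).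
by apply/funext => x; rewrite ew_rest.
Qed.

Let c0 x := sg * Dx a b (Dx a b zc) x - lm * zc x.

Let Lc0 : L2 c0.
Proof. by have [_ /wd_L2 h] := zc_wd; exact: (L2B (L2Z sg h) (L2Z lm Lzc)). Qed.

Let c0_pair chi : test chi -> test (derive1 chi) ->
  ip c0 chi = sg * ip zc (derive1 (derive1 chi)) - lm * ip zc chi.
Proof.
move=> t1 t2; have [Lc _] := test_L2 t1; have [w1 w2] := zc_wd.
have h := wd_L2 w2.
by rewrite (ipBl (L2Z sg h) (L2Z lm Lzc) Lc) (ipZl sg h Lc) (ipZl lm Lzc Lc)
  (wd_test2 w1 w2 t1 t2).
Qed.

Let om_pair t eta : 0 <= t <= T -> L2 eta -> ip (om^~ t) eta = ip (Z t) eta - ip zc eta.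
Proof. by move=> tT Le; exact: (ipBl (LZ tT) Lzc Le). Qed.

Let gen_pair t chi : 0 <= t <= T -> test chi -> test (derive1 chi) ->
  ip (fun x => ew kap x * rest t x) chi =
  ip c0 chi + (sg * ip (om^~ t) (derive1 (derive1 chi)) - lm * ip (om^~ t) chi).
Proof.
move=> tT t1 t2; have [Lc _] := test_L2 t1; have [_ Lc''] := test_L2 t2.
by rewrite (Zpair tT t1 t2) (c0_pair t1 t2) !om_pair//; ring.
Qed.

Let om0 chi : L2 chi -> ip (om^~ 0) chi = 0.
Proof.
move=> Lc; rewrite (om_pair zT Lc); apply/eqP; rewrite subr_eq0; apply/eqP.
apply: (ip_ae (LZ zT) Lzc Lc); apply: (ae_mp hu0) => x hx xab.
by rewrite /Z /zc /transf hx.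
Qed.

Lemma omega_singular : exists2 C0, 0 <= C0 & forall chi, test chi -> test (derive1 chi) ->
    singular_at0 al T (C0 * normL2 a b chi) (fun s => ip (om^~ s) chi) /\
    singular_at0 al T (C0 * normL2 a b chi)
      (fun s => ip (om^~ s) (derive1 (derive1 chi))).
Proof. exact: regularity_singular hT al01 hreg om0. Qed.

Let lm0 : 0 <= lm.
Proof. by rewrite /lam mulr_ge0 ?invr_ge0 ?sqr_ge0. Qed.

Let sg0 : 0 <= sg.
Proof. by rewrite mulr_ge0 ?invr_ge0 ?sqr_ge0. Qed.

(** By [gen_pair] the pairing with [chi] consists of scalar functions bounded through (R) by
    multiples of the norm of [chi]; duality removes [chi]. The uniformity in [t] is what Fubini in
    time needs. *)
Let rest_bound : exists2 C1, 0 <= C1 & forall t, 0 <= t <= T ->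
  normL2 a b (fun x => ew kap x * rest t x) <= C1.
Proof.
have [C0 C00 H] := omega_singular.
pose A := C0 * T `^ al.
have A0 : 0 <= A by rewrite mulr_ge0 ?powR_ge0.
have C10 : 0 <= normL2 a b c0 + (sg * A + lm * A).
  apply: addr_ge0; first exact: normL2_ge0.
  by apply: addr_ge0; [exact: (mulr_ge0 sg0 A0)|exact: (mulr_ge0 lm0 A0)].
exists (normL2 a b c0 + (sg * A + lm * A)) => // t tT.
apply: (L2_dual (L2_ew kap (rest_L2 tT)) C10) => chi t1 t2.
have [Lc _] := test_L2 t1; have [h1 h2] := H chi t1 t2.
have n0 := normL2_ge0 a b chi.
have B y : singular_at0 al T (C0 * normL2 a b chi) y -> `|y t| <= A * normL2 a b chi.
  move=> [h _]; apply: (le_trans (h t tT)); rewrite /A mulrAC ler_wpM2r//.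
  by rewrite ler_wpM2l// ge0_ler_powR ?nnegrE ?(ltW al0) ?(ltW hT)//; case/andP: tT.
rewrite (gen_pair tT t1 t2) mulrDl; apply: (le_trans (ler_normD _ _)).
apply: lerD; first exact: (cauchy_schwarz Lc0 Lc).
have -> : (sg * A + lm * A) * normL2 a b chi =
    sg * (A * normL2 a b chi) + lm * (A * normL2 a b chi) by ring.
apply: (le_trans (ler_normB _ _)).
rewrite (normrM sg) (normrM lm) (ger0_norm lm0) (ger0_norm sg0).
by apply: lerD; apply: ler_wpM2l => //; [exact: (B _ h2)|exact: (B _ h1)].
Qed.

Let wx := spacetime a b 0 T ut.
Let Nw th := normL2 a b (fun=> 1) * ((fun th => normL2 a b (ut^~ th)) \_ `]0, T[) th.

Let wx_facts : [/\ mplane wx, integ Nw &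
  {ae mu, forall th, integ (wx^~ th) /\ Int (fun x => `|wx x th|) <= Nw th}].
Proof.
have [mw Lv H] := hdt.
have in0 : (0 : R) \in `[0, T] by rewrite in_itv.
have inT : T \in `[0, T] by rewrite in_itv/= lexx (ltW hT).
have [Lw ni _] := H 0 T in0 inT (ltW hT).
have mF : mplane wx.
  apply: mplane_itv; apply: measurable_funS mw.
    by apply: measurableX; exact: measurable_itv.
  move=> [x th] /= [hx hth]; split => //=; move: hth; rewrite !in_itv/=.
  by move=> /andP[h1 h2]; rewrite !ltW.
have [ni' h] := spacetime_fubini mF Lw ni.
by split; [exact: mF|exact: integZ|exact: h].
Qed.

Let Nw0 th : 0 <= Nw th.
Proof.
rewrite /Nw mulr_ge0 ?normL2_ge0// patch_itv; case: ifP => // _; exact: normL2_ge0.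
Qed.

Let Nwz th : th <= 0 -> Nw th = 0.
Proof. by move=> h; rewrite /Nw patch_itv in_itv/= ltNge h mulr0. Qed.

Let Pz eta th : th <= 0 -> P eta th = 0.
Proof. by move=> h; rewrite /P patch_itv in_itv/= ltNge h. Qed.

Let PE eta th : P eta th = Int (fun x => wx x th * cut eta x).
Proof.
rewrite /P patch_itv /wx /spacetime; case: ifPn => hth.
  apply: eq_Int => x; rewrite patch_itv andbT; case: ifP => // _; by rewrite mul0r.
rewrite -[LHS]Int0; apply: eq_Int => x; by rewrite andbF mul0r.
Qed.

Let ones (I : interval R) := (fun=> 1 : R) \_ [set` I].

(** The function convolved in [Fsrc], cut to the space-time rectangle and written as a sum of
    products for the sake of joint measurability; [GE] is its readable form. *)
Let G x s := (c0 \_ `]a, b[) x * ones `]0, T[ s +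
  ew kap x * (if (x \in `]a, b[) && (s \in `]0, T[) then f x s else 0).

Let GE x s : G x s = if (x \in `]a, b[) && (s \in `]0, T[) then c0 x + ew kap x * f x s else 0.
Proof.
rewrite /G /ones !patch_itv; case: (x \in _); case: (s \in _) => /=;
  by rewrite ?mulr1 ?mulr0 ?mul0r ?addr0.
Qed.

Let mG : mplane G.
Proof.
apply: mplaneD; apply: mplaneM.
- by apply: mplane_fst; exact: L2_measurable Lc0.
- by apply: mplane_snd; apply: measurable_patch_itv; exact: measurable_cst.
- by apply: mplane_fst; exact: ew_measurable.
- exact: mplane_itv hf.
Qed.

Let Kw := expR (`|kap| * (`|a| + `|b|)).

(** The equation gives [G] as the sum of c0 - ew * [rest] and of the weight times k * u_t. The first
    part is bounded in L^2 by [rest_bound], the second in L^1 by [weighted_pair]. In the pairing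
    with [chi], [gen_pair] cancels [c0]. *)
Let slice : exists2 A, 0 <= A & {ae mu, forall s, 0 < s < T ->
  [/\ integ (G^~ s),
      Int (fun x => `|G x s|) <= A + Kw * Int (fun th => kT (s - th) * Nw th) &
      forall chi, test chi -> test (derive1 chi) ->
        Int (fun x => G x s * chi x) =
          (lm * ip (om^~ s) chi - sg * ip (om^~ s) (derive1 (derive1 chi)))
          + Int (fun th => kT (s - th) * P chi th)]}.
Proof.
have [C1 C10 HC1] := rest_bound.
have n1 := normL2_ge0 a b (fun=> 1); have nc := normL2_ge0 a b c0.
exists (normL2 a b (fun=> 1) * (normL2 a b c0 + C1)); first by rewrite mulr_ge0 ?addr_ge0.
have [mw Ni wN] := wx_facts.
have kae := conv_ae_integ mk kT0 kTi Ni.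
apply: (ae_mp2 heq kae) => s Es ki sT; have {}Es := Es sT; have /andP[s0 sT'] := sT.
have sT2 : 0 <= s <= T by rewrite !ltW.
pose k th := kT (s - th).
have mk' : measurable_fun setT k.
  by apply: (measurableT_comp mk); exact: measurable_funB.
have k0 th : 0 <= k th by exact: kT0.
pose L x := Int (fun th => k th * wx x th).
pose e1 := cut (fun=> 1).
have [me1 e1K] : measurable_fun setT e1 /\ forall x, `|e1 x| <= Kw.
  have [] := @cut_bounded (fun=> 1) 1 (measurable_cst _).
    by move=> x; rewrite normr1.
  by rewrite mulr1.
have Lr := L2_ew kap (rest_L2 sT2).
pose B x := c0 x - ew kap x * rest s x.
have LB : L2 B by exact: L2B.
have HL (psi : R -> R) (K : R) : measurable_fun setT psi -> (forall x, `|psi x| <= K) ->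
   [/\ integ L, Int (fun x => `|L x|) <= Int (fun th => k th * Nw th) &
       Int (fun x => L x * psi x) = Int (fun th => k th * Int (fun x => wx x th * psi x))].
  by move=> mp pK; exact: (weighted_pair mw wN mk' k0 ki mp pK).
have [iL lL _] := HL e1 _ me1 e1K.
have Bi := L2_integ LB; have Li := integ_mulb iL me1 e1K.
have convL x : a < x < b -> convol (vker alpha) (ut x) s = L x.
  move=> xab; rewrite (convolE _ _ (ltW sT')); apply: eq_Int => th.
  rewrite -/(k th) /wx /spacetime [x \in _]in_itv/= xab [RHS]/= patch_itv !in_itv/=.
  have [tT|tT] := ltP th T; first by rewrite (ltW tT).
  have h : s - th <= 0 by rewrite subr_le0 (le_trans (ltW sT') tT).
  by rewrite /k (kTz h) !mul0r.
have Ge : {ae mu, forall x, (B \_ `]a, b[) x + e1 x * L x = G x s}.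
  apply: (ae_mp Es) => x hx; rewrite GE /e1 /cut !patch_itv !in_itv/= sT andbT.
  case: ifPn => [xab|_]; last by rewrite mul0r addr0.
  by rewrite -(hx xab) (convL x xab) /B /rest mulr1; ring.
have mGs : measurable_fun setT (G^~ s) by exact: mplane2.
have Gi := integD Bi Li.
have iG : integ (G^~ s) by exact: integ_ae Gi mGs Ge.
split; first exact: iG.
- have Ge' : {ae mu, forall x, `|G x s| <= `|(B \_ `]a, b[) x| + Kw * `|L x|}.
    apply: (ae_mp Ge) => x <-; apply: (le_trans (ler_normD _ _)); rewrite lerD2l.
    by rewrite normrM ler_wpM2r.
  have Bi' := integ_abs Bi; have Li' := integZ Kw (integ_abs iL).
  apply: (le_trans (Int_le_ae (integ_abs iG) (integD Bi' Li') Ge')).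
  rewrite (IntD Bi' Li') (IntZ Kw (integ_abs iL)); apply: lerD; last first.
    by apply: ler_wpM2l => //; exact: expR_ge0.
  apply: (le_trans (Int_L2_le LB)); apply: ler_wpM2l => //.
  (* The triangle inequality for [normL2], obtained by duality. *)
  apply: (L2_dual LB) => [|chi t1 t2]; first by rewrite addr_ge0.
  have [Lc _] := test_L2 t1.
  rewrite (ipBl Lc0 Lr Lc) mulrDl; apply: (le_trans (ler_normB _ _)); apply: lerD.
    exact: cauchy_schwarz.
  apply: (le_trans (cauchy_schwarz Lr Lc)); apply: ler_wpM2r; first exact: normL2_ge0.
  exact: HC1.
- move=> chi t1 t2; have [mchi [K chiK]] := test_bounded t1.
  have [Lc _] := test_L2 t1.
  have [mcc ccK] := cut_bounded mchi chiK.
  have [_ _ eL] := HL _ _ mcc ccK.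
  have i1 := integ_ip LB Lc; have i2 := integ_mulb iL mcc ccK.
  have E : {ae mu, forall x, ((fun x => B x * chi x) \_ `]a, b[) x + cut chi x * L x
      = G x s * chi x}.
    apply: (ae_mp Ge) => x <-; rewrite /e1 /cut !patch_itv; case: ifP => _; last by rewrite !mul0r addr0 mul0r.
    by ring.
  have m2 : measurable_fun setT (fun x => G x s * chi x) by exact: measurable_funM.
  rewrite -(Int_ae (integ_measurable (integD i1 i2)) m2 E) (IntD i1 i2).
  rewrite (@eq_Int _ (fun x => cut chi x * L x) (fun x => L x * cut chi x)); last first.
    by move=> x; rewrite mulrC.
  rewrite eL -[Int _]/(ip B chi) (ipBl Lc0 Lr Lc) (gen_pair sT2 t1 t2).
  congr (_ + _); first by ring.
  by apply: eq_Int => th; rewrite PE.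
Qed.

Let bconv (t : R) (y : R -> R) (K : R) : t <= T -> measurable_fun setT (y \_ `]0, T]) ->
  (forall s, 0 <= s <= T -> `|y s| <= K) -> 0 <= K ->
  integ (fun s => bT (t - s) * (y \_ `]0, T]) s) /\
  Int (fun s => bT (t - s) * (y \_ `]0, T]) s) = convol (beta_ker al) y t.
Proof.
move=> tT my yK K0; split; last by rewrite (convolE _ _ tT).
have [i _] := Int_refl t bTi.
have yb s : `|(y \_ `]0, T]) s| <= K.
  rewrite patch_itv in_itv/=; case: ifPn => [/andP[h1 h2]|_]; last by rewrite normr0.
  by apply: yK; rewrite (ltW h1).
have := integ_mulb i my yb; congr integ.
by apply/funext => s; rewrite mulrC.
Qed.

Let om_meas (eta : R -> R) (K : R) : measurable_fun setT eta -> (forall x, `|eta x| <= K) ->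
  measurable_fun setT ((fun s => ip (om^~ s) eta) \_ `]0, T]).
Proof.
move=> me eK; have [Pi yE] := omega_pair me eK.
apply: (prim_measurable Pi) => s /andP[s0 sT]; apply: yE; by rewrite (ltW s0).
Qed.

Lemma omega_measurable chi : test chi -> test (derive1 chi) ->
  measurable_fun setT ((fun s => ip (om^~ s) chi) \_ `]0, T]) /\
  measurable_fun setT ((fun s => ip (om^~ s) (derive1 (derive1 chi))) \_ `]0, T]).
Proof.
move=> t1 t2; have [m1 [K1 k1]] := test_bounded t1.
have [m2 [K2 k2]] := test_bounded2 t2.
by split; [exact: om_meas m1 k1|exact: om_meas m2 k2].
Qed.

(** The pairings of [slice] are integrated against [bT (t - s)]. For the term with the scalar
    derivative [P chi], associativity replaces the two kernels by q, and [convol_derivative] turns q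
    * y' into y + dq * y. *)
Lemma source_pair t chi : 0 < t <= T -> test chi -> test (derive1 chi) ->
  ip ((Fsrc sigma r a b alpha ct f)^~ t) chi =
  ip (om^~ t) chi + convol dq (fun s => ip (om^~ s) chi) t
  + lm * convol (beta_ker al) (fun s => ip (om^~ s) chi) t
  - sg * convol (beta_ker al) (fun s => ip (om^~ s) (derive1 (derive1 chi))) t.
Proof.
move=> /andP[t0 tT] t1 t2; have [mchi [K chiK]] := test_bounded t1.
have [A A0 sl] := slice.
pose y s := ip (om^~ s) chi; pose z s := ip (om^~ s) (derive1 (derive1 chi)).
have [my mz] := omega_measurable t1 t2.
have [C0 C00 HS] := omega_singular; have [Sy Sz] := HS chi t1 t2.
set M := C0 * normL2 a b chi * T `^ al.
have M0 : 0 <= M by rewrite !mulr_ge0 ?powR_ge0 ?normL2_ge0.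
have Sb v : singular_at0 al T (C0 * normL2 a b chi) v -> forall s, 0 <= s <= T -> `|v s| <= M.
  move=> [h _] s sT; apply: (le_trans (h s sT)).
  rewrite ler_wpM2l ?mulr_ge0 ?normL2_ge0// ge0_ler_powR ?nnegrE ?(ltW al0) ?(ltW hT)//.
    by case/andP: sT.
  by case/andP: sT.
have [iy ey] := bconv tT my (Sb _ Sy) M0; have [iz ez] := bconv tT mz (Sb _ Sz) M0.
have [Pi yE] := omega_pair mchi chiK.
have [iP eP] := assoc tT Pi (@Pz chi).
have [mw Ni wN] := wx_facts.
have [iN _] := assoc tT Ni Nwz.
pose NG s := A * ones `]0, T[ s + Kw * Int (fun th => kT (s - th) * Nw th).
pose k s := bT (t - s).
have mk' : measurable_fun setT k.
  by apply: (measurableT_comp mb); exact: measurable_funB.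
have Kw0 : 0 <= Kw by exact: expR_ge0.
have [rb _] := Int_refl t bTi.
have kNG : integ (fun s => k s * NG s).
  have i1 : integ (fun s => ones `]0, T[ s * k s).
    apply: (integ_mulb (K := 1) rb) => [|s].
      by apply: measurable_patch_itv; exact: measurable_cst.
    by rewrite /ones patch_itv; case: ifP; rewrite ?normr1 ?normr0.
  have := integD (integZ A i1) (integZ Kw iN); congr integ; apply/funext => s.
  by rewrite /NG /k; ring.
have GN : {ae mu, forall s, integ (G^~ s) /\ Int (fun x => `|G x s|) <= NG s}.
  apply: (ae_mp sl) => s; rewrite /NG /ones patch_itv in_itv/=.
  case: ifPn => [sT /(_ isT)[i l _]|ns _]; first by rewrite mulr1; split.
  have E x : G x s = 0 by rewrite GE [s \in _]in_itv/= (negbTE ns) andbF.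
  split; first by rewrite (funext E); exact: integ0.
  rewrite (@eq_Int _ _ (fun=> 0)) => [|x]; last by rewrite E normr0.
  rewrite Int0 mulr0 add0r; apply: mulr_ge0 => //; apply: Int_ge0 => th.
  exact: mulr_ge0 (kT0 _) (Nw0 _).
have [_ _ fub] := weighted_pair mG GN mk' (fun s => bT0 _) kNG mchi chiK.
have -> : ip ((Fsrc sigma r a b alpha ct f)^~ t) chi =
    Int (fun x => Int (fun s => k s * G x s) * chi x).
  apply: eq_Int => x; rewrite patch_itv; case: ifPn => xab; last first.
    rewrite (@eq_Int _ _ (fun=> 0)) ?Int0 ?mul0r// => s.
    by rewrite GE (negbTE xab) mulr0.
  congr (_ * _); rewrite /Fsrc (convolE _ _ tT); apply: eq_Int => s.
  rewrite /k GE xab; have [sT|sT] := ltP s T; last first.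
    have h : t - s <= 0 by rewrite subr_le0 (le_trans tT).
    by rewrite (bTz h) !mul0r.
  by congr (_ * _); rewrite patch_itv !in_itv/= sT (ltW sT) !andbT.
rewrite fub.
pose V s := k s * (lm * (y \_ `]0, T]) s - sg * (z \_ `]0, T]) s)
  + k s * Int (fun th => kT (s - th) * P chi th).
have i1 : integ (fun s => lm * (bT (t - s) * (y \_ `]0, T]) s)) by exact: integZ.
have i2 : integ (fun s => sg * (bT (t - s) * (z \_ `]0, T]) s)) by exact: integZ.
have VE : V = fun s => (lm * (bT (t - s) * (y \_ `]0, T]) s) - sg * (bT (t - s) * (z \_ `]0, T]) s))
   + bT (t - s) * Int (fun th => kT (s - th) * P chi th).
  by apply/funext => s; rewrite /V /k; ring.
have iV : integ V by rewrite VE; exact: integD (integB i1 i2) iP.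
have mU : measurable_fun setT (fun s => k s * Int (fun x => G x s * chi x)).
  apply: measurable_funM => //; apply: (mplane_Int (F := fun s x => G x s * chi x)).
  by apply: mplaneM; [exact: mplaneC|exact: mplane_snd].
have E : {ae mu, forall s, V s = k s * Int (fun x => G x s * chi x)}.
  apply: (ae_mp sl) => s; rewrite /V.
  have [s0 _|s0] := leP s 0.
    rewrite (@eq_Int _ (fun x => G x s * chi x) (fun=> 0)) ?Int0; last first.
      by move=> x; rewrite GE [s \in _]in_itv/= ltNge s0 /= andbF mul0r.
    rewrite (@eq_Int _ (fun th => kT (s - th) * P chi th) (fun=> 0)) ?Int0; last first.
      move=> th; have [h|h] := leP th 0; first by rewrite Pz// mulr0.
      have h' : s - th <= 0 by rewrite subr_le0 (le_trans s0 (ltW h)).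
      by rewrite (kTz h') mul0r.
    by rewrite !patch_itv !in_itv/= !(ltNge 0 s) s0 /=; ring.
  have [sT|sT _] := ltP s T; last first.
    have h : t - s <= 0 by rewrite subr_le0 (le_trans tT).
    by rewrite /k (bTz h) !mul0r addr0.
  move=> /(_ isT)[_ _ /(_ chi t1 t2) ->].
  by rewrite !patch_itv !in_itv/= s0 (ltW sT) /= -/(y s) -/(z s); ring.
rewrite -(Int_ae (integ_measurable iV) mU E) VE (IntD (integB i1 i2) iP) (IntB i1 i2).
rewrite (IntZ lm iy) (IntZ sg iz) ey ez eP.
have yE' s : 0 < s <= T -> y s = Int (P chi \_ `]0, s[).
  by move=> /andP[h1 h2]; apply: yE; rewrite (ltW h1).
have Qz s : s <= 0 -> kconv bT kT s = 0 by exact: (kconv_0 bTz kTz).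
rewrite (convol_derivative hT dq_integ dCq QI Qz Pi (@Pz chi) yE'); last by rewrite t0.
rewrite -/y -/z -[ip (om^~ t) chi]/(y t).
by move: (convol dq y t) (convol _ y t) (convol _ z t) (y t) => *; ring.
Qed.


(** Explicit versions of the weak derivatives of [omega], here and in [omega2], from the product
    rule; [Dx] of [omega] would match them only up to null sets. *)
Definition omega1 (t x : R) : R :=
  ew kap x * (Dx a b (u^~ t) x - kap * u x t) - ew kap x * (Dx a b ct x - kap * ct x).

Definition omega2 (t x : R) : R :=
  ew kap x * ((Dx a b (Dx a b (u^~ t)) x - kap * Dx a b (u^~ t) x)
    - kap * (Dx a b (u^~ t) x - kap * u x t))
  - ew kap x * ((Dx a b (Dx a b ct) x - kap * Dx a b ct x)
    - kap * (Dx a b ct x - kap * ct x)).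

Lemma omega_wd t : 0 <= t <= T -> wd (om^~ t) (omega1 t) /\ wd (omega1 t) (omega2 t).
Proof.
move=> tT; have [/in_H2P[L0 w1 w2] _] := hu tT; have [c0_ c1 c2] := in_H2P hct.
split; first exact: (wdB (L2_ew kap L0) (L2_ew kap c0_) (wd_ew kap L0 w1) (wd_ew kap c0_ c1)).
have W1 := wd_ew2 kap L0 w1 w2; have W2 := wd_ew2 kap c0_ c1 c2.
exact: (wdB (wd_L2 (wd_ew kap L0 w1)) (wd_L2 (wd_ew kap c0_ c1)) W1 W2).
Qed.

(** The datum [ct] inherits the boundary condition from [u] at time 0, with which it agrees almost
    everywhere. *)
Lemma omega_green t : 0 <= t <= T -> green a b (om^~ t) (omega1 t).
Proof.
move=> tT; have [/in_H2P[L0 w1 _] g0] := hu tT; have [c0_ c1 _] := in_H2P hct.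
have [/in_H2P[z0 z1 _] gz] := hu zT.
have Gu := green_H10 g0 w1; have Gz := green_H10 gz z1.
have L1 := wd_L2 w1; have d1 := wd_L2 c1.
have Gc : green a b ct (Dx a b ct).
  move=> p p1 Lp pp1; have Lp1 := wd_L2 pp1.
  rewrite !(ipC a b _ ct) !(ipC a b _ (Dx a b ct)) -(ip_ae z0 c0_ Lp1 hu0).
  rewrite -(ip_ae (wd_L2 z1) d1 Lp (wd_unique z0 c0_ hu0 z1 c1)).
  by rewrite !(ipC a b (_^~ 0)) (ipC a b (Dx a b _)); exact: Gz.
exact: (greenB (L2_ew kap L0) (L2_ew kap c0_)
  (wd_L2 (wd_ew kap L0 w1)) (wd_L2 (wd_ew kap c0_ c1))
  (green_ew kap L0 L1 Gu) (green_ew kap c0_ d1 Gc)).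
Qed.

Definition residual (N n : nat) (x : R) : R :=
  om x (grid T N n) + \sum_(1 <= j < n.+1) weight T N dq n j * om x (grid T N j)
  + lm * \sum_(1 <= j < n.+1) weight T N (beta_ker al) n j * om x (grid T N j)
  - sg * \sum_(1 <= j < n.+1) weight T N (beta_ker al) n j * omega2 (grid T N j) x
  - Fsrc sigma r a b alpha ct f x (grid T N n).

Lemma grid_bounds (N n : nat) : (1 <= n <= N)%N -> 0 < grid T N n <= T.
Proof.
move=> /andP[n1 nN]; have N0 : (0 < N)%N by exact: leq_trans nN.
rewrite /grid mulr_gt0 ?divr_gt0 ?ltr0n//= mulrCA -[leRHS]mulr1.
by rewrite ler_pM2l// ler_pdivrMr ?ltr0n// mul1r ler_nat.
Qed.

Hypothesis hF : forall N n : nat, (1 <= n <= N)%N ->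
  L2 ((Fsrc sigma r a b alpha ct f)^~ (grid T N n)).

Let sum_L2 (n : nat) (c : nat -> R) (v : nat -> R -> R) :
  (forall j, (1 <= j <= n)%N -> L2 (v j)) ->
  L2 (fun x => \sum_(1 <= j < n.+1) c j * v j x) /\
  forall chi, L2 chi -> ip (fun x => \sum_(1 <= j < n.+1) c j * v j x) chi =
    \sum_(1 <= j < n.+1) c j * ip (v j) chi.
Proof.
move=> Lv.
have E x : \sum_(1 <= j < n.+1) c j * v j x =
    \sum_(j <- index_iota 1 n.+1 | (1 <= j <= n)%N) c j * v j x.
  by rewrite big_seq_cond [RHS]big_seq_cond; apply: eq_bigl => j; rewrite mem_index_iota ltnS andbT andbb.
have LF j : (1 <= j <= n)%N -> L2 (fun x => c j * v j x) by move=> /Lv; exact: L2Z.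
rewrite (funext E); split; first exact: L2_sum.
move=> chi Lc; rewrite (ip_suml _ LF Lc) big_seq_cond [RHS]big_seq.
apply: eq_big => [j|j]; first by rewrite mem_index_iota ltnS andbb.
by rewrite mem_index_iota ltnS andbb => /Lv Lj; exact: ipZl.
Qed.

(** Paired with [chi], the residual is by [source_pair] a combination of three scalar quadrature
    errors, each with a constant proportional to the norm of [chi], which duality then removes. *)
Lemma residual_bound : exists2 C, 0 <= C & forall N n : nat, (1 <= n <= N)%N ->
  L2 (residual N n) /\ normL2 a b (residual N n) <=
    C * ((T / N%:R) `^ (2^-1 + 3 / 2 * al) * grid T N n `^ ((al - 1) / 2)).
Proof.
have [C0 C00 HS] := omega_singular; have /andP[a0 a1] := al01.
have q0 := quad_const_ge0 al01.
have Cq0 : 0 <= Cq by case: (hCq zT) => h _; exact: le_trans (normr_ge0 _) h.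
(* [dq] is merely bounded; since T^(1 - al) s^(al - 1) >= 1 on []0, T]], it also fits the singular
   bound of [truncation_error]. *)
pose A1 := Cq * T `^ (1 - al); pose A2 := (Gamma al)^-1.
have A10 : 0 <= A1 by rewrite mulr_ge0 ?powR_ge0.
have A20 : 0 <= A2 by rewrite invr_ge0 Gamma_ge0.
have dqb s : 0 < s <= T -> `|dq s| <= A1 * s `^ (al - 1).
  move=> /andP[s0 sT]; have [_ h] := hCq (ltac:(by rewrite (ltW s0)) : 0 <= s <= T).
  apply: (le_trans h); rewrite -[leLHS]mulr1 /A1 -mulrA ler_wpM2l//.
  apply: (@le_trans _ _ (T `^ (1 - al) * T `^ (al - 1))).
    by rewrite -(powRDp _ _ hT) (_ : _ + _ = 0) ?powRr0//; ring.
  by rewrite ler_wpM2l ?powR_ge0// powR_anti// subr_le0 ltW.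
have bb s : 0 < s <= T -> `|beta_ker al s| <= A2 * s `^ (al - 1).
  by move=> _; rewrite /beta_ker mulrC ger0_norm ?mulr_ge0 ?powR_ge0.
have bi : integ (beta_ker al \_ `]0, T]) by apply: beta_ker_integ => //; exact: ltW.
pose C := (A1 + lm * A2 + sg * A2) * C0 * quad_const al.
have C_0 : 0 <= C.
  apply: mulr_ge0 => //; apply: mulr_ge0 => //.
  by apply: addr_ge0; [apply: addr_ge0 => //; exact: mulr_ge0|exact: mulr_ge0].
exists C => // N n nN; have /andP[n1 nN'] := nN.
have tn := grid_bounds nN; have tn' : 0 <= grid T N n <= T by case/andP: tn => /ltW ->.
have tj j : (1 <= j <= n)%N -> 0 <= grid T N j <= T.
  move=> /andP[j1 jn]; have := @grid_bounds N j; rewrite j1 (leq_trans jn nN') => /(_ isT).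
  by case/andP => /ltW ->.
pose v j := om^~ (grid T N j); pose v2 j := omega2 (grid T N j).
have Lv j : (1 <= j <= n)%N -> L2 (v j) by move=> /tj; exact: omega_L2.
have Lv2 j : (1 <= j <= n)%N -> L2 (v2 j).
  by move=> /tj /omega_wd[_ /wd_L2].
have [La pa] := sum_L2 (weight T N dq n) Lv.
have [Lb pb] := sum_L2 (weight T N (beta_ker al) n) Lv.
have [Lc_ pc] := sum_L2 (weight T N (beta_ker al) n) Lv2.
have Ln := omega_L2 tn'; have LF := hF nN.
have Lab := L2D Ln La; have Lb' := L2Z lm Lb; have Lc' := L2Z sg Lc_.
have Lab' := L2D Lab Lb'; have Labc := L2B Lab' Lc'.
have LR : L2 (residual N n) := L2B Labc LF.
split; first exact: LR.
set h := _ `^ _; set g := _ `^ _.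
have hg : 0 <= h * g by rewrite mulr_ge0 ?powR_ge0.
apply: (L2_dual LR); first exact: mulr_ge0.
move=> chi t1 t2; have [Lchi _] := test_L2 t1.
have [my mz] := omega_measurable t1 t2; have [Sy Sz] := HS chi t1 t2.
pose y s := ip (om^~ s) chi; pose z s := ip (om^~ s) (derive1 (derive1 chi)).
have M0 : 0 <= C0 * normL2 a b chi by rewrite mulr_ge0// normL2_ge0.
have E1 := truncation_error al01 hT A10 M0 nN dq_integ dqb my Sy.
have E2 := truncation_error al01 hT A20 M0 nN bi bb my Sy.
have E3 := truncation_error al01 hT A20 M0 nN bi bb mz Sz.
have Rp : ip (residual N n) chi =
    (\sum_(1 <= j < n.+1) weight T N dq n j * y (grid T N j) - convol dq y (grid T N n))
    + lm * (\sum_(1 <= j < n.+1) weight T N (beta_ker al) n j * y (grid T N j)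
        - convol (beta_ker al) y (grid T N n))
    - sg * (\sum_(1 <= j < n.+1) weight T N (beta_ker al) n j * z (grid T N j)
        - convol (beta_ker al) z (grid T N n)).
  rewrite (ipBl Labc LF Lchi) (ipBl Lab' Lc' Lchi) (ipDl Lab Lb' Lchi) (ipDl Ln La Lchi).
  rewrite (ipZl lm Lb Lchi) (ipZl sg Lc_ Lchi) (pa _ Lchi) (pb _ Lchi) (pc _ Lchi).
  rewrite (source_pair tn t1 t2) -/y -/z.
  have -> : \sum_(1 <= j < n.+1) weight T N (beta_ker al) n j * ip (v2 j) chi =
      \sum_(1 <= j < n.+1) weight T N (beta_ker al) n j * z (grid T N j).
    apply: eq_big_nat => j; rewrite ltnS => /tj /omega_wd[w1 w2].
    by rewrite /v2 (wd_test2 w1 w2 t1 t2).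
  by rewrite -[ip (om^~ (grid T N n)) chi]/(y (grid T N n)); ring.
rewrite Rp {Rp}.
move: E1 E2 E3; rewrite -/h -/g -/y -/z.
set e1 := (X in `|X|); move=> E1.
set e2 := (X in `|X|); move=> E2.
set e3 := (X in `|X|); move=> E3.
apply: (le_trans (ler_normB _ _)).
have := ler_wpM2l lm0 E2; have := ler_wpM2l sg0 E3 => H3 H2.
rewrite (normrM sg) (ger0_norm sg0).
have H1 : `|e1 + lm * e2| <= `|e1| + lm * `|e2|.
  by apply: (le_trans (ler_normD _ _)); rewrite (normrM lm) (ger0_norm lm0).
apply: (le_trans (lerD (le_trans H1 (lerD E1 H2)) H3)).
by rewrite le_eqVlt; apply/orP; left; apply/eqP; rewrite /C; ring.
Qed.

End SourceTerm.

(** * Error estimate *)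

Lemma sum_weight_sub (R : realType) (n : nat) (c F G : nat -> R) :
  \sum_(1 <= j < n) c j * (F j - G j) =
  \sum_(1 <= j < n) c j * F j - \sum_(1 <= j < n) c j * G j.
Proof. by rewrite -sumrB; apply: eq_bigr => j _; rewrite mulrBr. Qed.

(** The terms in [ct] cancel, so the error of [U] is the inverse weight, bounded on []a, b[], times
    the error of [W]. The squared exponent [(al - 1) / 2] is the one that [grid_power_sum] can
    sum. *)
Lemma errA_le (R : realType) (T a b sigma r D p K al : R) (N : nat)
    (ct : R -> R) (u : R -> R -> R) (W : nat -> R -> R) : 0 < T -> 0 < al < 1 -> (0 < N)%N ->
  0 <= D -> 0 <= K ->
  (forall n, (1 <= n <= N)%N ->
    in_Lp 2%:E a b (fun x => omega sigma r ct u x (grid T N n) - W n x)) ->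
  \sum_(1 <= n < N.+1) normL2 a b (fun x => omega sigma r ct u x (grid T N n) - W n x) ^+ 2
    <= D * \sum_(1 <= n < N.+1) (K * ((T / N%:R) `^ p * grid T N n `^ ((al - 1) / 2))) ^+ 2 ->
  errA T a b N u (Unum sigma r ct W) <=
    Num.sqrt (expR (`|- kappa sigma r| * (`|a| + `|b|)) ^+ 2 * (D * (K ^+ 2 * (T `^ al / al))))
    * (T / N%:R) `^ p.
Proof.
move=> T0 al01 N0 D0 K0 Le H; have /andP[a0 a1] := al01.
set Kw := expR _; set h := T / N%:R in H *; set hp := h `^ p in H *.
have h0 : 0 < h by rewrite divr_gt0 ?ltr0n.
have hp0 : 0 <= hp by exact: powR_ge0.
have Kw0 : 0 <= Kw by exact: expR_ge0.
have E0 : 0 <= Kw ^+ 2 * (D * (K ^+ 2 * (T `^ al / al))).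
  rewrite mulr_ge0 ?sqr_ge0//; apply: mulr_ge0 => //.
  by rewrite mulr_ge0 ?sqr_ge0// divr_ge0 ?powR_ge0// ltW.
have -> : hp = Num.sqrt (hp ^+ 2) by rewrite sqrtr_sqr ger0_norm.
rewrite -sqrtrM// /errA ler_sqrt; last by rewrite mulr_ge0 ?sqr_ge0.
have Ediff l x : u x (grid T N l) - Unum sigma r ct W l x =
    ew (- kappa sigma r) x * (omega sigma r ct u x (grid T N l) - W l x).
  have e := ewNK (kappa sigma r) x.
  have e' : expR (kappa sigma r * x) = ew (- kappa sigma r) x by rewrite /ew opprK.
  rewrite /Unum /omega e' /transf -/(ew (kappa sigma r) x).
  set p1 := ew (- _) x in e *; set p2 := ew _ x in e *.
  have -> : p1 * (p2 * u x (grid T N l) - p2 * ct x - W l x) =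
     (p1 * p2) * u x (grid T N l) - p1 * (W l x + p2 * ct x) by ring.
  by rewrite e mul1r.
have S1 : \sum_(1 <= l < N.+1) normL2 a b (fun x => u x (grid T N l) - Unum sigma r ct W l x) ^+ 2
    <= Kw ^+ 2 * \sum_(1 <= n < N.+1)
         normL2 a b (fun x => omega sigma r ct u x (grid T N n) - W n x) ^+ 2.
  rewrite mulr_sumr; apply: ler_sum_nat => l; rewrite ltnS => hl.
  rewrite -exprMn lerXn2r ?nnegrE ?normL2_ge0 ?mulr_ge0 ?normL2_ge0//.
  by rewrite (funext (Ediff l)); exact: normL2_ew (Le l hl).
have S2 : \sum_(1 <= n < N.+1) (K * (hp * grid T N n `^ ((al - 1) / 2))) ^+ 2 =
    K ^+ 2 * hp ^+ 2 * \sum_(1 <= n < N.+1) grid T N n `^ (al - 1).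
  rewrite mulr_sumr; apply: eq_big_nat => n /andP[n1 _].
  have g0 : 0 < grid T N n by rewrite /grid mulr_gt0 ?ltr0n.
  have -> : grid T N n `^ (al - 1) = grid T N n `^ ((al - 1) / 2) * grid T N n `^ ((al - 1) / 2).
    by rewrite -(powRDp _ _ g0); congr (_ `^ _); field.
  by ring.
have G := @grid_power_sum R al T N (ltac:(by rewrite a0 ltW)) T0 N0.
rewrite -/h in G.
have := ler_wpM2l (sqr_ge0 Kw) H; rewrite S2 => H2.
have := ler_wpM2l (ltW h0) (le_trans S1 H2) => H3.
apply: (le_trans H3).
have F0 : 0 <= Kw ^+ 2 * (D * (K ^+ 2 * hp ^+ 2)).
  by rewrite mulr_ge0 ?sqr_ge0// mulr_ge0// mulr_ge0 ?sqr_ge0.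
have := ler_wpM2l F0 G; congr (_ <= _); ring.
Qed.

Unset Implicit Arguments.

Theorem theorem3p2 (R : realType) (T sigma r a b alphastar Cq : R)
    (alpha dq ct : R -> R) (f u : R -> R -> R)
    (hT : 0 < T) (hsigma : 0 < sigma) (hr : 0 <= r) (hab : a < b)
    (halphaW : in_W1oo T alpha)
    (halpha : forall t, 0 <= t <= T -> 0 < alpha t <= alphastar)
    (halphastar : alphastar < 1)
    (halpha0 : deriv_on `[0, T] alpha 0 0)
    (hct : in_H a b 2 ct)
    (hf : measurable_fun (`]a, b[ `*` `]0, T[)
            (fun z : measurableTypeR R * measurableTypeR R => f z.1 z.2))
    (hF : forall N n : nat, (1 <= n <= N)%N ->
            in_Lp 2%:E a b ((Fsrc sigma r a b alpha ct f)^~ (grid T N n)))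
    (hu : is_solution T sigma r a b alpha ct f u)
    (hdq : forall t, 0 <= t <= T -> deriv_on `[0, T] (qker alpha) t (dq t))
    (hCq : forall t, 0 <= t <= T -> `|qker alpha t| <= Cq /\ `|dq t| <= Cq)
    (hreg : regularity T a b (alpha 0) (omega sigma r ct u)) :
  exists2 C : R, 0 < C &
  exists2 tau0 : R, 0 < tau0 &
  forall (N : nat) (W : nat -> R -> R), (0 < N)%N -> T / N%:R <= tau0 ->
    is_scheme T sigma r a b alpha dq ct f N W ->
    errA T a b N u (Unum sigma r ct W)
      <= C * (T / N%:R) `^ (2^-1 + 3 / 2 * alpha 0).
Proof.
have [ut hdt [hu2 hu0 heq]] := hu.
have [al01 _] := order_bounds hT halpha halphastar.
have /andP[a0 a1] := al01.
have zT : (0 : R) <= 0 <= T by rewrite lexx (ltW hT).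
have Cq0 : 0 <= Cq by case: (hCq 0 zT) => h _; exact: le_trans (normr_ge0 _) h.
have [K K0 HR] := residual_bound hT hsigma halphaW halpha halphastar hct hf hdt hu2 hu0 heq
  hdq hCq hreg hF.
have dqi := dq_integ hT hdq hCq.
pose D := 4 * expR (16 * Cq ^+ 2 * T * T).
have D0 : 0 <= D by rewrite mulr_ge0 ?expR_ge0.
pose C := Num.sqrt (expR (`|- kappa sigma r| * (`|a| + `|b|)) ^+ 2 *
  (D * (K ^+ 2 * (T `^ (alpha 0) / alpha 0)))).
(* [C] may vanish; the added 1 makes the constant positive. *)
exists (C + 1); first by rewrite ltr_wpDl// sqrtr_ge0.
pose B := 8 * Cq ^+ 2 * T.
have B0 : 0 <= B by rewrite !mulr_ge0 ?sqr_ge0 ?(ltW hT).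
(* Then [B] times the step is at most 1/2, the smallness condition of [energy_estimate]; the 1
   covers the case [B = 0]. *)
exists ((2 * (B + 1))^-1); first by rewrite invr_gt0 mulr_gt0// ltr_wpDl.
move=> N W N0 small [WH _ Weq].
pose e n := fun x => omega sigma r ct u x (grid T N n) - W n x.
pose e1 n := fun x => omega1 sigma r a b ct u (grid T N n) x - Dx a b (W n) x.
pose e2 n := fun x => omega2 sigma r a b ct u (grid T N n) x - Dx a b (Dx a b (W n)) x.
have gb n : (1 <= n <= N)%N -> 0 <= grid T N n <= T.
  by move=> /(grid_bounds hT) /andP[/ltW -> ->].
have He n : (1 <= n <= N)%N -> [/\ in_Lp 2%:E a b (e n), is_wd a b (e n) (e1 n),
    is_wd a b (e1 n) (e2 n) & green a b (e n) (e1 n)].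
  move=> nN; have tn := gb n nN; have /andP[_ nN'] := nN.
  have [/in_H2P[L0 w1 w2] g0] := WH n nN'.
  have [v1 v2] := omega_wd sigma r hct hu2 tn.
  have Lo := omega_L2 sigma r hct hu2 tn.
  have G := omega_green sigma r hT hct hu2 hu0 tn.
  split; [exact: (L2B Lo L0)|exact: (wdB Lo L0 v1 w1)| |].
  - exact: (wdB (wd_L2 v1) (wd_L2 w1) v2 w2).
  - exact: (greenB Lo L0 (wd_L2 v1) (wd_L2 w1) G (green_H10 g0 w1)).
have lm0 : 0 <= lam sigma r by rewrite /lam mulr_ge0 ?invr_ge0 ?sqr_ge0.
have sg0 : 0 <= 2^-1 * sigma ^+ 2 by rewrite mulr_ge0 ?invr_ge0 ?sqr_ge0.
have dqb s : 0 < s <= T -> `|dq s| <= Cq.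
  by move=> /andP[s0 sT]; case: (hCq s) => //; rewrite (ltW s0).
have Heq n : (1 <= n <= N)%N -> {ae @lebesgue_measure R, forall x, a < x < b ->
    e n x + \sum_(1 <= j < n.+1) weight T N dq n j * e j x
      + lam sigma r * \sum_(1 <= j < n.+1) weight T N (beta_ker (alpha 0)) n j * e j x
      - 2^-1 * sigma ^+ 2 *
        \sum_(1 <= j < n.+1) weight T N (beta_ker (alpha 0)) n j * e2 j x
    = residual T sigma r a b alpha dq ct f u N n x}.
  move=> nN; apply: (ae_mp (Weq n nN)) => x hx xab; have := hx xab.
  by rewrite /residual /e /e2 !sum_weight_sub => <-; ring.
have sm : 8 * Cq ^+ 2 * T * (T / N%:R) <= 2^-1.
  rewrite -/B; apply: (le_trans (ler_wpM2l B0 small)).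
  have B1 : 0 < B + 1 by rewrite ltr_wpDl.
  by rewrite invfM mulrCA -[leRHS]mulr1 ler_wpM2l// ler_pdivrMr// mul1r lerDl.
have HS := energy_estimate al01 hT N0 Cq0 lm0 sg0 dqi dqb He (HR N) Heq sm.
have Le n : (1 <= n <= N)%N -> in_Lp 2%:E a b (e n) by move=> /He[].
apply: (le_trans (errA_le hT al01 N0 D0 K0 Le HS)).
by apply: ler_wpM2r; [exact: powR_ge0|rewrite -/C lerDl].
Qed.
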